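(* Let $n>1$ and let $$D^{n,1}=\{(z_0,\dots,z_n)\in\mathbb{C}^{n+1}: -|z_0|^2+|z_1|^2+\cdots+|z_n|^2>0\}.$$ Then the group $\mathrm{Aut}(D^{n,1})$ of all biholomorphic self-maps of $D^{n,1}$ equals $GU(n,1)$, acting on $D^{n,1}$ by linear transformations $z\mapsto Az$.
   Context: $GU(n,1)=\{A\in GL(n+1,\mathbb{C}): A^*JA=\nu(A)J \text{ for some } \nu(A)\in\mathbb{R}_{>0}\}$, where $J=\mathrm{diag}(-1,1,\dots,1)$ (i.e. $J=\begin{pmatrix}-1&0\\0&E_n\end{pmatrix}$ with $E_n$ the $n\times n$ identity). *)

(* Defs.v *)
From HB Require Import structures.
From mathcomp Require Import all_boot all_order all_algebra.
From mathcomp Require Import complex.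
From mathcomp Require Import all_classical all_reals topology normedtype derive.
Set Implicit Arguments. Unset Strict Implicit. Unset Printing Implicit Defensive.
Import Order.TTheory GRing.Theory Num.Theory.
Import numFieldNormedType.Exports.
Local Open Scope ring_scope.
Local Open Scope complex_scope.
Local Open Scope classical_set_scope.

Definition Cn (R : realType) (n : nat) : normedModType R[i] := 'cV[R[i]]_n.+1.

Definition Dn1 (R : realType) (n : nat) : set (Cn R n) :=
  [set z | 0 < \sum_(j < n) `|z (lift ord0 j) ord0| ^+ 2 - `|z ord0 ord0| ^+ 2].

(* f is holomorphic on U: complex (Frechet) differentiable at every point
   of U, the differential being taken over the scalar field R[i]. *)
Definition holomorphic_on (R : realType) (n m : nat)
    (U : set (Cn R n)) (f : Cn R n -> Cn R m) : Prop :=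
  forall z, U z -> differentiable f z.

Definition biholomorphic_self (R : realType) (n : nat)
    (U : set (Cn R n)) (f : Cn R n -> Cn R n) : Prop :=
  [/\ holomorphic_on U f, (forall z, U z -> U (f z)) &
      exists g : Cn R n -> Cn R n,
        [/\ holomorphic_on U g, (forall z, U z -> U (g z)),
            (forall z, U z -> g (f z) = z) & (forall z, U z -> f (g z) = z)]].

Definition Jmx (R : realType) (n : nat) : 'M[R[i]]_n.+1 :=
  diag_mx (\row_(j < n.+1) (if j == ord0 then -1 else 1)).

Definition adjmx (R : realType) (m n : nat) (A : 'M[R[i]]_(m, n)) : 'M[R[i]]_(n, m) :=
  (map_mx conjc A)^T.

(* GU(n,1) = { A in GL(n+1,C) : A^* J A = nu(A) J for some real nu(A) > 0 }.
   (For a complex number, 0 < nu means nu is real and positive.) *)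
Definition GU (R : realType) (n : nat) : set 'M[R[i]]_n.+1 :=
  [set A | A \in unitmx /\
     exists nu : R[i], 0 < nu /\ adjmx A *m Jmx R n *m A = nu *: Jmx R n].

Arguments Dn1 : clear implicits.
Arguments GU : clear implicits.

(* Main.v *)
(* By a Hartogs argument f and its inverse extend to entire maps F, G of C^{n+1}, inverse to each
   other by the identity theorem.  They preserve the complement K = {|z'| <= |z_0|} of the domain.
   K is a union of complex lines through 0; on such a line the quotients F_i / F_0 are bounded by 1
   and holomorphic off at most one point, hence constant.  So F maps lines of K to lines, fixes 0,
   and is an entire bijection of C on each line, that is, homogeneous of degree one on K.  As F is
   differentiable at 0, it is linear on K and then everywhere.  A linear map preserving both signs
   of the Hermitian form preserves its null vectors, and this forces it to be a similitude.

   The complex analysis rests on averages over the 2^M-th roots of unity in place of contour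
   integrals: they are total, linear and bounded by the supremum, and the bisection proof of Goursat's
   lemma shows that they are asymptotically independent of the radius.  The maximum principle applied
   to divided differences then replaces most uses of Cauchy's formula, and limits along an ultrafilter
   replace the integral in the Hartogs extension. *)
Require Import Defs.
From HB Require Import structures.
From mathcomp Require Import all_boot all_order all_algebra.
From mathcomp Require Import complex.
From mathcomp Require Import all_classical all_reals topology normedtype derive.
From mathcomp Require Import landau interval_inference sequences exp trigo.
From mathcomp Require Import ring lra.
Set Implicit Arguments. Unset Strict Implicit. Unset Printing Implicit Defensive.
Import Order.TTheory GRing.Theory Num.Theory.
Import numFieldNormedType.Exports.
Import ComplexField.Normc.
Local Open Scope ring_scope.
Local Open Scope complex_scope.
Local Open Scope classical_set_scope.
Local Notation Re := complex.Re.
Local Notation Im := complex.Im.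

(** * The complex modulus with real values *)

(* The norm of [R[i]] takes its values in [R[i]], where the order is only partial; [normc] is
   real-valued, so that [lra] applies. *)
Section ComplexModulus.
Variable R : realType.
Implicit Types (x y z : R[i]) (a b : R).

(** The domain itself gives no growth control, whereas on its complement the single negative
    direction dominates: there every coordinate is bounded by [z_0]. This is why linearity is sought
    on the complement, although the maps are at first defined only outside it.

    One estimate carries the one-variable theory: [q (a + h) - q a - d * h] is at most
    [32 * B / r ^+ 2 * normc h ^+ 2] when [q] is bounded by [B] on the circle of radius [r], even if
    [q] is only continuous at [a]. It yields removable singularities, Liouville's theorem for linear
    growth, and, being uniform in [q], differentiability of limits of bounded families.

    The averages are compared with one another, but for a function with a hole inside the circle
    their convergence is never established. A fixed ultrafilter assigns a limit to every bounded
    sequence, additively and respecting bounds, and this suffices to define the extension. *)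

Lemma normr_normc z : `|z| = (normc z)%:C.
Proof. by case: z. Qed.

Lemma normcD x y : normc (x + y) <= normc x + normc y.
Proof. exact: le_normcD. Qed.

Lemma normc_ge0 z : 0 <= normc z :> R.
Proof. by case: z => a b; exact: sqrtr_ge0. Qed.

Lemma normc_opp z : normc (- z) = normc z :> R.
Proof. exact: normcN. Qed.

Lemma normcB x y : normc (x - y) <= normc x + normc y.
Proof. by rewrite -(normc_opp y) normcD. Qed.

Lemma normc_distC x y : normc (x - y) = normc (y - x).
Proof. by rewrite -normc_opp opprB. Qed.

Lemma normc_ler_dist x y : normc x - normc y <= normc (x - y).
Proof. by rewrite lerBlDr; have := normcD (x - y) y; rewrite subrK. Qed.

Lemma normcr a : normc a%:C = `|a|.
Proof. by rewrite /normc /= expr0n addr0 sqrtr_sqr. Qed.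

Lemma normc_i : normc 'i = 1 :> R.
Proof. by rewrite /normc /= expr0n add0r expr1n sqrtr1. Qed.

Lemma normc_mul x y : normc (x * y) = normc x * normc y :> R.
Proof. exact: normcM. Qed.

Lemma normc_inv x : normc x^-1 = (normc x)^-1 :> R.
Proof. exact: normcV. Qed.

Lemma normc_div x y : normc (x / y) = normc x / normc y :> R.
Proof. by rewrite normc_mul normc_inv. Qed.

Lemma normc_exp x n : normc (x ^+ n) = normc x ^+ n :> R.
Proof.
elim: n => [|n IHn]; first by rewrite !expr0 normc1.
by rewrite !exprS normc_mul IHn.
Qed.

Lemma normc_eq0 x : (normc x == 0 :> R) = (x == 0).
Proof.
apply/eqP/eqP => [|->]; [exact: eq0_normc | exact: normc0].
Qed.

Lemma normc_gt0 x : (0 < normc x :> R) = (x != 0).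
Proof. by rewrite lt0r normc_eq0 normc_ge0 andbT. Qed.

Lemma normc_le0 x : normc x <= 0 :> R -> x = 0.
Proof. by move=> h; apply/eqP; rewrite -normc_eq0 eq_le h normc_ge0. Qed.

Lemma normc_sqr z : normc z ^+ 2 = Re z ^+ 2 + Im z ^+ 2.
Proof. by case: z => a b; rewrite /normc sqr_sqrtr //= addr_ge0 ?sqr_ge0. Qed.

Lemma conjM_normc z : z^* * z = (normc z ^+ 2)%:C.
Proof.
by rewrite normc_sqr; case: z => a b; apply/eqP; rewrite eq_complex /=; apply/andP; split; apply/eqP; ring.
Qed.

Lemma Re_le_normc z : `|Re z| <= normc z.
Proof.
rewrite -ler_sqr ?nnegrE ?normc_ge0 // normc_sqr real_normK ?num_real //.
by rewrite lerDl sqr_ge0.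
Qed.

Lemma Im_le_normc z : `|Im z| <= normc z.
Proof.
rewrite -ler_sqr ?nnegrE ?normc_ge0 // normc_sqr real_normK ?num_real //.
by rewrite lerDr sqr_ge0.
Qed.

Lemma normc_complex a b : normc (a +i* b) <= `|a| + `|b|.
Proof.
have -> : a +i* b = a%:C + 'i * b%:C by apply/eqP; rewrite eq_complex /=; apply/andP; split; apply/eqP; ring.
by apply: (le_trans (normcD _ _)); rewrite normc_mul normc_i mul1r !normcr.
Qed.

Lemma normc_nat n : normc (n%:R : R[i]) = n%:R :> R.
Proof. by rewrite -(rmorph_nat (real_complex R)) normcr normr_nat. Qed.

Lemma normc_sum (I : Type) (r : seq I) (P : pred I) (F : I -> R[i]) :
  normc (\sum_(i <- r | P i) F i) <= \sum_(i <- r | P i) normc (F i).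
Proof.
elim/big_rec2: _ => [|i y1 y2 _ h]; first by rewrite normc0.
by apply: (le_trans (normcD _ _)); rewrite lerD2l.
Qed.

Lemma normc_sum_bound (N : nat) (F : nat -> R[i]) (B : R) :
  (forall k, (k < N)%N -> normc (F k) <= B) ->
  normc (\sum_(0 <= k < N) F k) <= N%:R * B.
Proof.
move=> FB; apply: (le_trans (normc_sum _ _ _)).
apply: (@le_trans _ _ (\sum_(0 <= k < N) B)).
  by rewrite !big_seq; apply: ler_sum => k; rewrite mem_index_iota => /andP[_ /FB].
by rewrite sumr_const_nat subn0 mulr_natl lexx.
Qed.

Lemma ler_eps (x y : R) : (forall e, 0 < e -> x <= y + e) -> x <= y.
Proof.
move=> h; rewrite leNgt; apply/negP => yx.
have : x <= y + (x - y) / 2 by apply: h; lra.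
lra.
Qed.

End ComplexModulus.

(** * Bisection and Goursat's lemma *)

Section DyadicBisection.
Variable R : realType.

Definition dyad (m : nat) : R := 2^-1 ^+ m.

Lemma dyad0 : dyad 0 = 1. Proof. exact: expr0. Qed.

Lemma dyadS m : dyad m.+1 = dyad m / 2.
Proof. by rewrite /dyad exprSr. Qed.

Lemma dyad_gt0 m : 0 < dyad m.
Proof. by rewrite exprn_gt0 // invr_gt0. Qed.

Lemma dyadV m : dyad m = (2 ^ m)%:R^-1.
Proof. by rewrite /dyad natrX exprVn. Qed.

Lemma dyad_small (c d : R) : 0 < d ->
  exists m, forall k, (m <= k)%N -> c * dyad k < d.
Proof.
move=> d0; exists (Num.bound (c / d)) => k hk.
rewrite /dyad exprVn ltr_pdivrMr ?exprn_gt0 // mulrC -ltr_pdivrMr //.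
exact: upper_nthrootP.
Qed.

(** The point is the supremum of the left endpoints, since every right endpoint bounds them all. *)
Lemma nested_dyadic_point (x : nat -> R) (X : R) : 0 <= X ->
  (forall m, x m <= x m.+1 /\ x m.+1 + X * dyad m.+1 <= x m + X * dyad m) ->
  exists c, forall m, x m <= c <= x m + X * dyad m.
Proof.
move=> X0 hx.
have Xd m : 0 <= X * dyad m by rewrite mulr_ge0 // ltW // dyad_gt0.
have xle m k : x m <= x (m + k)%N.
  by elim: k => [|k IH]; rewrite ?addn0 // addnS (le_trans IH) //; have [] := hx (m + k)%N.
have yle m k : x (m + k)%N + X * dyad (m + k) <= x m + X * dyad m.
  by elim: k => [|k IH]; rewrite ?addn0 // addnS (le_trans _ IH) //; have [] := hx (m + k)%N.
have xy i j : x i <= x j + X * dyad j.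
  case: (leqP i j) => [/subnKC <-|/ltnW /subnKC <-].
    by apply: (le_trans (xle i (j - i)%N)); rewrite lerDl.
  by apply: (le_trans _ (yle j (i - j)%N)); rewrite lerDl.
have E0 : range x !=set0 by exists (x 0%N); exists 0%N.
exists (sup (range x)) => m; apply/andP; split.
  apply: ub_le_sup; last by exists m.
  by exists (x 0%N + X * dyad 0) => _ [k _ <-].
by apply: ge_sup => // _ [k _ <-].
Qed.

(** [P m x y] speaks of the rectangle with lower left corner [(x, y)] and sides [X / 2^m],
    [Y / 2^m]. A rectangle where [P] fails has a failing quarter; the nested failing rectangles
    shrink to a point, where the local hypothesis contradicts failure. It serves both Goursat's
    lemma and the compactness of discs. *)
Lemma dyadic_bisection (P : nat -> R -> R -> Prop) (X Y x0 y0 : R) :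
  0 <= X -> 0 <= Y ->
  (forall m x y,
     P m.+1 x y -> P m.+1 (x + X * dyad m.+1) y ->
     P m.+1 x (y + Y * dyad m.+1) ->
     P m.+1 (x + X * dyad m.+1) (y + Y * dyad m.+1) -> P m x y) ->
  (forall x y, x0 <= x <= x0 + X -> y0 <= y <= y0 + Y ->
     exists2 d, 0 < d & forall m a b, a <= x <= a + X * dyad m ->
       b <= y <= b + Y * dyad m -> (X + Y) * dyad m < d -> P m a b) ->
  P 0 x0 y0.
Proof.
move=> X0 Y0 hsub hloc; apply: contrapT => nP0.
(* The condition that [P] fails is part of [ok], so every rectangle has a successor (a dummy one if
   [P] holds) and [choice] gives a total function. *)
pose ok m (p q : R * R) := ~ P m p.1 p.2 -> [/\ ~ P m.+1 q.1 q.2,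
  p.1 <= q.1 /\ q.1 + X * dyad m.+1 <= p.1 + X * dyad m &
  p.2 <= q.2 /\ q.2 + Y * dyad m.+1 <= p.2 + Y * dyad m].
have stepP (mp : nat * (R * R)) : exists q, ok mp.1 mp.2 q.
  case: mp => m [x y] /=.
  have [Pm|nPm] := pselect (P m x y); first by exists (0, 0) => /=.
  have hX : 0 <= X * dyad m.+1 by rewrite mulr_ge0 // ltW // dyad_gt0.
  have hY : 0 <= Y * dyad m.+1 by rewrite mulr_ge0 // ltW // dyad_gt0.
  have eX : X * dyad m = X * dyad m.+1 + X * dyad m.+1 by rewrite dyadS; field.
  have eY : Y * dyad m = Y * dyad m.+1 + Y * dyad m.+1 by rewrite dyadS; field.
  apply: contrapT => noq; apply: nPm; apply: hsub; apply: contrapT => nP; apply: noq.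
  - by exists (x, y) => _ /=; split => //; split; lra.
  - by exists (x + X * dyad m.+1, y) => _ /=; split => //; split; lra.
  - by exists (x, y + Y * dyad m.+1) => _ /=; split => //; split; lra.
  - by exists (x + X * dyad m.+1, y + Y * dyad m.+1) => _ /=; split => //; split; lra.
have [F FP] := choice stepP.
pose u := fix u m := if m is k.+1 then F (k, u k) else (x0, y0).
have nPu m : ~ P m (u m).1 (u m).2.
  by elim: m => [//|m IH]; have [] := FP (m, u m) IH.
have [x hx] : exists c, forall m, (u m).1 <= c <= (u m).1 + X * dyad m.
  by apply: nested_dyadic_point => // m; have [] := FP (m, u m) (nPu m).
have [y hy] : exists c, forall m, (u m).2 <= c <= (u m).2 + Y * dyad m.
  by apply: nested_dyadic_point => // m; have [] := FP (m, u m) (nPu m).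
have := hx 0%N; have := hy 0%N; rewrite dyad0 !mulr1 /= => hy0 hx0.
have [d d0 hd] := hloc x y hx0 hy0.
have [m /(_ m (leqnn m)) hm] := dyad_small (X + Y) d0.
exact: (nPu m (hd _ _ _ (hx m) (hy m) hm)).
Qed.

End DyadicBisection.

(** * Complex derivatives *)

Section ComplexDerivative.
Variable R : realType.
Implicit Types (f g : R[i] -> R[i]) (a d z : R[i]).

Definition ccont f a := forall e : R, 0 < e ->
  exists2 r : R, 0 < r & forall h, normc h < r -> normc (f (a + h) - f a) <= e.

Definition cderiv f a d := forall e : R, 0 < e ->
  exists2 r : R, 0 < r &
    forall h, normc h < r -> normc (f (a + h) - f a - d * h) <= e * normc h.

Definition cdiff f a := exists d, cderiv f a d.

Lemma ccont_at f a (e : R) : ccont f a -> 0 < e ->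
  exists2 r : R, 0 < r & forall z, normc (z - a) < r -> normc (f z - f a) <= e.
Proof.
move=> fa e0; have [r r0 hr] := fa e e0; exists r => // z zr.
by have := hr _ zr; rewrite [a + _]addrC subrK.
Qed.

Lemma cderiv_cont f a d : cderiv f a d -> ccont f a.
Proof.
move=> fd e e0; have [r r0 hr] := fd 1 ltr01.
have D0 : 0 < 1 + normc d by rewrite ltr_pwDl ?normc_ge0.
exists (Num.min r (e / (1 + normc d))) => [|h]; first by rewrite lt_min r0 divr_gt0.
rewrite lt_min ltr_pdivlMr // => /andP[/hr h1 h2].
have -> : f (a + h) - f a = f (a + h) - f a - d * h + d * h by ring.
by apply: (le_trans (normcD _ _)); rewrite normc_mul; lra.
Qed.

Lemma cdiff_cont f a : cdiff f a -> ccont f a.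
Proof. by move=> [d /cderiv_cont]. Qed.

Lemma ccont_cst (c : R[i]) a : ccont (fun=> c) a.
Proof. by move=> e e0; exists 1 => // h _; rewrite subrr normc0 ltW. Qed.

Lemma ccontD f g a : ccont f a -> ccont g a -> ccont (fun z => f z + g z) a.
Proof.
move=> fa ga e e0; have e2 : 0 < e / 2 by lra.
have [r r0 hr] := fa _ e2; have [s s0 hs] := ga _ e2.
exists (Num.min r s) => [|h]; first by rewrite lt_min r0.
rewrite lt_min => /andP[/hr h1 /hs h2].
rewrite opprD addrACA; apply: (le_trans (normcD _ _)); lra.
Qed.

Lemma ccontN f a : ccont f a -> ccont (fun z => - f z) a.
Proof. by move=> fa e /fa[r r0 hr]; exists r => // h /hr; rewrite -opprD normc_opp. Qed.

Lemma ccontB f g a : ccont f a -> ccont g a -> ccont (fun z => f z - g z) a.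
Proof. by move=> fa ga; apply: ccontD => //; exact: ccontN. Qed.

Lemma ccontM f g a : ccont f a -> ccont g a -> ccont (fun z => f z * g z) a.
Proof.
move=> fa ga e e0.
have F0 := normc_ge0 (f a); have G0 := normc_ge0 (g a).
pose k := 1 + normc (f a) + normc (g a); have k0 : 0 < k by rewrite /k; lra.
pose e1 := Num.min 1 (e / k).
have e10 : 0 < e1 by rewrite lt_min ltr01 divr_gt0.
have e11 : e1 <= 1 by rewrite ge_min lexx.
have e1e : e1 * k <= e by rewrite -ler_pdivlMr // ge_min lexx orbT.
have [r r0 hr] := fa _ e10; have [s s0 hs] := ga _ e10.
exists (Num.min r s) => [|h]; first by rewrite lt_min r0.
rewrite lt_min => /andP[/hr h1 /hs h2].
have -> : f (a + h) * g (a + h) - f a * g a =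
  (f (a + h) - f a) * (g (a + h) - g a) + (f (a + h) - f a) * g a + f a * (g (a + h) - g a) by ring.
have t1 := normcD ((f (a + h) - f a) * (g (a + h) - g a) + (f (a + h) - f a) * g a) (f a * (g (a + h) - g a)).
have t2 := normcD ((f (a + h) - f a) * (g (a + h) - g a)) ((f (a + h) - f a) * g a).
have b1 : normc ((f (a + h) - f a) * (g (a + h) - g a)) <= e1 * 1.
  by rewrite normc_mul ler_pM ?normc_ge0 // (le_trans h2).
have b2 : normc ((f (a + h) - f a) * g a) <= e1 * normc (g a) by rewrite normc_mul ler_wpM2r.
have b3 : normc (f a * (g (a + h) - g a)) <= normc (f a) * e1 by rewrite normc_mul ler_wpM2l.
rewrite /k in e1e; lra.
Qed.

Lemma ccont_near f g a (r : R) : 0 < r -> (forall h, normc h < r -> f (a + h) = g (a + h)) ->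
  ccont f a -> ccont g a.
Proof.
move=> r0 fg fa e e0; have [s s0 hs] := fa e e0.
exists (Num.min r s) => [|h]; first by rewrite lt_min r0.
rewrite lt_min => /andP[hr /hs]; rewrite fg //.
by have := fg 0; rewrite addr0 normc0 => ->.
Qed.

Lemma cderiv_near f g a d (r : R) : 0 < r -> (forall h, normc h < r -> f (a + h) = g (a + h)) ->
  cderiv f a d -> cderiv g a d.
Proof.
move=> r0 fg fa e e0; have [s s0 hs] := fa e e0.
exists (Num.min r s) => [|h]; first by rewrite lt_min r0.
rewrite lt_min => /andP[hr /hs]; rewrite fg //.
by have := fg 0; rewrite addr0 normc0 => ->.
Qed.

Lemma cdiff_near f g a (r : R) : 0 < r -> (forall h, normc h < r -> f (a + h) = g (a + h)) ->
  cdiff f a -> cdiff g a.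
Proof. by move=> r0 fg [d fd]; exists d; exact: cderiv_near r0 fg fd. Qed.

Lemma cderiv_cst (c : R[i]) a : cderiv (fun=> c) a 0.
Proof. by move=> e e0; exists 1 => // h _; rewrite subrr mul0r subr0 normc0 mulr_ge0 ?normc_ge0 ?ltW. Qed.

Lemma cderiv_id a : cderiv id a 1.
Proof.
move=> e e0; exists 1 => // h _.
have -> : id (a + h) - id a - 1 * h = 0 by rewrite /=; ring.
by rewrite normc0 mulr_ge0 ?normc_ge0 ?ltW.
Qed.

Lemma cderivD f g a d d' : cderiv f a d -> cderiv g a d' ->
  cderiv (fun z => f z + g z) a (d + d').
Proof.
move=> fd gd e e0; have e2 : 0 < e / 2 by lra.
have [r r0 hr] := fd _ e2; have [s s0 hs] := gd _ e2.
exists (Num.min r s) => [|h]; first by rewrite lt_min r0.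
rewrite lt_min => /andP[/hr h1 /hs h2].
have -> : f (a + h) + g (a + h) - (f a + g a) - (d + d') * h =
  (f (a + h) - f a - d * h) + (g (a + h) - g a - d' * h) by ring.
by apply: (le_trans (normcD _ _)); lra.
Qed.

Lemma cderivN f a d : cderiv f a d -> cderiv (fun z => - f z) a (- d).
Proof.
move=> fd e /fd[r r0 hr]; exists r => // h /hr.
have -> : - f (a + h) - - f a - - d * h = - (f (a + h) - f a - d * h) by ring.
by rewrite normc_opp.
Qed.

Lemma cderivM f g a d d' : cderiv f a d -> cderiv g a d' ->
  cderiv (fun z => f z * g z) a (d * g a + f a * d').
Proof.
move=> fd gd e e0.
pose k := 1 + normc (g a) + normc d + normc (f a).
have k0 : 0 < k by rewrite /k; have := normc_ge0 (g a); have := normc_ge0 d; have := normc_ge0 (f a); lra.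
pose e1 := Num.min 1 (e / (3 * k)).
have e10 : 0 < e1 by rewrite lt_min ltr01 divr_gt0 // mulr_gt0.
have e1e : e1 * (3 * k) <= e by rewrite -ler_pdivlMr ?mulr_gt0 // ge_min lexx orbT.
have e11 : e1 <= 1 by rewrite ge_min lexx.
have [r r0 hr] := fd _ e10; have [s s0 hs] := gd _ e10.
have [t t0 ht] := cderiv_cont gd e10.
exists (Num.min r (Num.min s t)) => [|h]; first by rewrite !lt_min r0 s0.
rewrite !lt_min => /andP[/hr h1 /andP[/hs h2 /ht h3]].
have -> : f (a + h) * g (a + h) - f a * g a - (d * g a + f a * d') * h =
  (f (a + h) - f a - d * h) * g a + (f (a + h) - f a - d * h) * (g (a + h) - g a)
  + d * h * (g (a + h) - g a) + f a * (g (a + h) - g a - d' * h) by ring.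
apply: (le_trans (normcD _ _)); rewrite normc_mul.
have H0 := normc_ge0 h; have G0 := normc_ge0 (g a); have D0 := normc_ge0 d; have F0 := normc_ge0 (f a).
have b4 : normc (f a) * normc (g (a + h) - g a - d' * h) <= normc (f a) * (e1 * normc h) by rewrite ler_wpM2l.
have b3 : normc (d * h * (g (a + h) - g a)) <= normc d * normc h * e1.
  by rewrite !normc_mul ler_wpM2l // mulr_ge0.
have b2 : normc ((f (a + h) - f a - d * h) * (g (a + h) - g a)) <= e1 * normc h * 1.
  by rewrite normc_mul ler_pM ?normc_ge0 // (le_trans h3).
have b1 : normc ((f (a + h) - f a - d * h) * g a) <= e1 * normc h * normc (g a).
  by rewrite normc_mul ler_wpM2r.
have t1 := normcD ((f (a + h) - f a - d * h) * g a) ((f (a + h) - f a - d * h) * (g (a + h) - g a)).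
have t2 := normcD ((f (a + h) - f a - d * h) * g a + (f (a + h) - f a - d * h) * (g (a + h) - g a)) (d * h * (g (a + h) - g a)).
apply: (@le_trans _ _ (e1 * k * normc h)); first by rewrite /k; lra.
by rewrite ler_wpM2r // (le_trans _ e1e) // ler_pM2l //; lra.
Qed.

Lemma cderivV f a d : f a != 0 -> cderiv f a d ->
  cderiv (fun z => (f z)^-1) a (- d / f a ^+ 2).
Proof.
move=> fa0 fd e e0.
have F0 : 0 < normc (f a) by rewrite normc_gt0.
have D0 := normc_ge0 d.
pose m := normc (f a).
(* The first bound keeps [normc (f (a + h))] above [m / 2], so the denominator below is at least
   [m ^+ 3 / 2]; the second makes the numerator small against it. *)
pose e1 := Num.min (m / 2) (e * m ^+ 3 / (2 * (m + normc d))).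
have mD : 0 < m + normc d by rewrite ltr_pwDl.
have e10 : 0 < e1 by rewrite lt_min !divr_gt0 ?mulr_gt0 ?exprn_gt0.
have e1e : e1 * (2 * (m + normc d)) <= e * m ^+ 3 by rewrite -ler_pdivlMr ?mulr_gt0 // ge_min lexx orbT.
have e11 : e1 <= m / 2 by rewrite ge_min lexx.
have [r r0 hr] := fd _ e10; have [t t0 ht] := cderiv_cont fd e10.
exists (Num.min r t) => [|h]; first by rewrite !lt_min r0.
rewrite lt_min => /andP[/hr h1 /ht h3].
have nf : m / 2 <= normc (f (a + h)).
  have := normcB (f (a + h)) (f (a + h) - f a).
  have -> : f (a + h) - (f (a + h) - f a) = f a by ring.
  by rewrite -/m; lra.
have fh0 : f (a + h) != 0 by rewrite -normc_gt0; lra.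
have -> : (f (a + h))^-1 - (f a)^-1 - - d / f a ^+ 2 * h =
  (- (f a * (f (a + h) - f a - d * h)) + d * h * (f (a + h) - f a)) / (f (a + h) * f a ^+ 2).
  by field; rewrite fa0.
rewrite normc_div ler_pdivrMr; last by rewrite normc_gt0 mulf_neq0 // expf_neq0.
apply: (le_trans (normcD _ _)); rewrite normc_opp !normc_mul -/m.
have H0 := normc_ge0 h.
apply: (@le_trans _ _ (e1 * (m + normc d) * normc h)).
  have b1 : m * normc (f (a + h) - f a - d * h) <= m * (e1 * normc h) by rewrite ler_wpM2l // ltW.
  have b2 : normc d * normc h * normc (f (a + h) - f a) <= normc d * normc h * e1 by rewrite ler_wpM2l // mulr_ge0.
  by lra.
apply: (@le_trans _ _ (e * m ^+ 3 / 2 * normc h)); first by rewrite ler_wpM2r //; lra.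
apply: (@le_trans _ _ (e * normc h * (m / 2 * (m * m)))).
  by rewrite le_eqVlt; apply/orP; left; apply/eqP; field.
by rewrite ler_wpM2l ?mulr_ge0 ?(ltW e0) // ler_wpM2r // mulr_ge0 // ltW.
Qed.

Lemma cderiv_comp f g a d d' : cderiv g a d -> cderiv f (g a) d' ->
  cderiv (fun z => f (g z)) a (d' * d).
Proof.
move=> gd fd e e0.
have D0 := normc_ge0 d; have D0' := normc_ge0 d'.
pose e1 := Num.min 1 (e / (2 + normc d + normc d')).
have k0 : 0 < 2 + normc d + normc d' by lra.
have e10 : 0 < e1 by rewrite lt_min ltr01 divr_gt0.
have e1e : e1 * (2 + normc d + normc d') <= e by rewrite -ler_pdivlMr // ge_min lexx orbT.
have e11 : e1 <= 1 by rewrite ge_min lexx.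
have [r r0 hr] := fd _ e10; have [s s0 hs] := gd _ e10.
have r2 : 0 < r / 2 by lra.
have [t t0 ht] := cderiv_cont gd r2.
exists (Num.min s t) => [|h]; first by rewrite !lt_min s0.
rewrite !lt_min => /andP[/hs h2 /ht h3].
have lt3 : normc (g (a + h) - g a) < r by lra.
have h4 := hr _ lt3; rewrite addrCA subrr addr0 in h4.
have -> : f (g (a + h)) - f (g a) - d' * d * h =
  (f (g (a + h)) - f (g a) - d' * (g (a + h) - g a)) + d' * (g (a + h) - g a - d * h) by ring.
have H0 := normc_ge0 h.
have h5 : normc (g (a + h) - g a) <= (1 + normc d) * normc h.
  have := normcD (g (a + h) - g a - d * h) (d * h).
  rewrite subrK normc_mul.
  have : e1 * normc h <= 1 * normc h by rewrite ler_wpM2r.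
  by lra.
apply: (le_trans (normcD _ _)); rewrite [normc (d' * _)]normc_mul.
have b1 : normc d' * normc (g (a + h) - g a - d * h) <= normc d' * (e1 * normc h) by rewrite ler_wpM2l.
have b2 : e1 * normc (g (a + h) - g a) <= e1 * ((1 + normc d) * normc h) by rewrite ler_wpM2l // ltW.
have b3 : e1 * (2 + normc d + normc d') * normc h <= e * normc h by rewrite ler_wpM2r.
have b4 : 0 <= e1 * normc h by rewrite mulr_ge0 // ltW.
lra.
Qed.

Lemma cderiv_unique f a d d' : cderiv f a d -> cderiv f a d' -> d = d'.
Proof.
move=> fd fd'; apply/eqP; rewrite -subr_eq0; apply/eqP/normc_le0/ler_eps => e e0.
have e2 : 0 < e / 2 by lra.
have [r r0 hr] := fd _ e2; have [s s0 hs] := fd' _ e2.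
pose t := Num.min r s / 2.
have m0 : 0 < Num.min r s by rewrite lt_min r0.
have t0 : 0 < t by rewrite /t; lra.
have nt : normc t%:C = t by rewrite normcr gtr0_norm.
have tr : t < Num.min r s by rewrite /t; lra.
move: (tr); rewrite lt_min => /andP[tr1 tr2].
have h1 : normc (f (a + t%:C) - f a - d * t%:C) <= e / 2 * normc t%:C by apply: hr; rewrite nt.
have h2 : normc (f (a + t%:C) - f a - d' * t%:C) <= e / 2 * normc t%:C by apply: hs; rewrite nt.
have := normcB (f (a + t%:C) - f a - d' * t%:C) (f (a + t%:C) - f a - d * t%:C).
have -> : f (a + t%:C) - f a - d' * t%:C - (f (a + t%:C) - f a - d * t%:C) = (d - d') * t%:C by ring.
rewrite normc_mul nt in h1 h2 *.
move=> h3; rewrite add0r -(ler_pM2r t0); lra.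
Qed.

Lemma cdiff_cst (c : R[i]) a : cdiff (fun=> c) a.
Proof. by exists 0; exact: cderiv_cst. Qed.

Lemma cdiff_id a : cdiff id a.
Proof. by exists 1; exact: cderiv_id. Qed.

Lemma cdiffD f g a : cdiff f a -> cdiff g a -> cdiff (fun z => f z + g z) a.
Proof. by move=> [d fd] [d' gd]; eexists; exact: cderivD fd gd. Qed.

Lemma cdiffN f a : cdiff f a -> cdiff (fun z => - f z) a.
Proof. by move=> [d fd]; eexists; exact: cderivN fd. Qed.

Lemma cdiffB f g a : cdiff f a -> cdiff g a -> cdiff (fun z => f z - g z) a.
Proof. by move=> fd gd; apply: cdiffD => //; exact: cdiffN. Qed.

Lemma cdiffM f g a : cdiff f a -> cdiff g a -> cdiff (fun z => f z * g z) a.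
Proof. by move=> [d fd] [d' gd]; eexists; exact: cderivM fd gd. Qed.

Lemma cdiffV f a : f a != 0 -> cdiff f a -> cdiff (fun z => (f z)^-1) a.
Proof. by move=> fa0 [d fd]; eexists; exact: cderivV fd. Qed.

Lemma cdiff_div f g a : g a != 0 -> cdiff f a -> cdiff g a -> cdiff (fun z => f z / g z) a.
Proof. by move=> ga0 fd gd; apply: cdiffM => //; exact: cdiffV. Qed.

Lemma cdiff_comp f g a : cdiff g a -> cdiff f (g a) -> cdiff (fun z => f (g z)) a.
Proof. by move=> [d gd] [d' fd]; eexists; exact: cderiv_comp gd fd. Qed.

Lemma cdiffX f a n : cdiff f a -> cdiff (fun z => f z ^+ n) a.
Proof.
move=> fd; elim: n => [|n IH].
  by apply: (cdiff_near ltr01 _ (cdiff_cst 1 a)) => h _; rewrite expr0.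
by apply: (cdiff_near ltr01 _ (cdiffM fd IH)) => h _; rewrite exprS.
Qed.

End ComplexDerivative.

(** * Goursat's lemma for discrete boundary sums *)

Section Goursat.
Variable R : realType.
Implicit Types (G : R[i] -> R[i]) (F : R -> R[i]) (x y : R).

Definition step_sum F x (dx : R) (K : nat) : R[i] :=
  \sum_(0 <= k < K) F (x + k%:R * dx).

Lemma step_sum_double F x dx K :
  step_sum F x dx (K + K) = step_sum F x dx K + step_sum F (x + K%:R * dx) dx K.
Proof.
rewrite /step_sum (@big_cat_nat _ _ _ K 0 (K + K)) ?leq_addr //=; congr (_ + _).
rewrite -{1}[K]add0n big_addn addnK.
by apply: eq_bigr => k _; rewrite natrD mulrDl [X in x + X]addrC addrA.
Qed.

(* Left-endpoint sums over the boundary of a rectangle: using the same nodes on opposite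
   sides makes the sum exactly zero for affine functions, without trapezoidal weights. *)
Definition boundary_sum G x y (dx dy : R) (K : nat) : R[i] :=
  dx%:C * (step_sum (fun t => G (t +i* y)) x dx K
           - step_sum (fun t => G (t +i* (y + K%:R * dy))) x dx K)
  + 'i * dy%:C * (step_sum (fun t => G ((x + K%:R * dx) +i* t)) y dy K
           - step_sum (fun t => G (x +i* t)) y dy K).

(** The four quarters have the same mesh, so the sums along a shared inner side use the same nodes
    and cancel exactly. *)
Lemma boundary_sum_double G x y dx dy K :
  boundary_sum G x y dx dy (K + K) =
  boundary_sum G x y dx dy K + boundary_sum G (x + K%:R * dx) y dx dy K
  + boundary_sum G x (y + K%:R * dy) dx dy K
  + boundary_sum G (x + K%:R * dx) (y + K%:R * dy) dx dy K.
Proof.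
rewrite /boundary_sum !step_sum_double natrD !mulrDl !addrA.
ring.
Qed.

(** For the affine part, opposite sides differ at matching nodes by the constants [B * 'i * K dy]
    and [B * K dx], whose contributions cancel. Only the error [E] remains, and it is bounded by the
    perimeter times [eta]. *)
Lemma boundary_sum_affine G x y dx dy K (A B : R[i]) (eta : R) :
  0 <= dx -> 0 <= dy -> 
  (forall s t, x <= s <= x + K%:R * dx -> y <= t <= y + K%:R * dy ->
     normc (G (s +i* t) - (A + B * (s +i* t))) <= eta) ->
  normc (boundary_sum G x y dx dy K) <= 2 * (K%:R * dx + K%:R * dy) * eta.
Proof.
move=> dx0 dy0 hG.
pose E s t := G (s +i* t) - (A + B * (s +i* t)).
have Kdx : 0 <= K%:R * dx by rewrite mulr_ge0.
have Kdy : 0 <= K%:R * dy by rewrite mulr_ge0.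
have inK (k : nat) (u : R) : (k < K)%N -> 0 <= u -> 0 <= k%:R * u <= K%:R * u.
  by move=> kK u0; rewrite mulr_ge0 //= ler_wpM2r // ler_nat ltnW.
have -> : boundary_sum G x y dx dy K =
  dx%:C * (\sum_(0 <= k < K) (E (x + k%:R * dx) y - E (x + k%:R * dx) (y + K%:R * dy)))
  + 'i * dy%:C * (\sum_(0 <= k < K) (E (x + K%:R * dx) (y + k%:R * dy) - E x (y + k%:R * dy))).
  have splitE a b : G (a +i* b) = E a b + (A + B * (a +i* b)) by rewrite /E subrK.
  have cplx a b : a +i* b = a%:C + 'i * b%:C :> R[i].
    by apply/eqP; rewrite eq_complex /=; apply/andP; split; apply/eqP; ring.
  rewrite /boundary_sum /step_sum -!sumrB.
  rewrite (eq_bigr (fun k => (E (x + k%:R * dx) y - E (x + k%:R * dx) (y + K%:R * dy))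
     - B * ('i * (K%:R * dy)%:C))); last first.
    by move=> k _; rewrite !splitE !cplx rmorphD /=; ring.
  rewrite [X in _ + _ * X](eq_bigr (fun k => (E (x + K%:R * dx) (y + k%:R * dy) - E x (y + k%:R * dy))
     + B * (K%:R * dx)%:C)); last first.
    by move=> k _; rewrite !splitE !cplx [(_ + K%:R * dx)%:C]rmorphD /=; ring.
  rewrite !big_split /= !sumrN !sumr_const_nat subn0.
  ring.
apply: (le_trans (normcD _ _)).
have b1 : normc (\sum_(0 <= k < K) (E (x + k%:R * dx) y - E (x + k%:R * dx) (y + K%:R * dy))) <= K%:R * (2 * eta).
  apply: (@normc_sum_bound _ K (fun k => E (x + k%:R * dx) y - E (x + k%:R * dx) (y + K%:R * dy))) => k kK.
  apply: (le_trans (normcB _ _)); have /andP[k0 k1] := inK _ _ kK dx0.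
  have h1 : normc (E (x + k%:R * dx) y) <= eta by apply: hG; lra.
  have h2 : normc (E (x + k%:R * dx) (y + K%:R * dy)) <= eta by apply: hG; lra.
  lra.
have b2 : normc (\sum_(0 <= k < K) (E (x + K%:R * dx) (y + k%:R * dy) - E x (y + k%:R * dy))) <= K%:R * (2 * eta).
  apply: (@normc_sum_bound _ K (fun k => E (x + K%:R * dx) (y + k%:R * dy) - E x (y + k%:R * dy))) => k kK.
  apply: (le_trans (normcB _ _)); have /andP[k0 k1] := inK _ _ kK dy0.
  have h1 : normc (E (x + K%:R * dx) (y + k%:R * dy)) <= eta by apply: hG; lra.
  have h2 : normc (E x (y + k%:R * dy)) <= eta by apply: hG; lra.
  lra.
rewrite !normc_mul normc_i mul1r !normcr !ger0_norm //.
have c1 := ler_wpM2l dx0 b1; have c2 := ler_wpM2l dy0 b2.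
apply: (le_trans (lerD c1 c2)).
by rewrite le_eqVlt; apply/orP; left; apply/eqP; ring.
Qed.

Lemma goursat G x0 y0 X Y (e : R) : 0 <= X -> 0 <= Y -> 0 < e ->
  (forall x y, x0 <= x <= x0 + X -> y0 <= y <= y0 + Y -> cdiff G (x +i* y)) ->
  exists M0, forall M, (M0 <= M)%N ->
    normc (boundary_sum G x0 y0 (X * dyad R M) (Y * dyad R M) (2 ^ M)) <= e.
Proof.
move=> X0 Y0 e0 hG.
(* The bound is proportional to the area, so it adds up over four quarters. The mesh [M] is common
   to all rectangles, while the threshold [M0] may depend on the rectangle. *)
pose P m x y := exists M0, forall M, (M0 <= M)%N -> (m <= M)%N ->
  normc (boundary_sum G x y (X * dyad R M) (Y * dyad R M) (2 ^ (M - m))) <= e * (dyad R m) ^+ 2.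
suff [M0 hM] : P 0%N x0 y0.
  by exists M0 => M MM; have := hM M MM (leq0n M); rewrite subn0 dyad0 expr1n mulr1.
have side (Z : R) M m : (m <= M)%N -> (2 ^ (M - m))%:R * (Z * dyad R M) = Z * dyad R m.
  move=> mM; rewrite !dyadV mulrCA; congr (_ * _).
  rewrite -{2}(subnK mM) expnD natrM; field.
  by rewrite !pnatr_eq0 -!lt0n !expn_gt0.
apply: (@dyadic_bisection R P X Y x0 y0) => //.
  move=> m x y [M1 h1] [M2 h2] [M3 h3] [M4 h4].
  exists (maxn m.+1 (maxn (maxn M1 M2) (maxn M3 M4))) => M.
  rewrite !geq_max => /andP[mM /andP[/andP[l1 l2] /andP[l3 l4]]] _.
  have -> : (2 ^ (M - m) = 2 ^ (M - m.+1) + 2 ^ (M - m.+1))%N.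
    by rewrite addnn -mul2n -expnS -subSn // subSS.
  rewrite boundary_sum_double !side //.
  have k1 := h1 M l1 mM; have k2 := h2 M l2 mM; have k3 := h3 M l3 mM; have k4 := h4 M l4 mM.
  have -> : e * dyad R m ^+ 2 = e * dyad R m.+1 ^+ 2 + e * dyad R m.+1 ^+ 2 + e * dyad R m.+1 ^+ 2 + e * dyad R m.+1 ^+ 2.
    by rewrite dyadS; field.
  set b1 := boundary_sum _ x y _ _ _ in k1 *; set b2 := boundary_sum _ _ y _ _ _ in k2 *.
  set b3 := boundary_sum _ x _ _ _ _ in k3 *; set b4 := boundary_sum _ _ _ _ _ _ in k4 *.
  have t1 := normcD (b1 + b2 + b3) b4; have t2 := normcD (b1 + b2) b3; have t3 := normcD b1 b2.
  by apply: (le_trans t1); apply: lerD => //; apply: (le_trans t2); apply: lerD => //; apply: (le_trans t3); apply: lerD.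
move=> x y hx hy; have [B hB] := hG x y hx hy.
(* Perimeter times diameter bound is [2 * (X + Y) ^+ 2 * dyad R m ^+ 2]; the added 1 covers a
   degenerate rectangle. *)
pose e1 := e / (2 * (X + Y) ^+ 2 + 1).
have D0 : 0 < 2 * (X + Y) ^+ 2 + 1 by rewrite ltr_wpDl // mulr_ge0 // sqr_ge0.
have e10 : 0 < e1 by rewrite divr_gt0.
have [d d0 hd] := hB _ e10.
exists d => // m a b hxa hyb md; exists 0%N => M _ mM.
have dm : 0 < dyad R m by exact: dyad_gt0.
apply: (le_trans (@boundary_sum_affine G a b _ _ _ (G (x +i* y) - B * (x +i* y)) B (e1 * ((X + Y) * dyad R m)) _ _ _)).
- by rewrite mulr_ge0 // ltW // dyad_gt0.
- by rewrite mulr_ge0 // ltW // dyad_gt0.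
- move=> s t; rewrite !side // => hs ht.
  have nst : normc ((s +i* t) - (x +i* y)) <= (X + Y) * dyad R m.
    have -> : (s +i* t) - (x +i* y) = (s - x) +i* (t - y) :> R[i] by [].
    apply: (le_trans (normc_complex _ _)).
    have : `|s - x| <= X * dyad R m by rewrite ler_distl; apply/andP; split; lra.
    have : `|t - y| <= Y * dyad R m by rewrite ler_distl; apply/andP; split; lra.
    lra.
  have := hd ((s +i* t) - (x +i* y)) (le_lt_trans nst md).
  rewrite addrCA subrr addr0 => h.
  have -> : G (s +i* t) - (G (x +i* y) - B * (x +i* y) + B * (s +i* t)) =
    G (s +i* t) - G (x +i* y) - B * ((s +i* t) - (x +i* y)) by ring.
  by apply: (le_trans h); rewrite ler_wpM2l // ltW.
rewrite !side // -!mulrDl.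
have -> : 2 * ((X + Y) * dyad R m) * (e1 * ((X + Y) * dyad R m)) =
  e1 * (2 * (X + Y) ^+ 2) * dyad R m ^+ 2 by ring.
rewrite ler_wpM2r ?sqr_ge0 //.
have <- : e1 * (2 * (X + Y) ^+ 2 + 1) = e by rewrite /e1 divfK // gt_eqF.
by rewrite ler_wpM2l ?lerDl // ltW.
Qed.

End Goursat.

(** * Averages over circles *)

Section CircleAverages.
Variable R : realType.
Implicit Types (f : R[i] -> R[i]) (c z w : R[i]) (r t : R).

Lemma is_derive_eps (f : R -> R) (x d : R) : is_derive x 1 f d ->
  forall e, 0 < e -> exists2 r : R, 0 < r &
    forall h, `|h| < r -> `|f (x + h) - f x - d * h| <= e * `|h|.
Proof.
move=> [fx <-] e e0.
have /derivable_nbhsP/eqaddoP/(_ e e0)/nbhs_ballP[r /= r0 hr] := fx.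
exists r => // h hh; have := hr h; rewrite /ball /= sub0r normrN => /(_ hh) /=.
rewrite !fctE /= /shift /= opprD addrA [h *: 1]mulr1 [h + x]addrC.
by rewrite [h *: _]mulrC.
Qed.

Definition cis t : R[i] := cos t +i* sin t.

Definition cexp w : R[i] := (expR (Re w))%:C * cis (Im w).

Lemma cisD s t : cis (s + t) = cis s * cis t.
Proof. by rewrite /cis cosD sinD; apply/eqP; rewrite eq_complex /= eqxx [X in _ == X]addrC eqxx. Qed.

Lemma normc_cis t : normc (cis t) = 1 :> R.
Proof. by rewrite /normc /= cos2Dsin2 sqrtr1. Qed.

Lemma cexpD w z : cexp (w + z) = cexp w * cexp z.
Proof. by case: w z => [a b] [s t]; rewrite /cexp /= expRD cisD rmorphM /=; ring. Qed.

Lemma cis_eps e : 0 < e -> exists2 r : R, 0 < r &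
  forall t, `|t| < r -> normc (cis t - 1 - 'i * t%:C) <= e * `|t|.
Proof.
move=> e0; have e2 : 0 < e / 2 by lra.
have [r r0 hr] := is_derive_eps (is_derive_cos (0 : R)) e2.
have [s s0 hs] := is_derive_eps (is_derive_sin (0 : R)) e2.
exists (Num.min r s) => [|t]; first by rewrite lt_min r0.
rewrite lt_min => /andP[/hr h1 /hs h2].
have -> : cis t - 1 - 'i * t%:C = (cos t - 1) +i* (sin t - t).
  by apply/eqP; rewrite eq_complex /=; apply/andP; split; apply/eqP; ring.
apply: (le_trans (normc_complex _ _)).
move: h1 h2; rewrite !add0r cos0 sin0 oppr0 mul0r !subr0 mul1r ?addr0.
by lra.
Qed.

Lemma cexp_eps e : 0 < e -> exists2 r : R, 0 < r &
  forall h, normc h < r -> normc (cexp h - 1 - h) <= e * normc h.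
Proof.
move=> e0; pose e1 := Num.min 1 (e / 8).
have e10 : 0 < e1 by rewrite lt_min ltr01; lra.
have e11 : e1 <= 1 by rewrite ge_min lexx.
have e1e : e1 <= e / 8 by rewrite ge_min lexx orbT.
have [r r0 hr] := is_derive_eps (is_derive_expR (0 : R)) e10.
have [s s0 hs] := cis_eps e10.
exists (Num.min e1 (Num.min r s)) => [|h]; first by rewrite lt_min e10 lt_min r0.
rewrite lt_min => /andP[he]; rewrite lt_min => /andP[hhr hhs].
have ha := Re_le_normc h; have hb := Im_le_normc h; have H0 := normc_ge0 h.
have h1 := hr _ (le_lt_trans ha hhr); have h2 := hs _ (le_lt_trans hb hhs).
rewrite add0r expR0 mul1r in h1.
set a := Re h in ha h1 *; set b := Im h in hb h2 *.
pose rho1 := (expR a)%:C - 1 - a%:C; pose rho2 := cis b - 1 - 'i * b%:C.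
have n1 : normc rho1 <= e1 * normc h.
  have -> : rho1 = (expR a - 1 - a)%:C by rewrite /rho1 !rmorphB rmorph1.
  by rewrite normcr (le_trans h1) // ler_wpM2l // ltW.
have n2 : normc rho2 <= e1 * normc h by rewrite (le_trans h2) // ler_wpM2l // ltW.
have na : normc a%:C <= normc h by rewrite normcr.
have nb : normc ('i * b%:C) <= normc h by rewrite normc_mul normc_i mul1r normcr.
(* This expands [(1 + a + rho1) * (1 + 'i b + rho2)]. The terms add up to at most
   [6 * e1 * normc h], which the divisor 8 in [e1] absorbs. *)
have -> : cexp h - 1 - h = ('i * b%:C) * a%:C + a%:C * rho2 + rho2 + rho1 * (1 + 'i * b%:C + rho2).
  rewrite /cexp -/a -/b /rho1 /rho2 [h in LHS]complexE complexiE -/a -/b -complexiE; ring.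
have ee1 : e1 * normc h <= normc h by rewrite ler_piMl.
have p1 : normc (('i * b%:C) * a%:C) <= normc h * e1.
  by rewrite normc_mul ler_pM ?normc_ge0 // (le_trans na) // ltW.
have p2 : normc (a%:C * rho2) <= 1 * (e1 * normc h).
  by rewrite normc_mul ler_pM ?normc_ge0 // (le_trans na) // (le_trans (ltW he)).
have p3 : normc (1 + 'i * b%:C + rho2) <= 3.
  have := normcD (1 + 'i * b%:C) rho2; have := normcD 1 ('i * b%:C); rewrite normc1; lra.
have p4 : normc (rho1 * (1 + 'i * b%:C + rho2)) <= e1 * normc h * 3.
  by rewrite normc_mul ler_pM ?normc_ge0.
have t1 := normcD (('i * b%:C) * a%:C + a%:C * rho2 + rho2) (rho1 * (1 + 'i * b%:C + rho2)).
have t2 := normcD (('i * b%:C) * a%:C + a%:C * rho2) rho2.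
have t3 := normcD (('i * b%:C) * a%:C) (a%:C * rho2).
have e1h : e1 * normc h <= e / 8 * normc h by rewrite ler_wpM2r.
have eh : 0 <= e * normc h by rewrite mulr_ge0 // ltW.
clear -t1 t2 t3 p1 p2 n2 p4 e1h eh; lra.
Qed.

Lemma cdiff_cexp w : cdiff cexp w.
Proof.
exists (cexp w) => e e0.
have D0 : 0 < 1 + normc (cexp w) by have := normc_ge0 (cexp w); lra.
have e10 : 0 < e / (1 + normc (cexp w)) by rewrite divr_gt0.
have [r r0 hr] := cexp_eps e10; exists r => // h /hr {}hr.
have -> : cexp (w + h) - cexp w - cexp w * h = cexp w * (cexp h - 1 - h) by rewrite cexpD; ring.
rewrite normc_mul.
have H0 := normc_ge0 h.
apply: (@le_trans _ _ ((1 + normc (cexp w)) * (e / (1 + normc (cexp w)) * normc h))).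
  by rewrite ler_pM ?normc_ge0 // lerDr.
by rewrite mulrA [_ * (e / _)]mulrC divfK ?gt_eqF.
Qed.

Definition cnode c r (M k : nat) : R[i] := c + r%:C * cis (k%:R * (pi *+ 2 * dyad R M)).

Definition avg f c r (M : nat) : R[i] :=
  (dyad R M)%:C * \sum_(0 <= k < 2 ^ M) f (cnode c r M k).

Definition tends0 (u : nat -> R[i]) :=
  forall e : R, 0 < e -> exists M0, forall M, (M0 <= M)%N -> normc (u M) <= e.

Lemma tends0D (u v : nat -> R[i]) : tends0 u -> tends0 v -> tends0 (fun M => u M + v M).
Proof.
move=> hu hv e e0; have e2 : 0 < e / 2 by lra.
have [M1 h1] := hu _ e2; have [M2 h2] := hv _ e2; exists (maxn M1 M2) => M.
rewrite geq_max => /andP[/h1 {}h1 /h2 {}h2]; apply: (le_trans (normcD _ _)); lra.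
Qed.

Lemma tends0Ml (u : nat -> R[i]) a : tends0 u -> tends0 (fun M => a * u M).
Proof.
move=> hu e e0; have D0 : 0 < 1 + normc a by have := normc_ge0 a; lra.
have e1 : 0 < e / (1 + normc a) by rewrite divr_gt0.
have [M0 h] := hu _ e1; exists M0 => M /h {}h; rewrite normc_mul.
have -> : e = (1 + normc a) * (e / (1 + normc a)) by rewrite mulrC divfK ?gt_eqF.
by rewrite ler_pM ?normc_ge0 // lerDr.
Qed.

Lemma tends0_ext (u v : nat -> R[i]) : (forall M, u M = v M) -> tends0 u -> tends0 v.
Proof. by move=> uv hu e /hu[M0 h]; exists M0 => M; rewrite -uv; exact: h. Qed.

Lemma normc_cnode c r M k : 0 <= r -> normc (cnode c r M k - c) = r.
Proof.
move=> r0; rewrite /cnode addrAC subrr add0r normc_mul normc_cis mulr1 normcr ger0_norm //.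
Qed.

Lemma dyad_pow M : (2 ^ M)%:R * dyad R M = 1.
Proof. by rewrite dyadV mulfV // pnatr_eq0 -lt0n expn_gt0. Qed.

Lemma eq_avg f g c r M : (forall k, f (cnode c r M k) = g (cnode c r M k)) -> avg f c r M = avg g c r M.
Proof. by move=> fg; congr (_ * _); apply: eq_bigr => k _. Qed.

Lemma avgD f g c r M : avg (fun z => f z + g z) c r M = avg f c r M + avg g c r M.
Proof. by rewrite /avg big_split mulrDr. Qed.

Lemma avgMl a f c r M : avg (fun z => a * f z) c r M = a * avg f c r M.
Proof. by rewrite /avg -mulr_sumr mulrCA. Qed.

Lemma avg_cst a c r M : avg (fun=> a) c r M = a.
Proof.
rewrite /avg sumr_const_nat subn0 -mulr_natl mulrA -[in X in X * a](rmorph_nat (real_complex R)).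
by rewrite -rmorphM mulrC /= mulrC [_ * (2 ^ M)%:R]mulrC dyad_pow mul1r.
Qed.

Lemma avg_bound f c r M (B : R) : 0 <= r ->
  (forall z, normc (z - c) = r -> normc (f z) <= B) -> normc (avg f c r M) <= B.
Proof.
move=> r0 fB; rewrite /avg normc_mul normcr (gtr0_norm (dyad_gt0 _ _)).
apply: (@le_trans _ _ (dyad R M * ((2 ^ M)%:R * B))).
  rewrite ler_wpM2l ?(ltW (dyad_gt0 _ _)) //.
  by apply: (@normc_sum_bound _ _ (fun k => f (cnode c r M k))) => k _; apply: fB; exact: normc_cnode.
by rewrite mulrA [dyad R M * _]mulrC dyad_pow mul1r.
Qed.

(* Goursat's lemma for [w |-> f (c + exp w)]: by periodicity only the two vertical sides of the
   rectangle contribute. *)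
Lemma avg_annulus f c (r1 r2 : R) : 0 < r1 -> r1 <= r2 ->
  (forall z, r1 <= normc (z - c) <= r2 -> cdiff f z) ->
  tends0 (fun M => avg f c r2 M - avg f c r1 M).
Proof.
move=> r10 r12 fd e e0.
have r20 : 0 < r2 by lra.
pose X := ln r2 - ln r1; pose Y : R := pi *+ 2.
have X0 : 0 <= X by rewrite subr_ge0 ler_ln.
have Y0 : 0 < Y by rewrite /Y mulrn_wgt0 // pi_gt0.
pose G w := f (c + cexp w).
have Gd x y : ln r1 <= x <= ln r1 + X -> 0 <= y <= 0 + Y -> cdiff G (x +i* y).
  move=> /andP[hx1 hx2] _; apply: (@cdiff_comp _ f (fun w => c + cexp w)).
    by apply: cdiffD; [exact: cdiff_cst | exact: cdiff_cexp].
  apply: fd; rewrite addrAC subrr add0r /cexp normc_mul normc_cis mulr1 normcr ger0_norm ?expR_ge0 //=.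
  rewrite -{1}(lnK (_ : r1 \is Num.pos)) ?posrE // -{1}(lnK (_ : r2 \is Num.pos)) ?posrE //.
  rewrite !ler_expR hx1 /=; rewrite /X in hx2; lra.
(* The boundary sum will be ['i * Y] times the difference of the averages, hence the factor [Y] in
   the tolerance. *)
have eY : 0 < e * Y by rewrite mulr_gt0.
have [M0 hM] := goursat X0 (ltW Y0) eY Gd; exists M0 => M /hM {hM}.
rewrite /boundary_sum.
have perX : step_sum (fun t => G (t +i* 0)) (ln r1) (X * dyad R M) (2 ^ M) =
  step_sum (fun t => G (t +i* (0 + (2 ^ M)%:R * (Y * dyad R M)))) (ln r1) (X * dyad R M) (2 ^ M).
  apply: eq_bigr => k _; rewrite [(2 ^ M)%:R * _]mulrCA dyad_pow mulr1 add0r /G /cexp /=.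
  by rewrite /cis /Y cos2pi sin2pi cos0 sin0.
rewrite perX subrr mulr0 add0r [(2 ^ M)%:R * _]mulrCA dyad_pow mulr1.
have vert r : 0 < r -> step_sum (fun t => G (ln r +i* t)) 0 (Y * dyad R M) (2 ^ M) =
  \sum_(0 <= k < 2 ^ M) f (cnode c r M k).
  move=> rp; apply: eq_bigr => k _.
  by rewrite /G /cexp /= lnK ?posrE // add0r.
have -> : ln r1 + X = ln r2 by rewrite /X; ring.
rewrite !vert //.
set s2 := \sum_(_ <= _ < _) _; set s1 := \sum_(_ <= _ < _) f (cnode c r1 M _).
have -> : 'i * (Y * dyad R M)%:C * (s2 - s1) = 'i * Y%:C * (avg f c r2 M - avg f c r1 M).
  by rewrite /avg -/s1 -/s2 rmorphM /=; ring.
by rewrite !normc_mul normc_i mul1r normcr (gtr0_norm Y0) mulrC ler_pM2r.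
Qed.

(** On a small circle the average is close to [f c] by continuity, and [avg_annulus] carries it to
    radius [r]. Differentiability at [c] itself is left open, so that the result applies around
    isolated exceptional points. *)
Lemma mean_value f c r : 0 < r -> ccont f c ->
  (forall z, 0 < normc (z - c) <= r -> cdiff f z) ->
  tends0 (fun M => avg f c r M - f c).
Proof.
move=> r0 fc fd e e0; have e2 : 0 < e / 2 by lra.
have [s s0 hs] := ccont_at fc e2.
pose t := Num.min r (s / 2).
have t0 : 0 < t by rewrite lt_min r0; lra.
have tr : t <= r by rewrite ge_min lexx.
have ts : t < s by rewrite gt_min; apply/orP; right; lra.
have [M0 hM] := avg_annulus t0 tr (fun z (h : t <= normc (z - c) <= r) =>
  fd z (introT andP (conj (lt_le_trans t0 (proj1 (elimT andP h))) (proj2 (elimT andP h))))) e2.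
exists M0 => M /hM {}hM.
have -> : avg f c r M - f c = (avg f c r M - avg f c t M) + (avg (fun z => f z + - f c) c t M).
  by rewrite avgD avg_cst; ring.
apply: (le_trans (normcD _ _)).
have : normc (avg (fun z => f z + - f c) c t M) <= e / 2.
  by apply: avg_bound; [exact: ltW | move=> z zt; apply: hs; rewrite zt].
lra.
Qed.

End CircleAverages.

(** * The maximum principle *)

Section MaximumPrinciple.
Variable R : realType.
Implicit Types (f q : R[i] -> R[i]) (a b c z w h : R[i]) (r : R).

(** Compactness in the form of an induction principle: a property of sets that passes to subsets and
    finite unions and holds locally holds for the closed disc. *)
Lemma disc_compact (P : set R[i] -> Prop) c r :
  P set0 -> (forall A B, A `<=` B -> P B -> P A) ->
  (forall A B, P A -> P B -> P (A `|` B)) ->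
  (forall z, normc (z - c) <= r -> exists2 s : R, 0 < s & P [set w | normc (w - z) < s]) ->
  P [set w | normc (w - c) <= r].
Proof.
move=> P0 Psub PU Ploc.
case: (ltP r 0) => [rneg|r0].
  apply: (Psub _ set0) => // w /= wr; have := normc_ge0 (w - c); lra.
(* Squares are cut down to the disc, so that a small square near a point outside the disc becomes
   empty. *)
pose rect m x y : set R[i] := [set w | normc (w - c) <= r /\
  (x <= Re w <= x + 2 * r * dyad R m /\ y <= Im w <= y + 2 * r * dyad R m)].
have r20 : 0 <= 2 * r by rewrite mulr_ge0.
suff : P (rect 0%N (Re c - r) (Im c - r)).
  apply: Psub => w /= wr; split => //; rewrite dyad0 mulr1.
  have := Re_le_normc (w - c); have := Im_le_normc (w - c).
  move=> /le_trans/(_ wr); rewrite ler_norml raddfB /= => /andP[? ?].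
  move=> /le_trans/(_ wr); rewrite ler_norml raddfB /= => /andP[? ?].
  split; lra.
apply: (@dyadic_bisection R (fun m x y => P (rect m x y)) (2 * r) (2 * r)) => //.
  move=> m x y P1 P2 P3 P4.
  apply: (Psub _ _ _ (PU _ _ (PU _ _ P1 P2) (PU _ _ P3 P4))) => w [wr [/andP[h1 h2] /andP[h3 h4]]].
  have e : 2 * r * dyad R m = 2 * r * dyad R m.+1 + 2 * r * dyad R m.+1 by rewrite dyadS; field.
  rewrite e in h2 h4; rewrite /rect /=.
  case: (leP (Re w) (x + 2 * r * dyad R m.+1)) => k1;
  case: (leP (Im w) (y + 2 * r * dyad R m.+1)) => k2.
  - by left; left; split => //; split; lra.
  - by right; left; split => //; split; lra.
  - by left; right; split => //; split; lra.
  - by right; right; split => //; split; lra.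
move=> x y _ _; pose p := x +i* y.
have [d d0 hd] : exists2 d : R, 0 < d & P [set w | normc (w - p) < d /\ normc (w - c) <= r].
  case: (leP (normc (p - c)) r) => [/Ploc[s s0 Ps]|pr].
    by exists s => //; apply: Psub Ps => w [].
  exists (normc (p - c) - r); first by lra.
  apply: (Psub _ set0) => // w [/= wp wc].
  have := normcD (p - w) (w - c); rewrite (normc_distC p w) addrA subrK; lra.
exists d => // m u v hu hv md; apply: Psub hd => w [wr [h1 h2]]; split => //=.
apply: le_lt_trans md.
have -> : w - p = (Re w - x) +i* (Im w - y) by case: (w).
apply: (le_trans (normc_complex _ _)).
have : `|Re w - x| <= 2 * r * dyad R m by rewrite ler_distl; apply/andP; split; lra.
have : `|Im w - y| <= 2 * r * dyad R m by rewrite ler_distl; apply/andP; split; lra.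
lra.
Qed.

Lemma disc_bounded f c r : (forall z, normc (z - c) <= r -> ccont f z) ->
  exists2 B : R, 0 <= B & forall z, normc (z - c) <= r -> normc (f z) <= B.
Proof.
move=> fc; apply: (@disc_compact (fun A => exists2 B : R, 0 <= B & forall z, A z -> normc (f z) <= B)).
- by exists 0.
- by move=> A B AB [K K0 hK]; exists K => // z /AB /hK.
- move=> A B [K K0 hK] [L L0 hL]; exists (Num.max K L); first by rewrite le_max K0.
  by move=> z [/hK|/hL] h; rewrite le_max h ?orbT.
- move=> z /fc/ccont_at/(_ ltr01)[s s0 hs]; exists s => //.
  exists (1 + normc (f z)); first by have := normc_ge0 (f z); lra.
  move=> w /= /hs; have := normcD (f w - f z) (f z); rewrite subrK; lra.
Qed.

(** If all values stayed below the supremum [S], some bound less than [S] would hold near each point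
    by upper semicontinuity, and by compactness one such bound would hold on the whole disc. *)
Lemma disc_argmax (u : R[i] -> R) c r : 0 <= r ->
  (forall z, normc (z - c) <= r -> forall e : R, 0 < e ->
     exists2 s : R, 0 < s & forall w, normc (w - z) < s -> u w <= u z + e) ->
  exists2 z, normc (z - c) <= r & forall w, normc (w - c) <= r -> u w <= u z.
Proof.
move=> r0 uc.
have cc : normc (c - c) <= r by rewrite subrr normc0.
(* [T] is the set of admissible bounds: [setT] gives boundedness, the open ray below [S] gives the
   contradiction. *)
have bnd (T : set R) : T !=set0 -> (forall s t, T s -> T t -> T (Num.max s t)) ->
  (forall z, normc (z - c) <= r -> exists2 e : R, 0 < e & T (u z + e)) ->
  exists2 s : R, T s & forall w, normc (w - c) <= r -> u w <= s.
  move=> [t0 Tt0] Tmax Tloc.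
  have [s Ts hs] : exists2 s : R, T s & forall w, [set w | normc (w - c) <= r] w -> normc (w - c) <= r -> u w <= s.
    apply: (@disc_compact (fun A => exists2 s : R, T s & forall w, A w -> normc (w - c) <= r -> u w <= s)).
    - by exists t0.
    - by move=> A B AB [s Ts hs]; exists s => // w /AB; exact: hs.
    - move=> A B [s Ts hs] [t Tt ht]; exists (Num.max s t); first exact: Tmax.
      by move=> w [/hs h|/ht h] /h k; rewrite le_max k ?orbT.
    - move=> z zr; have [e e0 Te] := Tloc z zr; have [s s0 hs] := uc z zr e e0.
      by exists s => //; exists (u z + e) => // w /hs.
  by exists s => // w wr; exact: hs.
have [B _ hB] := bnd setT (ex_intro _ 0 I) (fun _ _ _ _ => I)
  (fun _ _ => ex_intro2 _ _ 1 ltr01 I).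
pose S := sup [set u w | w in [set w | normc (w - c) <= r]].
have uS w : normc (w - c) <= r -> u w <= S.
  move=> wr; apply: ub_le_sup; last by exists w.
  by exists B => _ [x xr <-]; exact: hB.
apply: contrapT => nomax.
have uS' w : normc (w - c) <= r -> u w < S.
  move=> wr; rewrite lt_neqAle uS // andbT; apply/negP => /eqP uwS; apply: nomax.
  by exists w => // x xr; rewrite uwS uS.
have [s /= sS hs] : exists2 s : R, s < S & forall w, normc (w - c) <= r -> u w <= s.
  apply: (bnd [set s | s < S]).
  - by exists (u c); exact: uS'.
  - by move=> s t /= sS tS; rewrite gt_max sS.
  - by move=> z /uS' zS; exists ((S - u z) / 2) => /=; lra.
suff : S <= s by lra.
by apply: ge_sup; [exists (u c); exists c | move=> _ [x xr <-]; exact: hs].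
Qed.

Lemma normc_sqr_expand a z :
  normc z ^+ 2 = normc a ^+ 2 + 2 * Re (a^* * (z - a)) + normc (z - a) ^+ 2 :> R.
Proof. by case: a z => [a b] [x y]; rewrite !normc_sqr /=; ring. Qed.

Lemma Re_avg_le f c r M (B : R) : (forall k, Re (f (cnode c r M k)) <= B) -> Re (avg f c r M) <= B.
Proof.
move=> fB; rewrite /avg.
have -> (x : R) z : Re (x%:C * z) = x * Re z by case: z => u v /=; ring.
apply: (@le_trans _ _ (dyad R M * ((2 ^ M)%:R * B))); last first.
  by rewrite mulrA [dyad R M * _]mulrC dyad_pow mul1r.
rewrite ler_wpM2l ?(ltW (dyad_gt0 _ _)) //.
elim: (2 ^ M)%N => [|N IH]; first by rewrite big_geq //= mul0r.
rewrite big_nat_recr //= raddfD /= -natr1 mulrDl mul1r; exact: lerD.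
Qed.

(* If [|q|^2 + e1 |z - c|^2] had an interior maximum at [z0], then [Re psi] would be at most
   [- e1 t^2 / 2] on the circle of radius [t] around [z0], where [psi] is the linearization below;
   but the averages of [psi] tend to [psi z0 = 0]. *)
Lemma maximum_principle q c r (B : R) : 0 < r ->
  (forall z, normc (z - c) <= r -> ccont q z) ->
  (forall z, normc (z - c) < r ->
     exists2 s : R, 0 < s & forall w, 0 < normc (w - z) < s -> cdiff q w) ->
  (forall z, normc (z - c) = r -> normc (q z) <= B) ->
  forall z, normc (z - c) <= r -> normc (q z) <= B.
Proof.
move=> r0 qc qd qB z zr.
have cr1 : normc (c + r%:C - c) = r by rewrite addrAC subrr add0r normcr gtr0_norm.
have B0 : 0 <= B by exact: le_trans (normc_ge0 _) (qB _ cr1).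
suff key e : 0 < e -> normc (q z) ^+ 2 <= B ^+ 2 + e.
  rewrite -ler_sqr ?nnegrE ?normc_ge0 //; exact: ler_eps.
move=> e0'; pose e1 := e / r ^+ 2.
have r2 : 0 < r ^+ 2 by rewrite exprn_gt0.
have e10 : 0 < e1 by rewrite divr_gt0.
pose u w : R := normc (q w) ^+ 2 + e1 * normc (w - c) ^+ 2.
have sq_close (x y d : R) : 0 <= x -> 0 <= y -> 0 < d -> y <= x + Num.min 1 (d / (2 * x + 1)) -> y ^+ 2 <= x ^+ 2 + d.
  move=> x0 y0 d0; set m := Num.min _ _ => yxm.
  have D0 : 0 < 2 * x + 1 by lra.
  have m0 : 0 < m by rewrite lt_min ltr01 divr_gt0.
  have m1 : m <= 1 by rewrite ge_min lexx.
  have m2 : m * (2 * x + 1) <= d by rewrite -ler_pdivlMr // ge_min lexx orbT.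
  have h1 : y ^+ 2 <= (x + m) ^+ 2 by rewrite ler_sqr ?nnegrE //; lra.
  have h2 : m * m <= m by rewrite ler_piMr // ltW.
  apply: (le_trans h1); rewrite (_ : (x + m) ^+ 2 = x ^+ 2 + 2 * x * m + m * m); [lra | ring].
have [z0 z0r z0max] : exists2 z, normc (z - c) <= r & forall w, normc (w - c) <= r -> u w <= u z.
  apply: disc_argmax; first exact: ltW.
  move=> x xr d d0; have d2 : 0 < d / 2 by lra.
  have d3 : 0 < d / 2 / e1 by rewrite divr_gt0.
  have m0 : 0 < Num.min 1 (d / 2 / (2 * normc (q x) + 1)).
    by rewrite lt_min ltr01 divr_gt0 //; have := normc_ge0 (q x); lra.
  have m1 : 0 < Num.min 1 (d / 2 / e1 / (2 * normc (x - c) + 1)).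
    by rewrite lt_min ltr01 divr_gt0 //; have := normc_ge0 (x - c); lra.
  have [s s0 hs] := ccont_at (qc x xr) m0.
  exists (Num.min s (Num.min 1 (d / 2 / e1 / (2 * normc (x - c) + 1)))); first by rewrite lt_min s0.
  move=> w; rewrite lt_min => /andP[/hs h1 h2].
  have k1 : normc (q w) ^+ 2 <= normc (q x) ^+ 2 + d / 2.
    apply: sq_close => //; try exact: normc_ge0.
    by have := normcD (q w - q x) (q x); rewrite subrK; lra.
  have k2 : normc (w - c) ^+ 2 <= normc (x - c) ^+ 2 + d / 2 / e1.
    apply: sq_close => //; try exact: normc_ge0.
    by have := normcD (w - x) (x - c); rewrite addrA subrK; lra.
  have k3 : e1 * normc (w - c) ^+ 2 <= e1 * normc (x - c) ^+ 2 + d / 2.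
    have := ler_wpM2l (ltW e10) k2; rewrite mulrDr [e1 * (_ / e1)]mulrC divfK ?gt_eqF //.
  rewrite /u; lra.
have uz0 : u z0 <= B ^+ 2 + e.
  move: z0r; rewrite le_eqVlt => /orP[/eqP z0r|z0r].
    rewrite /u z0r /e1 divfK ?gt_eqF // lerD2r ler_sqr ?nnegrE ?normc_ge0 //; exact: qB.
  exfalso.
  have [s s0 hs] := qd z0 z0r.
  pose t := Num.min (s / 2) (r - normc (z0 - c)).
  have t0 : 0 < t by rewrite lt_min; apply/andP; split; lra.
  have ts : t < s by rewrite gt_min; apply/orP; left; lra.
  have tr : t <= r - normc (z0 - c) by rewrite ge_min lexx orbT.
  pose psi w := (q z0)^* * (q w - q z0) + e1%:C * ((z0 - c)^* * (w - z0)).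
  have psic : ccont psi z0.
    have psi1 : ccont (fun w => (q z0)^* * (q w - q z0)) z0.
      apply: ccontM; first exact: ccont_cst.
      by apply: ccontB; [exact: qc (ltW z0r) | exact: ccont_cst].
    have psi2 : ccont (fun w => e1%:C * ((z0 - c)^* * (w - z0))) z0.
      apply: cdiff_cont; apply: cdiffM; first exact: cdiff_cst.
      apply: cdiffM; first exact: cdiff_cst.
      by apply: cdiffB; [exact: cdiff_id | exact: cdiff_cst].
    exact: ccontD.
  have psid w : 0 < normc (w - z0) <= t -> cdiff psi w.
    move=> /andP[w0 wt]; apply: cdiffD; apply: cdiffM; try exact: cdiff_cst.
      apply: cdiffB; last exact: cdiff_cst.
      by apply: hs; rewrite w0 (le_lt_trans wt).
    apply: cdiffM; first exact: cdiff_cst.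
    by apply: cdiffB; [exact: cdiff_id | exact: cdiff_cst].
  have et : 0 < e1 * t ^+ 2 / 4 by rewrite divr_gt0 // mulr_gt0 // exprn_gt0.
  have [M /(_ M (leqnn _))] := mean_value t0 psic psid et.
  have -> : psi z0 = 0 by rewrite /psi !subrr !mulr0 addr0.
  rewrite subr0.
  have : Re (avg psi z0 t M) <= - (e1 * t ^+ 2 / 2).
    apply: Re_avg_le => k; set w := cnode z0 t M k.
    have wz : normc (w - z0) = t by apply: normc_cnode; exact: ltW.
    have wr : normc (w - c) <= r.
      by have := normcD (w - z0) (z0 - c); rewrite addrA subrK wz; lra.
    have := z0max w wr; rewrite /u.
    rewrite (normc_sqr_expand (q z0) (q w)) (normc_sqr_expand (z0 - c) (w - c)).
    have -> : w - c - (z0 - c) = w - z0 by ring.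
    have ReE (x : R) y y' : Re (y' + x%:C * y) = Re y' + x * Re y.
      by case: y y' => ? ? [? ?] /=; ring.
    rewrite wz /psi ReE.
    have := sqr_ge0 (normc (q w - q z0)).
    set A := Re _; set A' := Re _; lra.
  have := Re_le_normc (avg psi z0 t M); rewrite ler_norml => /andP[? _]; lra.
apply: le_trans uz0; apply: (le_trans _ (z0max z zr)); rewrite /u lerDl.
by rewrite mulr_ge0 ?sqr_ge0 // ltW.
Qed.

Lemma avoid_seq (E : seq R[i]) z :
  exists2 s : R, 0 < s & forall w, 0 < normc (w - z) < s -> w \notin E.
Proof.
elim: E => [|x E [s s0 hs]]; first by exists 1.
have [xz|xz] := eqVneq x z.
  exists s => // w ws; rewrite inE negb_or hs // andbT.
  by apply: contraTN ws => /eqP ->; rewrite xz subrr normc0 ltxx.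
have d0 : 0 < normc (x - z) by rewrite normc_gt0 subr_eq0.
exists (Num.min s (normc (x - z))) => [|w]; first by rewrite lt_min s0.
rewrite lt_min => /andP[w0 /andP[ws wx]]; rewrite inE negb_or hs ?w0 // andbT.
by apply: contraTN wx => /eqP ->; rewrite ltxx.
Qed.

(** Finitely many points of mere continuity are harmless because [maximum_principle] asks only for
    punctured neighbourhoods. Divided differences have such points at their nodes. *)
Lemma maximum_principle_seq (E : seq R[i]) q c r (B : R) : 0 < r ->
  (forall z, normc (z - c) <= r -> ccont q z) ->
  (forall z, normc (z - c) < r -> z \notin E -> cdiff q z) ->
  (forall z, normc (z - c) = r -> normc (q z) <= B) ->
  forall z, normc (z - c) <= r -> normc (q z) <= B.
Proof.
move=> r0 qc qd qB; apply: maximum_principle => // z zr.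
have [s s0 hs] := avoid_seq E z.
exists (Num.min s (r - normc (z - c))) => [|w]; first by rewrite lt_min s0; lra.
rewrite lt_min => /andP[w0 /andP[ws wr]]; apply: qd; last by rewrite hs ?w0.
by have := normcD (w - z) (z - c); rewrite addrA subrK; lra.
Qed.

End MaximumPrinciple.

(** * Holomorphic functions of one variable *)

Section HolomorphicOneVariable.
Variable R : realType.
Implicit Types (f q phi : R[i] -> R[i]) (a b c d z w h : R[i]) (r : R).

Lemma complex_dyadic_cauchy (u : nat -> R[i]) (K : R) : 0 <= K ->
  (forall n m, (n <= m)%N -> normc (u m - u n) <= K * dyad R n) ->
  exists l, forall n, normc (u n - l) <= 4 * K * dyad R n.
Proof.
move=> K0 hu.
have real_lim (x : nat -> R) : (forall n m, (n <= m)%N -> `|x m - x n| <= K * dyad R n) ->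
  exists l, forall n, `|x n - l| <= 2 * K * dyad R n.
  move=> hx; have K4 : 0 <= 4 * K by rewrite mulr_ge0.
  (* The intervals of half-length [2 * K * dyad R n] around [x n] are nested, since consecutive
     terms differ by at most [K * dyad R n]. *)
  have [m|l hl] := @nested_dyadic_point R (fun n => x n - 2 * K * dyad R n) (4 * K) K4.
    have := hx m m.+1 (leqnSn m); rewrite ler_norml dyadS => /andP[h1 h2].
    split; lra.
  exists l => n; have /andP[h1 h2] := hl n.
  rewrite ler_norml; apply/andP; split; lra.
have [|x hx] := real_lim (fun n => Re (u n)).
  by move=> n m nm; apply: le_trans (hu n m nm); rewrite /= -raddfB; exact: Re_le_normc.
have [|y hy] := real_lim (fun n => Im (u n)).
  by move=> n m nm; apply: le_trans (hu n m nm); rewrite /= -raddfB; exact: Im_le_normc.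
exists (x +i* y) => n.
have -> : u n - (x +i* y) = (Re (u n) - x) +i* (Im (u n) - y) by case: (u n).
by apply: (le_trans (normc_complex _ _)); have := hx n; have := hy n; rewrite /=; lra.
Qed.

Definition divdiff q b d z := if z == b then d else (q z - q b) / (z - b).

Lemma divdiff_near q b d z : z != b ->
  exists2 r, 0 < r & forall h, normc h < r -> (q (z + h) - q b) / (z + h - b) = divdiff q b d (z + h).
Proof.
move=> zb; exists (normc (z - b)) => [|h hr]; first by rewrite normc_gt0 subr_eq0.
rewrite /divdiff ifF //; apply/negbTE; apply: contraTneq hr => zhb.
have -> : z - b = - h by rewrite -zhb; ring.
by rewrite normc_opp ltxx.
Qed.

Lemma divdiff_cdiff q b d z : z != b -> cdiff q z -> cdiff (divdiff q b d) z.
Proof.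
move=> zb qz; have [r r0 hr] := divdiff_near q d zb.
apply: (@cdiff_near _ (fun w => (q w - q b) / (w - b)) _ _ r r0 hr); apply: cdiff_div; first by rewrite subr_eq0.
  by apply: cdiffB => //; exact: cdiff_cst.
by apply: cdiffB; [exact: cdiff_id | exact: cdiff_cst].
Qed.

Lemma divdiff_ccont q b d z : z != b -> ccont q z -> ccont (divdiff q b d) z.
Proof.
move=> zb qz; have [r r0 hr] := divdiff_near q d zb.
apply: (@ccont_near _ (fun w => (q w - q b) / (w - b)) _ _ r r0 hr); apply: ccontM.
  by apply: ccontB => //; exact: ccont_cst.
apply: cdiff_cont; apply: (@cdiffV _ (fun w => w - b)); first by rewrite subr_eq0.
by apply: cdiffB; [exact: cdiff_id | exact: cdiff_cst].
Qed.

Lemma divdiff_ccont_center q b d : cderiv q b d -> ccont (divdiff q b d) b.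
Proof.
move=> qd e e0; have [r r0 hr] := qd e e0; exists r => // h /hr {}hr.
rewrite /divdiff eqxx; case: eqVneq => [_|hb]; first by rewrite subrr normc0 ltW.
have h0 : h != 0 by apply: contraNneq hb => ->; rewrite addr0.
have -> : (q (b + h) - q b) / (b + h - b) - d = (q (b + h) - q b - d * h) / h.
  have -> : b + h - b = h by ring.
  by field.
by rewrite normc_div ler_pdivrMr // normc_gt0.
Qed.

Lemma quadratic_cderiv q a d (s K : R) : 0 < s ->
  (forall h, normc h < s -> normc (q (a + h) - q a - d * h) <= K * normc h ^+ 2) ->
  cderiv q a d.
Proof.
move=> s0 hq e e0; have D0 : 0 < 1 + `|K| by have := normr_ge0 K; lra.
exists (Num.min s (e / (1 + `|K|))) => [|h]; first by rewrite lt_min s0 divr_gt0.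
rewrite lt_min ltr_pdivlMr // => /andP[/hq h1 h2]; apply: (le_trans h1).
have H0 := normc_ge0 h; rewrite expr2 mulrA ler_wpM2r //.
have : K * normc h <= `|K| * normc h by rewrite ler_wpM2r // ler_norm.
lra.
Qed.

(* The divided differences [Q_b z = (q z - q b) / (z - b)] extend continuously to the whole disc,
   so the maximum principle applied to [Q_b - Q_b'] bounds it everywhere by a multiple of [b - b'];
   at the center [a] this makes the difference quotients of [q] at [a] Lipschitz in [b], hence
   convergent, although [q] is only assumed continuous there. *)
Lemma second_order_bound q a r (B : R) : 0 < r -> ccont q a ->
  (forall z, 0 < normc (z - a) <= r -> cdiff q z) ->
  (forall z, normc (z - a) = r -> normc (q z) <= B) ->
  exists d, forall h, normc h < r / 2 ->
    normc (q (a + h) - q a - d * h) <= 32 * B / r ^+ 2 * normc h ^+ 2.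
Proof.
move=> r0 qa qd qB.
have qc z : normc (z - a) <= r -> ccont q z.
  move=> zr; have [->//|za] := eqVneq z a.
  by apply: cdiff_cont; apply: qd; rewrite zr normc_gt0 subr_eq0 za.
have qd' z : normc (z - a) <= r -> z != a -> cdiff q z.
  by move=> zr za; apply: qd; rewrite zr normc_gt0 subr_eq0 za.
have qB' z : normc (z - a) <= r -> normc (q z) <= B.
  apply: (@maximum_principle_seq R [:: a]) => // {}z zr; rewrite inE => za.
  by apply: qd' => //; exact: ltW.
have B0 : 0 <= B by apply: le_trans (normc_ge0 _) (qB' a _); rewrite subrr normc0 ltW.
pose Q b z := divdiff q b (xget 0 [set d | cderiv q b d]) z.
have Qc b z : b != a -> normc (b - a) < r / 2 -> normc (z - a) <= r -> ccont (Q b) z.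
  move=> ba br zr; have [->|zb] := eqVneq z b.
    apply: divdiff_ccont_center; apply: (@xgetPex _ _ [set d | cderiv q b d]); apply: qd' => //; lra.
  by apply: divdiff_ccont => //; exact: qc.
have Qd b z : normc (z - a) < r -> z != a -> z != b -> cdiff (Q b) z.
  by move=> zr za zb; apply: divdiff_cdiff => //; apply: qd' => //; exact: ltW.
have far b z : normc (b - a) < r / 2 -> normc (z - a) = r -> r / 2 <= normc (z - b).
  by move=> br zr; have := normcB (z - b) (a - b); rewrite opprB addrA subrK zr (normc_distC a b); lra.
have neq b z : normc (b - a) < r / 2 -> normc (z - a) = r -> z != b.
  by move=> br zr; rewrite -subr_eq0 -normc_gt0; have := far b z br zr; lra.
have Qb b : b != a -> normc (b - a) < r / 2 -> forall z, normc (z - a) <= r -> normc (Q b z) <= 4 * B / r.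
  move=> ba br; apply: (@maximum_principle_seq R [:: a; b]) => //.
  - by move=> z; exact: Qc.
  - by move=> z zr; rewrite !inE negb_or => /andP[za zb]; exact: Qd.
  move=> z zr; rewrite /Q /divdiff (negbTE (neq b z br zr)) normc_div.
  have z0 := far b z br zr.
  have zz : 0 < normc (z - b) by lra.
  rewrite ler_pdivrMr //.
  apply: (@le_trans _ _ (2 * B)).
    apply: (le_trans (normcB _ _)).
    have : normc (q z) <= B by exact: qB.
    have : normc (q b) <= B by apply: qB'; lra.
    lra.
  have k0 : 0 <= 4 * B / r by rewrite divr_ge0 ?mulr_ge0 // ltW.
  apply: (le_trans _ (ler_wpM2l k0 z0)).
  by rewrite le_eqVlt; apply/orP; left; apply/eqP; field; rewrite gt_eqF.
(* On the circle, the numerator of the difference of two quotients is at most [(2 * B + 4 * B / r *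
   (3 / 2 * r)) * normc (b - c) = 8 * B * normc (b - c)], and its denominator is at least
   [(r / 2) ^+ 2]. *)
pose C := 32 * B / r ^+ 2.
have C0 : 0 <= C by rewrite /C divr_ge0 ?sqr_ge0 // mulr_ge0.
have QL b c : b != a -> c != a -> normc (b - a) < r / 2 -> normc (c - a) < r / 2 ->
  normc (Q b a - Q c a) <= C * normc (b - c).
  move=> ba ca br cr.
  have aa : normc (a - a) <= r by rewrite subrr normc0 ltW.
  apply: (@maximum_principle_seq R [:: a; b; c] (fun z => Q b z - Q c z)) aa => //.
  - by move=> z zr; apply: ccontB; exact: Qc.
  - move=> z zr; rewrite !inE !negb_or => /and3P[za zb zc].
    by apply: cdiffB; exact: Qd.
  move=> z zr; rewrite /Q /divdiff (negbTE (neq b z br zr)) (negbTE (neq c z cr zr)).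
  have zb0 := far b z br zr; have zc0 := far c z cr zr.
  have zb1 : 0 < normc (z - b) by lra.
  have zc1 : 0 < normc (z - c) by lra.
  have zb : z - b != 0 by rewrite -normc_gt0.
  have zc : z - c != 0 by rewrite -normc_gt0.
  have -> : (q z - q b) / (z - b) - (q z - q c) / (z - c) =
    ((b - c) * (q z - q b) + (q c - q b) * (z - b)) / ((z - b) * (z - c)) by field; rewrite ?zb ?zc.
  have qcb : normc (q c - q b) <= normc (b - c) * (4 * B / r).
    have [->|cb] := eqVneq c b; first by rewrite !subrr !normc0 mul0r.
    have : normc (Q b c) <= 4 * B / r by apply: Qb => //; lra.
    rewrite /Q /divdiff (negbTE cb) normc_div ler_pdivrMr ?normc_gt0 ?subr_eq0 //.
    by rewrite mulrC (normc_distC c b).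
  have qzb : normc (q z - q b) <= 2 * B.
    apply: (le_trans (normcB _ _)).
    have : normc (q z) <= B by exact: qB.
    have : normc (q b) <= B by apply: qB'; lra.
    lra.
  have zb2 : normc (z - b) <= 3 / 2 * r.
    by have := normcD (z - a) (a - b); rewrite addrA subrK zr (normc_distC a b); lra.
  rewrite normc_div normc_mul ler_pdivrMr ?mulr_gt0 //.
  apply: (@le_trans _ _ (C * normc (b - c) * (r / 2 * (r / 2)))); last first.
    by apply: ler_wpM2l; [rewrite mulr_ge0 ?normc_ge0 | apply: ler_pM => //; lra].
  apply: (le_trans (normcD _ _)); rewrite !normc_mul.
  apply: (@le_trans _ _ (normc (b - c) * (2 * B) + normc (b - c) * (4 * B / r) * (3 / 2 * r))).
    by apply: lerD; [apply: ler_wpM2l; rewrite ?normc_ge0 | apply: ler_pM; rewrite ?normc_ge0].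
  by rewrite le_eqVlt; apply/orP; left; apply/eqP; rewrite /C; field; rewrite gt_eqF.
(* Nodes converging to [a] at dyadic speed: by the Lipschitz bound [QL] the values [Q (bn n) a]
   converge, and their limit [d] will be the derivative at [a]. *)
pose bn n := a + (r / 4 * dyad R n)%:C.
have dn1 n : 0 < r / 4 * dyad R n by rewrite mulr_gt0 ?dyad_gt0 //; lra.
have bna n : normc (bn n - a) = r / 4 * dyad R n.
  by rewrite /bn addrAC subrr add0r normcr gtr0_norm.
have dle n m : (n <= m)%N -> dyad R m <= dyad R n.
  move=> nm; rewrite /dyad ler_wiXn2l //; lra.
have bnne n : bn n != a by rewrite -subr_eq0 -normc_gt0 bna.
have bnr n : normc (bn n - a) < r / 2.
  rewrite bna; have := dle 0%N n (leq0n n); rewrite dyad0 => h.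
  by have := ler_wpM2l (ltW r0) h; lra.
have [|n m nm|d hd] := @complex_dyadic_cauchy (fun n => Q (bn n) a) (C * (r / 4)).
- by rewrite mulr_ge0 //; lra.
- apply: (le_trans (QL _ _ (bnne m) (bnne n) (bnr m) (bnr n))).
  rewrite -mulrA ler_wpM2l //.
  have -> : bn m - bn n = (r / 4 * dyad R m - r / 4 * dyad R n)%:C by rewrite /bn rmorphB /=; ring.
  have := dle n m nm; rewrite normcr => /(ler_wpM2l (ltW r0)) k; have := dn1 m; have := dn1 n.
  rewrite ler_norml => *; apply/andP; split; lra.
exists d => h hr.
have [->|h0] := eqVneq h 0.
  by rewrite addr0 mulr0 subr0 subrr normc0 expr0n mulr0.
have H0 : 0 < normc h by rewrite normc_gt0.
have aha : a + h != a by rewrite -subr_eq0 addrAC subrr add0r.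
have ahr : normc (a + h - a) < r / 2 by rewrite addrAC subrr add0r.
have Qah : Q (a + h) a = (q (a + h) - q a) / h.
  rewrite /Q /divdiff eq_sym (negbTE aha); field; rewrite h0 /= -normc_gt0 -normc_opp.
  have -> : - (a - (a + h)) = h by ring. by [].
have -> : q (a + h) - q a - d * h = (Q (a + h) a - d) * h by rewrite Qah; field.
rewrite normc_mul expr2 mulrA ler_wpM2r ?normc_ge0 // -/C.
apply: ler_eps => e e0.
have [n /(_ n (leqnn n)) hn] := dyad_small (C * (r / 4) + 4 * (C * (r / 4))) e0.
have k1 := hd n.
have k2 := QL _ _ aha (bnne n) ahr (bnr n).
have k3 : normc (a + h - bn n) <= normc h + r / 4 * dyad R n.
  have -> : a + h - bn n = h - (bn n - a) by ring.
  by rewrite -bna; exact: normcB.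
have := normcD (Q (a + h) a - Q (bn n) a) (Q (bn n) a - d); rewrite addrA subrK.
have := ler_wpM2l C0 k3; lra.
Qed.

(** A quadratic remainder at [a] is in particular a derivative, and [second_order_bound] provides
    one from continuity at [a]. *)
Lemma removable q a r : 0 < r -> ccont q a ->
  (forall z, 0 < normc (z - a) < r -> cdiff q z) -> cdiff q a.
Proof.
move=> r0 qa qd; have r2 : 0 < r / 2 by lra.
have qd2 z : 0 < normc (z - a) <= r / 2 -> cdiff q z.
  by move=> /andP[z0 zr]; apply: qd; rewrite z0; lra.
have [z zr|B _ hB] := @disc_bounded R q a (r / 2).
  have [->//|za] := eqVneq z a.
  by apply: cdiff_cont; apply: qd2; rewrite zr normc_gt0 subr_eq0 za.
have [z zr|d hd] := second_order_bound r2 qa qd2 (B := B); first by apply: hB; rewrite zr.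
exists d; apply: (@quadratic_cderiv q a d _ (32 * B / (r / 2) ^+ 2)) hd; lra.
Qed.

Lemma cderiv_second_order q a d r (B : R) : 0 < r -> cderiv q a d ->
  (forall z, normc (z - a) <= r -> cdiff q z) ->
  (forall z, normc (z - a) = r -> normc (q z) <= B) ->
  forall h, normc h < r / 2 ->
    normc (q (a + h) - q a - d * h) <= 32 * B / r ^+ 2 * normc h ^+ 2.
Proof.
move=> r0 qad qd qB.
have [z /andP[_ /qd]//|d' hd'] := second_order_bound r0 (cderiv_cont qad) _ qB.
suff -> : d = d' by [].
apply: cderiv_unique qad _; apply: (@quadratic_cderiv q a d' _ (32 * B / r ^+ 2)) hd'; lra.
Qed.

(** With bound [K * r] on the circle of radius [r], the coefficient in the second-order estimate is
    of order [1 / r], so the remainder vanishes as [r] grows. *)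
Lemma entire_linear_growth q (K T : R) : (forall z, cdiff q z) ->
  (forall z, T <= normc z -> normc (q z) <= K * normc z) ->
  exists d, forall h, q h = q 0 + d * h.
Proof.
move=> qd qK; have [d hd] := qd 0; exists d => h.
apply/eqP; rewrite -subr_eq0 opprD addrA; apply/eqP/normc_le0/ler_eps => e e0.
pose r := 1 + `|T| + 2 * normc h + 32 * `|K| * normc h ^+ 2 / e.
have H0 := normc_ge0 h; have T0 := normr_ge0 T; have K0 := normr_ge0 K.
have t0 : 0 <= 32 * `|K| * normc h ^+ 2 / e by rewrite divr_ge0 ?mulr_ge0 ?sqr_ge0 // ltW.
have r0 : 0 < r by rewrite /r; lra.
have k : normc (q (0 + h) - q 0 - d * h) <= 32 * (`|K| * r) / r ^+ 2 * normc h ^+ 2.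
  apply: (cderiv_second_order r0 hd) => [z _|z|]; first exact: qd.
    rewrite subr0 => zr; apply: (le_trans (qK z _)); rewrite zr.
      by have := ler_norm T; rewrite /r; lra.
    by rewrite ler_wpM2r ?(ltW r0) // ler_norm.
  by rewrite /r; lra.
rewrite add0r in k; rewrite add0r; apply: (le_trans k).
have -> : 32 * (`|K| * r) / r ^+ 2 * normc h ^+ 2 = 32 * `|K| * normc h ^+ 2 / r by field; rewrite gt_eqF.
rewrite ler_pdivrMr // -ler_pdivrMl // mulrC /r; lra.
Qed.

(* [s * phi (a + s)] is entire of linear growth. *)
Lemma liouville_punctured phi a (B : R) :
  (forall z, z != a -> cdiff phi z) -> (forall z, z != a -> normc (phi z) <= B) ->
  exists c, forall z, z != a -> phi z = c.
Proof.
move=> phid phiB.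
pose q s := s * phi (a + s).
have a1 : a + 1 != a by rewrite -subr_eq0 addrAC subrr add0r oner_eq0.
have B0 : 0 <= B := le_trans (normc_ge0 _) (phiB _ a1).
have as0 s : s != 0 -> a + s != a by rewrite -[in X in _ -> X]subr_eq0 addrAC subrr add0r.
have qB s : normc (q s) <= B * normc s.
  have [->|s0] := eqVneq s 0; first by rewrite /q mul0r !normc0 mulr0.
  by rewrite /q normc_mul mulrC ler_wpM2r ?normc_ge0 // phiB // as0.
have qd s : s != 0 -> cdiff q s.
  move=> s0; apply: cdiffM; first exact: cdiff_id.
  apply: cdiff_comp; last by apply: phid; exact: as0.
  by apply: cdiffD; [exact: cdiff_cst | exact: cdiff_id].
have q0 : cdiff q 0.
  apply: (@removable q 0 1) => //.
    move=> e e0; have D0 : 0 < 1 + B by lra.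
    exists (e / (1 + B)) => [|h]; first by rewrite divr_gt0.
    rewrite ltr_pdivlMr // add0r => hb; rewrite {2}/q mul0r subr0; apply: (le_trans (qB h)).
    by have := normc_ge0 h; lra.
  by move=> z /andP[]; rewrite subr0 normc_gt0 => z0 _; exact: qd.
have [||d hd] := @entire_linear_growth q B 0.
- by move=> z; have [->|] := eqVneq z 0; [exact: q0 | exact: qd].
- by move=> z _; exact: qB.
exists d => z za; have := hd (z - a); rewrite /q mul0r add0r addrCA subrr addr0 [d * _]mulrC.
by apply: mulfI; rewrite subr_eq0.
Qed.

(* [phi (c + t) / t ^+ n] is entire for every [n], the division by zero at [t = 0] giving [0]. *)
Lemma entire_identity phi c r : 0 < r -> (forall z, cdiff phi z) ->
  (forall z, normc (z - c) < r -> phi z = 0) -> forall z, phi z = 0.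
Proof.
move=> r0 phid phi0 z.
have [->|zc] := eqVneq z c; first by apply: phi0; rewrite subrr normc0.
pose s := z - c; have s0 : 0 < normc s by rewrite normc_gt0 subr_eq0.
have [|B B0 hB] := @disc_bounded R phi c (2 * normc s).
  by move=> w _; exact/cdiff_cont.
apply/normc_le0/ler_eps => e e0; rewrite add0r.
have [n /(_ n (leqnn n)) hn] := dyad_small B e0.
pose q t := phi (c + t) / t ^+ n.
have qd t : cdiff q t.
  have [->|t0] := eqVneq t 0.
    apply: (cdiff_near r0 _ (cdiff_cst 0 0)) => h hr.
    by rewrite /q add0r phi0 ?mul0r // addrAC subrr add0r.
  apply: cdiff_div; first by rewrite expf_neq0.
    by apply: cdiff_comp; [apply: cdiffD; [exact: cdiff_cst | exact: cdiff_id] | exact: phid].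
  by apply: cdiffX; exact: cdiff_id.
(* The bound is taken on a circle of twice the modulus of [s], which gains a factor [2^-n] for
   [phi z]. *)
have : normc (q s) <= B / (2 * normc s) ^+ n.
  apply: (@maximum_principle_seq R [::] q 0 (2 * normc s)).
  - by rewrite mulr_gt0.
  - by move=> w _; exact/cdiff_cont.
  - by move=> w _ _; exact: qd.
  - move=> w; rewrite subr0 => wr; rewrite /q normc_div normc_exp wr ler_wpM2r ?invr_ge0 ?exprn_ge0 //.
      by rewrite mulr_ge0 // ltW.
    by apply: hB; rewrite addrAC subrr add0r wr.
  - by rewrite subr0; lra.
rewrite /q addrCA subrr addr0 normc_div normc_exp exprMn ler_pdivrMr ?exprn_gt0 // => k.
apply: (le_trans k); apply: ltW; apply: le_lt_trans hn.
rewrite /dyad exprVn le_eqVlt; apply/orP; left; apply/eqP; field.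
by apply/andP; split; apply: expf_neq0; [rewrite pnatr_eq0 | rewrite gt_eqF].
Qed.

Lemma avg_kernel a r : normc a < r -> tends0 (fun M => avg (fun z => z / (z - a)) 0 r M - 1).
Proof.
move=> ar; have r0 : 0 < r by have := normc_ge0 a; lra.
move=> e e0; have e2 : 0 < e / 2 by lra.
(* On this larger circle [z / (z - a) - 1 = a / (z - a)] is at most [e / 2] in modulus;
   [avg_annulus] compares it with the given circle. *)
pose r' := r + normc a / (e / 2).
have rr' : r <= r' by rewrite lerDl divr_ge0 ?normc_ge0 // ltW.
have [z zr|M0 hM] := @avg_annulus R (fun z => z / (z - a)) 0 r r' r0 rr' _ _ e2.
  apply: cdiff_div; [|exact: cdiff_id|by apply: cdiffB; [exact: cdiff_id | exact: cdiff_cst]].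
  rewrite subr_eq0; apply: contraTneq zr => ->; rewrite subr0 negb_and -ltNge ar //.
exists M0 => M /hM {}hM.
have -> : avg (fun z => z / (z - a)) 0 r M - 1 =
  avg (fun z => z / (z - a) + - 1) 0 r' M - (avg (fun z => z / (z - a)) 0 r' M - avg (fun z => z / (z - a)) 0 r M).
  by rewrite avgD avg_cst; ring.
have : normc (avg (fun z => z / (z - a) + - 1) 0 r' M) <= e / 2.
  apply: avg_bound => [|z]; first by lra.
  rewrite subr0 => zr; have za : r' - normc a <= normc (z - a).
    by have := normc_ler_dist z a; rewrite zr; lra.
  have za0 : 0 < normc (z - a) by lra.
  have -> : z / (z - a) + - 1 = a / (z - a) by field; rewrite -normc_gt0.
  rewrite normc_div ler_pdivrMr // -ler_pdivrMl // mulrC.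
  by apply: le_trans za; rewrite /r'; lra.
by have := normcB (avg (fun z => z / (z - a) + - 1) 0 r' M) (avg (fun z => z / (z - a)) 0 r' M - avg (fun z => z / (z - a)) 0 r M); lra.
Qed.

(** The kernel is [z / (z - a)] because the average integrates against [dz / z]. Splitting off
    [phi a] times the kernel leaves [psi], which is entire and vanishes at 0, so its averages tend
    to 0. *)
Lemma cauchy_formula phi a r : normc a < r -> (forall z, cdiff phi z) ->
  tends0 (fun M => avg (fun z => phi z * (z / (z - a))) 0 r M - phi a).
Proof.
move=> ar phid; have r0 : 0 < r by have := normc_ge0 a; lra.
have [d hd] := phid a.
pose psi z := z * divdiff phi a d z.
have psid z : cdiff psi z.
  apply: cdiffM; first exact: cdiff_id.
  have off w : w != a -> cdiff (divdiff phi a d) w by move=> wa; exact: divdiff_cdiff.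
  have [->|/off//] := eqVneq z a.
  apply: (@removable _ a 1) => //; first exact: divdiff_ccont_center.
  by move=> w /andP[]; rewrite normc_gt0 subr_eq0 => /off.
have m1 : tends0 (fun M => avg psi 0 r M - psi 0).
  by apply: mean_value => //; exact: cdiff_cont.
have m2 := tends0Ml (phi a) (avg_kernel ar).
apply: tends0_ext (tends0D m1 m2) => M; rewrite /psi mul0r subr0.
have -> : avg (fun z => phi z * (z / (z - a))) 0 r M =
   avg (fun z => psi z + phi a * (z / (z - a))) 0 r M.
  apply: eq_avg => k; set z := cnode _ _ _ _.
  have za : z != a.
    by apply: contraTneq ar => <-; have := normc_cnode 0 M k (ltW r0); rewrite subr0 => ->; rewrite ltxx.
  rewrite /psi /divdiff (negbTE za); field; rewrite subr_eq0 za //.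
rewrite avgD avgMl; ring.
Qed.

(* [z / alpha z] is entire without zeros, and of linear growth because [beta] is bounded on the
   unit disc. *)
Lemma entire_bijection_linear (alpha beta : R[i] -> R[i]) :
  (forall z, cdiff alpha z) -> (forall z, cdiff beta z) -> alpha 0 = 0 ->
  (forall z, alpha (beta z) = z) -> (forall z, beta (alpha z) = z) ->
  exists c, forall z, alpha z = c * z.
Proof.
move=> alphad betad alpha0 alphaK betaK.
have beta0 : beta 0 = 0 by rewrite -[in LHS]alpha0 betaK.
have [a ha] := alphad 0; have [b hb] := betad 0.
have a0 : a != 0.
  have ha' : cderiv alpha (beta 0) a by rewrite beta0.
  have h1 := cderiv_comp hb ha'.
  have h2 : cderiv (fun z => alpha (beta z)) 0 1.
    by apply: (cderiv_near ltr01 _ (cderiv_id 0)) => h _; rewrite alphaK.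
  by apply: contra_eq_neq (cderiv_unique h1 h2) => ->; rewrite mul0r eq_sym oner_eq0.
pose q0 := divdiff alpha 0 a.
have alphaN0 z : z != 0 -> alpha z != 0.
  by apply: contra_neq => az; rewrite -(betaK z) az.
have q0E z : z != 0 -> q0 z = alpha z / z by move=> z0; rewrite /q0 /divdiff (negbTE z0) alpha0 !subr0.
have q0N0 z : q0 z != 0.
  have [->|z0] := eqVneq z 0; first by rewrite /q0 /divdiff eqxx.
  by rewrite q0E // mulf_neq0 ?invr_neq0 // alphaN0.
have q0d z : cdiff q0 z.
  have off w : w != 0 -> cdiff q0 w by move=> w0; exact: divdiff_cdiff.
  have [->|/off//] := eqVneq z 0.
  apply: (@removable _ 0 1) => //; first exact: divdiff_ccont_center.
  by move=> w /andP[]; rewrite normc_gt0 subr_eq0 => /off.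
have [z _|B B0 hB] := @disc_bounded R beta 0 1; first exact: cdiff_cont.
have [z|z zB|d hd] := @entire_linear_growth (fun z => (q0 z)^-1) 1 (B + 1).
- exact: cdiffV.
- have z0 : z != 0 by rewrite -normc_gt0; lra.
  rewrite q0E // normc_inv normc_div invf_div mul1r ler_pdivrMr ?normc_gt0 ?alphaN0 //.
  rewrite ler_peMr ?normc_ge0 // leNgt; apply/negP => az.
  have : normc (beta (alpha z)) <= B by apply: hB; rewrite subr0 ltW.
  by rewrite betaK; lra.
(* The inverse of [q0] is affine and has no zero, hence is constant. *)
have d0 : d = 0.
  apply/eqP; apply: contraT => dN0.
  have := hd (- (q0 0)^-1 / d); rewrite [d * _]mulrC divfK // subrr => /eqP.
  by rewrite invr_eq0 (negbTE (q0N0 _)).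
exists a => z; have [->|z0] := eqVneq z 0; first by rewrite alpha0 mulr0.
have := hd z; rewrite d0 mul0r addr0 => /invr_inj; rewrite q0E // /q0 /divdiff eqxx => <-.
by rewrite divfK.
Qed.

End HolomorphicOneVariable.

(** * Several variables *)

Section SeveralVariables.
Variables (R : realType) (m : nat).
Local Notation vec := 'cV[R[i]]_m.
Implicit Types (F G : vec -> R[i]) (L : 'I_m -> R[i]) (z h v : vec) (s t : R[i]).

Definition vnorm h : R := \sum_i normc (h i ord0).

Lemma vnorm_ge0 h : 0 <= vnorm h.
Proof. by apply: sumr_ge0 => i _; exact: normc_ge0. Qed.

Lemma coord_le_vnorm h i : normc (h i ord0) <= vnorm h.
Proof. by rewrite /vnorm (bigD1 i) //= lerDl sumr_ge0 // => j _; exact: normc_ge0. Qed.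

Lemma coord2_le_vnorm h i j : i != j -> normc (h i ord0) + normc (h j ord0) <= vnorm h.
Proof.
move=> ij; rewrite /vnorm (bigD1 i) //= (bigD1 j) /= 1?eq_sym // addrA lerDl.
by apply: sumr_ge0 => k _; exact: normc_ge0.
Qed.

Lemma vnormZ s h : vnorm (s *: h) = normc s * vnorm h.
Proof. by rewrite /vnorm mulr_sumr; apply: eq_bigr => i _; rewrite mxE normc_mul. Qed.

Lemma vnorm0 : vnorm 0 = 0.
Proof. by rewrite /vnorm big1 // => i _; rewrite mxE normc0. Qed.

Lemma vnorm_delta i : vnorm (delta_mx i ord0) = 1.
Proof.
rewrite /vnorm (bigD1 i) //= big1 ?addr0 => [|j ji]; first by rewrite mxE !eqxx normc1.
by rewrite mxE (negbTE ji) normc0.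
Qed.

Definition linf L h : R[i] := \sum_j L j * h j ord0.

Lemma linf_bound L h : normc (linf L h) <= (\sum_j normc (L j)) * vnorm h.
Proof.
apply: (le_trans (normc_sum _ _ _)); rewrite mulr_suml; apply: ler_sum => j _.
by rewrite normc_mul ler_wpM2l ?normc_ge0 // coord_le_vnorm.
Qed.

Lemma linfZ L s h : linf L (s *: h) = s * linf L h.
Proof. by rewrite /linf mulr_sumr; apply: eq_bigr => j _; rewrite mxE mulrCA. Qed.

Lemma linfD L h v : linf L (h + v) = linf L h + linf L v.
Proof. by rewrite /linf -big_split; apply: eq_bigr => j _; rewrite mxE mulrDr. Qed.

Lemma linf_delta L i : linf L (delta_mx i ord0) = L i.
Proof.
rewrite /linf (bigD1 i) //= big1 => [|j ji]; first by rewrite mxE !eqxx mulr1 addr0.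
by rewrite mxE (negbTE ji) mulr0.
Qed.

Definition vderiv F z L := forall e : R, 0 < e ->
  exists2 r : R, 0 < r & forall h, vnorm h < r ->
    normc (F (z + h) - F z - linf L h) <= e * vnorm h.

Definition vdiff F z := exists L, vderiv F z L.

Lemma vderiv_cont F z L : vderiv F z L -> forall e : R, 0 < e ->
  exists2 r : R, 0 < r & forall h, vnorm h < r -> normc (F (z + h) - F z) <= e.
Proof.
move=> FL e e0; have [r r0 hr] := FL 1 ltr01.
have l0 : 0 <= \sum_j normc (L j) by apply: sumr_ge0 => j _; exact: normc_ge0.
have D0 : 0 < 1 + \sum_j normc (L j) by lra.
exists (Num.min r (e / (1 + \sum_j normc (L j)))) => [|h]; first by rewrite lt_min r0 divr_gt0.
rewrite lt_min ltr_pdivlMr // => /andP[/hr h1 h2].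
have := normcD (F (z + h) - F z - linf L h) (linf L h); rewrite subrK.
by have := linf_bound L h; lra.
Qed.

Lemma vderiv_near F G z L (r : R) : 0 < r -> (forall h, vnorm h < r -> F (z + h) = G (z + h)) ->
  vderiv F z L -> vderiv G z L.
Proof.
move=> r0 FG FL e e0; have [s s0 hs] := FL e e0.
exists (Num.min r s) => [|h]; first by rewrite lt_min r0.
rewrite lt_min => /andP[hr /hs]; rewrite FG //.
by have := FG 0; rewrite addr0 vnorm0 => ->.
Qed.

Lemma vdiff_near F G z (r : R) : 0 < r -> (forall h, vnorm h < r -> F (z + h) = G (z + h)) ->
  vdiff F z -> vdiff G z.
Proof. by move=> r0 FG [L FL]; exists L; exact: vderiv_near r0 FG FL. Qed.

Lemma vdiff_cst (c : R[i]) z : vdiff (fun=> c) z.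
Proof.
exists (fun=> 0) => e e0; exists 1 => // h _.
by rewrite subrr sub0r normc_opp /linf big1 ?normc0 ?mulr_ge0 ?vnorm_ge0 ?(ltW e0) // => j _; rewrite mul0r.
Qed.

Lemma vdiffD F G z : vdiff F z -> vdiff G z -> vdiff (fun y => F y + G y) z.
Proof.
move=> [L FL] [L' GL]; exists (fun j => L j + L' j) => e e0; have e2 : 0 < e / 2 by lra.
have [r r0 hr] := FL _ e2; have [s s0 hs] := GL _ e2.
exists (Num.min r s) => [|h]; first by rewrite lt_min r0.
rewrite lt_min => /andP[/hr h1 /hs h2].
have -> : linf (fun j => L j + L' j) h = linf L h + linf L' h.
  by rewrite /linf -big_split; apply: eq_bigr => j _; rewrite mulrDl.
have -> : F (z + h) + G (z + h) - (F z + G z) - (linf L h + linf L' h) =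
  (F (z + h) - F z - linf L h) + (G (z + h) - G z - linf L' h) by ring.
by apply: (le_trans (normcD _ _)); lra.
Qed.

Lemma vdiff_sum (I : Type) (rr : seq I) (Fs : I -> vec -> R[i]) z :
  (forall i, vdiff (Fs i) z) -> vdiff (fun y => \sum_(i <- rr) Fs i y) z.
Proof.
move=> Fd; elim: rr => [|i rr IH].
  by apply: (@vdiff_near (fun=> 0) _ z 1 ltr01 _ (vdiff_cst 0 z)) => h _; rewrite big_nil.
by apply: (@vdiff_near (fun y => Fs i y + \sum_(j <- rr) Fs j y) _ z 1 ltr01 _ (vdiffD (Fd i) IH)) => h _; rewrite big_cons.
Qed.

Lemma vdiffM F G z : vdiff F z -> vdiff G z -> vdiff (fun y => F y * G y) z.
Proof.
move=> [L FL] [L' GL]; exists (fun j => L j * G z + F z * L' j) => e e0.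
have l0 : 0 <= \sum_j normc (L j) by apply: sumr_ge0 => j _; exact: normc_ge0.
have F0 := normc_ge0 (F z); have G0 := normc_ge0 (G z).
pose k := 1 + normc (G z) + \sum_j normc (L j) + normc (F z).
have k0 : 0 < k by rewrite /k; lra.
pose e1 := Num.min 1 (e / k).
have e10 : 0 < e1 by rewrite lt_min ltr01 divr_gt0.
have e1e : e1 * k <= e by rewrite -ler_pdivlMr // ge_min lexx orbT.
have e11 : e1 <= 1 by rewrite ge_min lexx.
have [r r0 hr] := FL _ e10; have [s s0 hs] := GL _ e10.
have [t t0 ht] := vderiv_cont GL e10.
exists (Num.min r (Num.min s t)) => [|h]; first by rewrite !lt_min r0 s0.
rewrite !lt_min => /andP[/hr h1 /andP[/hs h2 /ht h3]].
have -> : linf (fun j => L j * G z + F z * L' j) h = linf L h * G z + F z * linf L' h.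
  by rewrite /linf mulr_suml mulr_sumr -big_split; apply: eq_bigr => j _ /=; ring.
have -> : F (z + h) * G (z + h) - F z * G z - (linf L h * G z + F z * linf L' h) =
  (F (z + h) - F z - linf L h) * G z + (F (z + h) - F z - linf L h) * (G (z + h) - G z)
  + linf L h * (G (z + h) - G z) + F z * (G (z + h) - G z - linf L' h) by ring.
have H0 := vnorm_ge0 h.
have t1 := normcD ((F (z + h) - F z - linf L h) * G z + (F (z + h) - F z - linf L h) * (G (z + h) - G z)
  + linf L h * (G (z + h) - G z)) (F z * (G (z + h) - G z - linf L' h)).
have t2 := normcD ((F (z + h) - F z - linf L h) * G z + (F (z + h) - F z - linf L h) * (G (z + h) - G z))
  (linf L h * (G (z + h) - G z)).
have t3 := normcD ((F (z + h) - F z - linf L h) * G z) ((F (z + h) - F z - linf L h) * (G (z + h) - G z)).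
have b1 : normc ((F (z + h) - F z - linf L h) * G z) <= e1 * vnorm h * normc (G z).
  by rewrite normc_mul ler_wpM2r.
have b2 : normc ((F (z + h) - F z - linf L h) * (G (z + h) - G z)) <= e1 * vnorm h * 1.
  by rewrite normc_mul ler_pM ?normc_ge0 // (le_trans h3).
have b3 : normc (linf L h * (G (z + h) - G z)) <= (\sum_j normc (L j)) * vnorm h * e1.
  by rewrite normc_mul ler_pM ?normc_ge0 // linf_bound.
have b4 : normc (F z * (G (z + h) - G z - linf L' h)) <= normc (F z) * (e1 * vnorm h).
  by rewrite normc_mul ler_wpM2l.
apply: (@le_trans _ _ (e1 * k * vnorm h)); last by rewrite ler_wpM2r.
apply: (le_trans t1); rewrite /k; clear -t2 t3 b1 b2 b3 b4; lra.
Qed.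

Lemma vdiff_coord (phi : R[i] -> R[i]) z i : cdiff phi (z i ord0) -> vdiff (fun y => phi (y i ord0)) z.
Proof.
move=> [d phid]; exists (fun j => d * (j == i)%:R) => e e0.
have [r r0 hr] := phid e e0; exists r => // h hr'.
have hi := coord_le_vnorm h i.
have -> : linf (fun j => d * (j == i)%:R) h = d * h i ord0.
  rewrite /linf (bigD1 i) //= eqxx mulr1 big1 ?addr0 // => j /negbTE ->.
  by rewrite mulr0 mul0r.
rewrite mxE; apply: (le_trans (hr _ (le_lt_trans hi hr'))).
by rewrite ler_wpM2l // ltW.
Qed.

Definition setcoord (i : 'I_m) (s : R[i]) z : vec := \col_j (if j == i then s else z j ord0).

Lemma setcoord_id i z : setcoord i (z i ord0) z = z.
Proof. by apply/matrixP => j k; rewrite (ord1 k) mxE; case: eqP => [->|]. Qed.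

Lemma setcoordD i s t z h : setcoord i (s + t) (z + h) = setcoord i s z + setcoord i t h.
Proof. by apply/matrixP => j k; rewrite (ord1 k) !mxE; case: ifP. Qed.

Lemma setcoord_line i s t z : setcoord i (s + t) z = setcoord i s z + t *: delta_mx i ord0.
Proof.
apply/matrixP => j k; rewrite (ord1 k) !mxE andbT; case: ifP => _; first by rewrite mulr1.
by rewrite mulr0 addr0.
Qed.

Lemma vnorm_setcoord i s h : vnorm (setcoord i s h) <= normc s + vnorm h.
Proof.
rewrite /vnorm (bigD1 i) //= mxE eqxx lerD2l [in leRHS](bigD1 i) //=.
apply: (@le_trans _ _ (\sum_(j < m | j != i) normc (h j ord0))); last by rewrite lerDr normc_ge0.
by apply: ler_sum => j /negbTE ji; rewrite mxE ji.
Qed.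

Lemma vdiff_setcoord F z i s : vdiff F (setcoord i s z) -> vdiff (fun y => F (setcoord i s y)) z.
Proof.
move=> [L FL]; exists (fun j => L j * (j != i)%:R) => e e0.
have [r r0 hr] := FL e e0; exists r => // h hr'.
have hi : vnorm (setcoord i 0 h) <= vnorm h.
  by apply: (le_trans (vnorm_setcoord _ _ _)); rewrite normc0 add0r.
have -> : linf (fun j => L j * (j != i)%:R) h = linf L (setcoord i 0 h).
  by apply: eq_bigr => j _; rewrite mxE; case: eqP => _ /=; rewrite ?mulr1 ?mulr0 ?mul0r.
have := hr _ (le_lt_trans hi hr'); rewrite -setcoordD addr0 => k; apply: (le_trans k).
by rewrite ler_wpM2l // ltW.
Qed.

Lemma uniform_radius (T : Type) (N : T -> R) (I : finType) (P : I -> T -> Prop) :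
  (forall i, exists2 r : R, 0 < r & forall h : T, N h < r -> P i h) ->
  exists2 r : R, 0 < r & forall h : T, N h < r -> forall i, P i h.
Proof.
move=> hP; suff [r r0 hr] : exists2 r : R, 0 < r & forall h : T, N h < r -> forall i, i \in enum I -> P i h.
  by exists r => // h /hr k i; apply: k; rewrite mem_enum.
elim: (enum I) => [|i l [r r0 hr]]; first by exists 1.
have [s s0 hs] := hP i; exists (Num.min r s) => [|h]; first by rewrite lt_min r0.
by rewrite lt_min => /andP[/hr k1 /hs k2] j; rewrite inE => /orP[/eqP ->|/k1].
Qed.

(** The chain rule along a holomorphic curve; it reduces every question in several variables to
    complex lines and their images under entire maps. *)
Lemma curve_cdiff F (g : R[i] -> vec) s :
  (forall j, cdiff (fun t => g t j ord0) s) -> vdiff F (g s) -> cdiff (fun t => F (g t)) s.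
Proof.
move=> gd [L FL].
have /choice[D hD] : forall j, exists d, cderiv (fun t => g t j ord0) s d by move=> j; exact: gd.
exists (\sum_j L j * D j) => e e0.
have l0 : 0 <= \sum_j normc (L j) by apply: sumr_ge0 => j _; exact: normc_ge0.
have d0 : 0 <= \sum_j normc (D j) by apply: sumr_ge0 => j _; exact: normc_ge0.
have m0 : 0 <= m%:R :> R by [].
pose k := 1 + m%:R + \sum_j normc (L j) + \sum_j normc (D j).
have k0 : 0 < k by rewrite /k; lra.
pose e1 := Num.min 1 (e / k).
have e10 : 0 < e1 by rewrite lt_min ltr01 divr_gt0.
have e1e : e1 * k <= e by rewrite -ler_pdivlMr // ge_min lexx orbT.
have e11 : e1 <= 1 by rewrite ge_min lexx.
have [r r0 hr] := FL _ e10.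
have [r1 r10 hr1] : exists2 r1 : R, 0 < r1 & forall t, normc t < r1 -> forall j,
    normc (g (s + t) j ord0 - g s j ord0 - D j * t) <= e1 * normc t.
  by apply: (@uniform_radius _ (@normc R) _ (fun j t => normc (g (s + t) j ord0 - g s j ord0 - D j * t) <= e1 * normc t)) => j; exact: hD.
pose K := m%:R + \sum_j normc (D j) + 1.
have K0 : 0 < K by rewrite /K; lra.
exists (Num.min r1 (r / K)) => [|t]; first by rewrite lt_min r10 divr_gt0.
rewrite lt_min ltr_pdivlMr // => /andP[/hr1 h1 h2].
have T0 := normc_ge0 t.
have et : 0 <= e1 * normc t by rewrite mulr_ge0 // ltW.
have etle : e1 * normc t <= normc t by rewrite ler_piMl.
have gK : vnorm (g (s + t) - g s) <= (m%:R * e1 + \sum_j normc (D j)) * normc t.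
  apply: (@le_trans _ _ (\sum_j (e1 * normc t + normc (D j) * normc t))).
    apply: ler_sum => j _; rewrite !mxE.
    have := normcD (g (s + t) j ord0 - g s j ord0 - D j * t) (D j * t).
    by rewrite subrK normc_mul; have := h1 j; lra.
  by rewrite big_split /= -!mulr_suml sumr_const card_ord -(mulr_natl e1) mulrDl.
have me : m%:R * e1 <= m%:R by rewrite ler_piMr.
have gr : vnorm (g (s + t) - g s) < r.
  apply: (le_lt_trans gK); apply: le_lt_trans h2; rewrite mulrC ler_wpM2l // /K; lra.
have := hr _ gr; rewrite addrCA subrr addr0 => h3.
have -> : F (g (s + t)) - F (g s) - (\sum_j L j * D j) * t =
  (F (g (s + t)) - F (g s) - linf L (g (s + t) - g s)) + \sum_j L j * (g (s + t) j ord0 - g s j ord0 - D j * t).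
  have -> : \sum_j L j * (g (s + t) j ord0 - g s j ord0 - D j * t) = linf L (g (s + t) - g s) - (\sum_j L j * D j) * t.
    rewrite /linf mulr_suml -sumrB; apply: eq_bigr => j _; rewrite !mxE; ring.
  ring.
have h4 : normc (\sum_j L j * (g (s + t) j ord0 - g s j ord0 - D j * t)) <= (\sum_j normc (L j)) * (e1 * normc t).
  apply: (le_trans (normc_sum _ _ _)); rewrite mulr_suml; apply: ler_sum => j _.
  by rewrite normc_mul ler_wpM2l ?normc_ge0.
apply: (le_trans (normcD _ _)).
have h5 : e1 * vnorm (g (s + t) - g s) <= e1 * ((m%:R + \sum_j normc (D j)) * normc t).
  rewrite ler_wpM2l ?(ltW e10) //; apply: (le_trans gK); rewrite ler_wpM2r //; lra.
apply: (@le_trans _ _ (e1 * k * normc t)); last by rewrite ler_wpM2r.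
rewrite /k; lra.
Qed.

Lemma line_cdiff F z v s : vdiff F (z + s *: v) -> cdiff (fun t => F (z + t *: v)) s.
Proof.
move=> Fd; apply: curve_cdiff => // j.
apply: (@cdiff_near _ (fun t => z j ord0 + t * v j ord0) _ s 1 ltr01) => [t _|]; first by rewrite !mxE.
by apply: cdiffD; [exact: cdiff_cst | apply: cdiffM; [exact: cdiff_id | exact: cdiff_cst]].
Qed.

End SeveralVariables.

(** * Limits of bounded sequences along an ultrafilter *)

Section Ultralimits.
Variables (R : realType) (U : set_system nat).
Hypothesis Uultra : UltraFilter U.
Hypothesis Uoo : forall M0 : nat, U [set M | (M0 <= M)%N].
Implicit Types (u v : nat -> R[i]) (l : R[i]).

Definition ulim u l := forall e : R, 0 < e -> U [set n | normc (u n - l) <= e].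

Lemma ulim_cst l : ulim (fun=> l) l.
Proof. by move=> e e0; apply: filterS (filterT : U setT) => n _ /=; rewrite subrr normc0 ltW. Qed.

Lemma ulimD u v l l' : ulim u l -> ulim v l' -> ulim (fun n => u n + v n) (l + l').
Proof.
move=> ul vl e e0; have e2 : 0 < e / 2 by lra.
apply: filterS (filterI (ul _ e2) (vl _ e2)) => n /= [h1 h2].
rewrite opprD addrACA; apply: (le_trans (normcD _ _)); lra.
Qed.

Lemma ulimMl u l (a : R[i]) : ulim u l -> ulim (fun n => a * u n) (a * l).
Proof.
move=> ul e e0; have D0 : 0 < 1 + normc a by have := normc_ge0 a; lra.
have e1 : 0 < e / (1 + normc a) by rewrite divr_gt0.
apply: filterS (ul _ e1) => n /= h; rewrite -mulrBr normc_mul.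
have -> : e = (1 + normc a) * (e / (1 + normc a)) by rewrite mulrC divfK ?gt_eqF.
by rewrite ler_pM ?normc_ge0 // lerDr.
Qed.

Lemma ulimB u v l l' : ulim u l -> ulim v l' -> ulim (fun n => u n - v n) (l - l').
Proof.
move=> ul vl e e0.
by apply: filterS (ulimD ul (ulimMl (-1) vl) e0) => n /=; rewrite !mulN1r.
Qed.

Lemma ulim_sum (I : Type) (r : seq I) (us : I -> nat -> R[i]) (ls : I -> R[i]) :
  (forall i, ulim (us i) (ls i)) -> ulim (fun n => \sum_(i <- r) us i n) (\sum_(i <- r) ls i).
Proof.
move=> h; elim: r => [|i r IH].
  by rewrite big_nil => e /(ulim_cst 0); apply: filterS => n; rewrite /= big_nil.
by rewrite big_cons => e /(ulimD (h i) IH); apply: filterS => n; rewrite /= big_cons.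
Qed.

Lemma ulim_bound u l (B : R) : ulim u l -> (forall n, normc (u n) <= B) -> normc l <= B.
Proof.
move=> ul uB; apply: ler_eps => e e0.
have /filter_ex[n /= hn] := ul _ e0.
by have := normcB (u n) (u n - l); rewrite subKr; have := uB n; lra.
Qed.

Lemma ulim_unique u l l' : ulim u l -> ulim u l' -> l = l'.
Proof.
move=> ul ul'; apply/eqP; rewrite -subr_eq0; apply/eqP/normc_le0/ler_eps => e e0.
have /filter_ex[n /= hn] := ulimB ul ul' e0.
by move: hn; rewrite subrr sub0r normc_opp add0r.
Qed.

Lemma tends0_ulim u l : tends0 (fun n => u n - l) -> ulim u l.
Proof. by move=> h e /h[M0 hM]; apply: filterS (Uoo M0) => n; exact: hM. Qed.

(** The limit is the supremum of the numbers that lie below [x n] for [U]-almost all [n]. For the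
    upper estimate, the ultrafilter decides between a set and its complement, and one choice would
    put [sup S + e] into [S]. *)
Lemma real_ulim_ex (x : nat -> R) (B : R) : (forall n, `|x n| <= B) ->
  exists l : R, forall e : R, 0 < e -> U [set n | `|x n - l| <= e].
Proof.
move=> xB; pose S := [set y : R | U [set n | y <= x n]].
have S0 : S !=set0.
  by exists (- B); apply: filterS (filterT : U setT) => n _ /=; have := xB n; rewrite ler_norml => /andP[].
have SB : ubound S B.
  by move=> y /= /filter_ex[n /= yn]; have := xB n; rewrite ler_norml => /andP[_]; exact: le_trans.
exists (sup S) => e e0.
have Ulow : U [set n | sup S - e <= x n].
  have [y Sy ylt] : exists2 y, S y & sup S - e < y.
    by apply: sup_adherent => //; split => //; exists B.
  by apply: filterS Sy => n /=; apply: le_trans; exact: ltW.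
have Uup : U [set n | x n <= sup S + e].
  have [h|] := in_ultra_setVsetC [set n | sup S + e <= x n] Uultra.
    suff : sup S + e <= sup S by lra.
    by apply: ub_le_sup => //; exists B.
  by apply: filterS => n /= /negP; rewrite -ltNge => /ltW.
apply: filterS (filterI Ulow Uup) => n /= [h1 h2].
by rewrite ler_norml; apply/andP; split; lra.
Qed.

Lemma ulim_ex u (B : R) : (forall n, normc (u n) <= B) -> exists l, ulim u l.
Proof.
move=> uB.
have [a ha] := @real_ulim_ex (fun n => Re (u n)) B (fun n => le_trans (Re_le_normc _) (uB n)).
have [b hb] := @real_ulim_ex (fun n => Im (u n)) B (fun n => le_trans (Im_le_normc _) (uB n)).
exists (a +i* b) => e e0; have e2 : 0 < e / 2 by lra.
apply: filterS (filterI (ha _ e2) (hb _ e2)) => n /= [h1 h2].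
have -> : u n - (a +i* b) = (Re (u n) - a) +i* (Im (u n) - b) by case: (u n).
by apply: (le_trans (normc_complex _ _)); lra.
Qed.

(* No uniformity of the convergence is needed: the second-order Cauchy estimate is uniform
   in [n] as soon as the functions are, and it survives the limit. *)
Lemma ulim_vdiff (m : nat) (Fs : nat -> 'cV[R[i]]_m -> R[i]) (F : 'cV[R[i]]_m -> R[i])
    (z : 'cV[R[i]]_m) (rho B : R) : 0 < rho ->
  (forall n y, vnorm (y - z) < rho -> vdiff (Fs n) y) ->
  (forall n y, vnorm (y - z) < rho -> normc (Fs n y) <= B) ->
  (forall y, vnorm (y - z) < rho -> ulim (fun n => Fs n y) (F y)) ->
  vdiff F z.
Proof.
move=> rho0 Fd FB Fl.
have zz : vnorm (z - z) < rho by rewrite subrr vnorm0.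
have /choice[Ls hL] : forall n, exists L, vderiv (Fs n) z L by move=> n; exact: Fd.
have B0 : 0 <= B := le_trans (normc_ge0 _) (FB 0%N z zz).
have est n h : vnorm h < rho / 4 ->
  normc (Fs n (z + h) - Fs n z - linf (Ls n) h) <= 128 * B / rho ^+ 2 * vnorm h ^+ 2.
  move=> hr.
  have [h0|hN0] := eqVneq (vnorm h) 0.
    have -> : h = 0.
      apply/matrixP => i k; rewrite (ord1 k) mxE; apply: normc_le0.
      by rewrite -h0 coord_le_vnorm.
    have -> : linf (Ls n) 0 = 0 by rewrite /linf big1 // => j _; rewrite mxE mulr0.
    by rewrite addr0 subrr subr0 normc0 vnorm0 expr0n mulr0.
  have h0 : 0 < vnorm h by rewrite lt0r hN0 vnorm_ge0.
  (* On the line through [z] in direction [h], the disc of radius [r] reaches distance [rho / 2].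
     Since [vnorm h < rho / 4], the parameter 1 is below [r / 2], and [32 * B / r ^+ 2] becomes the
     stated coefficient. *)
  pose r := rho / 2 / vnorm h.
  have r0 : 0 < r by rewrite !divr_gt0.
  have rh : r * vnorm h = rho / 2 by rewrite /r divfK.
  have r2 : 1 < r / 2 by rewrite /r ltr_pdivlMr // ltr_pdivlMr //; lra.
  have inball s : normc s <= r -> vnorm (z + s *: h - z) < rho.
    move=> sr; rewrite addrAC subrr add0r vnormZ.
    apply: (@le_lt_trans _ _ (r * vnorm h)); first by rewrite ler_wpM2r // ltW.
    rewrite rh; lra.
  have hderiv : cderiv (fun s => Fs n (z + s *: h)) 0 (linf (Ls n) h).
    move=> e e0; have e1 : 0 < e / vnorm h by rewrite divr_gt0.
    have [d d0 hd] := hL n _ e1; exists (d / vnorm h) => [|s]; first by rewrite divr_gt0.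
    rewrite ltr_pdivlMr // -vnormZ => /hd; rewrite add0r scale0r addr0 linfZ vnormZ => k.
    rewrite [linf _ _ * s]mulrC; apply: (le_trans k).
    by rewrite [normc s * _]mulrC mulrA divfK.
  have := @cderiv_second_order R (fun s => Fs n (z + s *: h)) 0 (linf (Ls n) h) r B r0 hderiv _ _ 1.
  rewrite normc1 add0r scale1r scale0r addr0 mulr1 expr1n mulr1 => k.
  apply: (le_trans (k _ _ r2)) => [s|s|].
  - rewrite subr0 => sr; apply: line_cdiff; apply: Fd; exact: inball.
  - rewrite subr0 => sr; apply: FB; apply: inball; by rewrite sr.
  rewrite le_eqVlt; apply/orP; left; apply/eqP; rewrite /r; field; by rewrite gt_eqF ?hN0.
(* The estimate at [h = (rho / 8) e_j] bounds the partial derivatives uniformly in [n], so they have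
   limits along [U]. *)
have [K hK] : exists K, forall n j, normc (Ls n j) <= K.
  exists ((128 * B / rho ^+ 2 * (rho / 8) ^+ 2 + 2 * B) / (rho / 8)) => n j.
  have r8 : 0 < rho / 8 by lra.
  pose h : 'cV[R[i]]_m := (rho / 8)%:C *: delta_mx j ord0.
  have hn : vnorm h = rho / 8 by rewrite vnormZ vnorm_delta mulr1 normcr gtr0_norm.
  have hlt : vnorm h < rho / 4 by rewrite hn; lra.
  have := est n h hlt; rewrite linfZ linf_delta hn => k.
  rewrite ler_pdivlMr //.
  have -> : normc (Ls n j) * (rho / 8) = normc ((rho / 8)%:C * Ls n j).
    by rewrite normc_mul normcr (gtr0_norm r8) mulrC.
  have zh : vnorm (z + h - z) < rho by rewrite addrAC subrr add0r hn; lra.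
  have b1 := FB n _ zh; have b2 := FB n _ zz.
  have t1 := normcB (Fs n (z + h) - Fs n z) (Fs n (z + h) - Fs n z - (rho / 8)%:C * Ls n j).
  have t2 := normcB (Fs n (z + h)) (Fs n z).
  rewrite subKr in t1; clear -k b1 b2 t1 t2; lra.
have /choice[L hLl] : forall j, exists l, ulim (fun n => Ls n j) l by move=> j; exact: ulim_ex (hK^~ j).
exists L => e e0.
pose C := 128 * B / rho ^+ 2.
have C0 : 0 <= C by rewrite /C divr_ge0 ?sqr_ge0 // mulr_ge0.
exists (Num.min (rho / 4) (e / (1 + C))) => [|h]; first by rewrite lt_min !divr_gt0 //; lra.
rewrite lt_min => /andP[h1].
rewrite ltr_pdivlMr => [h2|]; last by lra.
have zh : vnorm (z + h - z) < rho by rewrite addrAC subrr add0r; lra.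
have ll : ulim (fun n => linf (Ls n) h) (linf L h).
  apply: ulim_sum => j e' e'0.
  by apply: filterS (ulimMl (h j ord0) (hLl j) e'0) => n /=; rewrite !(mulrC (h j ord0)).
have := ulim_bound (ulimB (ulimB (Fl _ zh) (Fl _ zz)) ll) (fun n => est n h h1).
move=> k; apply: (le_trans k); rewrite -/C expr2 mulrA ler_wpM2r ?vnorm_ge0 //.
by have := vnorm_ge0 h; lra.
Qed.

End Ultralimits.

(** * Hartogs extension *)

Section IndefiniteForm.
Variables (R : realType) (n : nat).
Local Notation vec := 'cV[R[i]]_n.+1.
Implicit Types (z h v : vec).

Definition hform z : R :=
  \sum_(j < n) normc (z (lift ord0 j) ord0) ^+ 2 - normc (z ord0 ord0) ^+ 2.

Lemma Dn1E z : Dn1 R n z <-> 0 < hform z.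
Proof.
have sq (x : R[i]) : (normc x ^+ 2)%:C = `|x| ^+ 2 by rewrite rmorphXn normr_normc.
rewrite /Dn1 /= /hform -ltcR rmorphB rmorph_sum /= sq.
by under [in X in _ <-> X]eq_bigr do rewrite sq.
Qed.

Lemma hform_gt0_coord z (j : 'I_n) : normc (z ord0 ord0) < normc (z (lift ord0 j) ord0) -> 0 < hform z.
Proof.
move=> zj; rewrite /hform (bigD1 j) //=.
have : 0 <= \sum_(k < n | k != j) normc (z (lift ord0 k) ord0) ^+ 2.
  by apply: sumr_ge0 => k _; exact: sqr_ge0.
have : normc (z ord0 ord0) ^+ 2 < normc (z (lift ord0 j) ord0) ^+ 2.
  by rewrite ltr_sqr ?nnegrE ?normc_ge0.
lra.
Qed.

Lemma hformZ s z : hform (s *: z) = normc s ^+ 2 * hform z.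
Proof.
rewrite /hform mulrBr mulr_sumr; congr (_ - _).
  by apply: eq_bigr => j _; rewrite mxE normc_mul exprMn.
by rewrite mxE normc_mul exprMn.
Qed.

End IndefiniteForm.

Section HartogsExtension.
Variables (R : realType) (n : nat) (j1 j2 : 'I_n).
Hypothesis j12 : j1 != j2.
Local Notation vec := 'cV[R[i]]_n.+1.
Local Notation i1 := (lift ord0 j1).
Implicit Types (z y h v : vec).

(** Replacing coordinate [i1] by [t] with [normc t = r > normc z_0] lands in the domain, where [f]
    is locally bounded; compactness makes the bound uniform in [t] and in [y] near [z]. *)
Lemma local_bound_circle (f : vec -> R[i]) z (r : R) :
  (forall z, 0 < hform z -> vdiff f z) -> normc (z ord0 ord0) < r ->
  exists rho B : R, [/\ 0 < rho, 0 <= B & forall y, vnorm (y - z) < rho ->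
    forall t, normc t = r -> normc (f (setcoord i1 t y)) <= B].
Proof.
move=> fd zr.
pose P (A : set R[i]) := exists rho B : R, [/\ 0 < rho, 0 <= B & forall y, vnorm (y - z) < rho ->
    forall t, A t -> normc t = r -> normc (f (setcoord i1 t y)) <= B].
have [rho [B [rho0 B0 h]]] : P [set t | normc (t - 0) <= r].
  apply: disc_compact.
  - by exists 1, 0.
  - by move=> A B AB [rho [K [? ? h]]]; exists rho, K; split => // y yr t /AB; exact: h.
  - move=> A A' [rho [B [rho0 B0 h]]] [rho' [B' [rho'0 B'0 h']]].
    exists (Num.min rho rho'), (Num.max B B'); split; first by rewrite lt_min rho0.
      by rewrite le_max B0.
    move=> y; rewrite lt_min => /andP[/h k /h' k'] t [/k|/k'] {}k /k {}k; by rewrite le_max k ?orbT.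
  (* [disc_compact] covers a full disc, but around a point off the circle the condition
     [normc t = r] fails and the bound is vacuous. *)
  move=> s _; have [sr|sr] := eqVneq (normc s) r; last first.
    exists `|normc s - r|; first by rewrite normr_gt0 subr_eq0.
    exists 1, 0; split => // y _ t /= ts tr; exfalso; move: ts; apply/negP; rewrite -leNgt.
    rewrite -tr ler_norml; apply/andP; split.
      by have := normc_ler_dist t s; rewrite normc_distC; have := normc_ler_dist s t; rewrite normc_distC; lra.
    by have := normc_ler_dist s t; rewrite normc_distC.
  have pos : 0 < hform (setcoord i1 s z).
    by apply: (@hform_gt0_coord _ _ _ j1); rewrite !mxE eqxx sr.
  have [L fL] := fd _ pos.
  have [d d0 hd] := vderiv_cont fL ltr01.
  exists (d / 2); first by lra.
  exists (d / 2), (1 + normc (f (setcoord i1 s z))); split; first by lra.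
    by have := normc_ge0 (f (setcoord i1 s z)); lra.
  move=> y yz t /= ts _.
  have e : setcoord i1 t y = setcoord i1 s z + setcoord i1 (t - s) (y - z).
    by rewrite -setcoordD; congr setcoord; [ring | rewrite addrC subrK].
  have k : vnorm (setcoord i1 (t - s) (y - z)) < d.
    by apply: (le_lt_trans (vnorm_setcoord _ _ _)); lra.
  have := hd _ k; rewrite -e => {}k.
  by have := normcD (f (setcoord i1 t y) - f (setcoord i1 s z)) (f (setcoord i1 s z)); rewrite subrK; lra.
exists rho, B; split => // y yr t tr; apply: (h y yr) => //=.
by rewrite subr0 tr.
Qed.

(* [v = |z'|^2 e_2 - conj(z_2) z'] is orthogonal to [z'] and has no [e_0]-component, so adding
   multiples of it to [z] only increases the form. *)
Lemma orthogonal_line z : 0 < hform z -> normc (z (lift ord0 j2) ord0) <= normc (z ord0 ord0) ->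
  exists v, [/\ v ord0 ord0 = 0, v (lift ord0 j2) ord0 != 0 &
    forall s, 0 < hform (z + s *: v)].
Proof.
move=> zpos z2; pose zj j := z (lift ord0 j) ord0.
pose S : R := \sum_j normc (zj j) ^+ 2.
pose vj j := S%:C * (j == j2)%:R - (zj j2)^* * zj j.
have [v [v0 vE]] : exists v : vec, v ord0 ord0 = 0 /\ forall j, v (lift ord0 j) ord0 = vj j.
  exists (\col_k (if unlift ord0 k is Some j then vj j else 0)).
  by split=> [|j]; rewrite mxE ?unlift_none ?liftK.
(* Here [normc (zj j2) <= normc z_0] is used; it makes the coordinate [S - |z_2|^2] of [v]
   nonzero. *)
have S0 : normc (zj j2) ^+ 2 < S.
  rewrite /hform subr_gt0 in zpos; apply: le_lt_trans zpos.
  by rewrite ler_sqr ?nnegrE ?normc_ge0.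
exists v; split => //.
  by rewrite vE /vj eqxx mulr1 conjM_normc -rmorphB /= -normc_gt0 normcr normr_gt0 subr_eq0 gt_eqF.
move=> s.
have orth : \sum_j (zj j)^* * vj j = 0.
  have -> : \sum_j (zj j)^* * vj j = \sum_j (S%:C * ((zj j)^* * (j == j2)%:R)) - \sum_j (zj j2)^* * (normc (zj j) ^+ 2)%:C.
    by rewrite -sumrB; apply: eq_bigr => j _; rewrite -conjM_normc /vj; ring.
  rewrite -!mulr_sumr (bigD1 j2) //= eqxx mulr1 big1 => [|j /negbTE ->]; last by rewrite mulr0.
  by rewrite addr0 -rmorph_sum -/S; ring.
suff : hform z <= hform (z + s *: v) by lra.
rewrite /hform [(z + _) ord0 _]mxE [(s *: v) ord0 _]mxE v0 mulr0 addr0 lerD2r.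
have -> : \sum_(j < n) normc ((z + s *: v) (lift ord0 j) ord0) ^+ 2 =
  \sum_(j < n) normc (zj j) ^+ 2 + 2 * Re (s * \sum_j (zj j)^* * vj j) + \sum_(j < n) normc (s * vj j) ^+ 2.
  rewrite mulr_sumr raddf_sum mulr_sumr -!big_split /=; apply: eq_bigr => j _.
  rewrite !mxE vE (normc_sqr_expand (zj j)) -/(zj j).
  have -> : zj j + s * vj j - zj j = s * vj j by ring.
  by congr (_ + 2 * Re _ + _); ring.
by rewrite orth mulr0 /= mulr0 addr0 lerDl sumr_ge0 // => j _; exact: sqr_ge0.
Qed.

(* [F z] is the Cauchy average of [f] over a large circle in the coordinate [i1]; it agrees with [f]
   by Cauchy's formula where [|z_0| < |z_{i2}|], since there [f] is entire in the coordinate [i1],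
   and the lines of [orthogonal_line] carry the equality to the whole domain. *)
Lemma hartogs_extension (f : vec -> R[i]) : (forall z, 0 < hform z -> vdiff f z) ->
  exists F : vec -> R[i], (forall z, vdiff F z) /\ (forall z, 0 < hform z -> F z = f z).
Proof.
move=> fd.
have [U [Uultra sU]] : exists U, UltraFilter U /\ \oo `<=` U by exact: ultraFilterLemma.
have Uoo M0 : U [set M | (M0 <= M)%N] by apply: sU; exists M0.
pose K t y := f (setcoord i1 t y) * (t / (t - y i1 ord0)).
pose A r M y := avg (fun t => K t y) 0 r M.
(* Exceeding [normc y_0] keeps the circle in the domain; exceeding [normc y_1] by 1 keeps the
   denominator of the kernel at least 1 in modulus. *)
pose rad y := normc (y ord0 ord0) + normc (y i1 ord0) + 1.
pose F y := xget 0 [set l | ulim U (fun M => A (rad y) M y) l].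
have rad0 y : normc (y ord0 ord0) < rad y by rewrite /rad; have := normc_ge0 (y i1 ord0); lra.
have rad1 y : normc (y i1 ord0) + 1 <= rad y by rewrite /rad; have := normc_ge0 (y ord0 ord0); lra.
have rad_gt0 y : 0 < rad y by apply: le_lt_trans (rad0 y); exact: normc_ge0.
have posE t y : normc (y ord0 ord0) < normc t -> 0 < hform (setcoord i1 t y).
  by move=> ty; apply: (@hform_gt0_coord _ _ _ j1); rewrite !mxE eqxx.
have fline t y : normc (y ord0 ord0) < normc t -> cdiff (fun s => f (setcoord i1 s y)) t.
  move=> ty; have := @line_cdiff _ _ f (setcoord i1 0 y) (delta_mx i1 ord0) t.
  rewrite -setcoord_line add0r => /(_ (fd _ (posE t y ty))).
  by apply: (cdiff_near ltr01) => h _; rewrite -setcoord_line add0r.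
have Kbound y t (B : R) : rad y <= normc t -> normc (f (setcoord i1 t y)) <= B -> normc (K t y) <= B * normc t.
  move=> ty fB; have t1 := rad1 y.
  have d1 : 1 <= normc (t - y i1 ord0) by have := normc_ler_dist t (y i1 ord0); lra.
  rewrite /K normc_mul normc_div ler_pM ?normc_ge0 ?divr_ge0 ?normc_ge0 // ler_pdivrMr; last by lra.
  by rewrite ler_peMr ?normc_ge0.
have Fspec y : ulim U (fun M => A (rad y) M y) (F y).
  have [rho [B [rho0 B0 hB]]] := local_bound_circle fd (rad0 y).
  apply: (@xgetPex _ _ [set l | ulim U (fun M => A (rad y) M y) l]).
  apply: (@ulim_ex _ _ Uultra _ (B * rad y)) => M; apply: avg_bound; first exact: ltW.
  move=> t; rewrite subr0 => tr; rewrite -tr; apply: Kbound; rewrite ?tr //.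
  by apply: hB => //; rewrite subrr vnorm0.
have Fr y r : rad y <= r -> ulim U (fun M => A r M y) (F y).
  move=> yr; have : tends0 (fun M => A r M y - A (rad y) M y).
    apply: avg_annulus => // t; rewrite subr0 => /andP[ty _].
    have ty0 : normc (y ord0 ord0) < normc t := lt_le_trans (rad0 y) ty.
    apply: cdiffM; first exact: fline.
    apply: cdiff_div; [|exact: cdiff_id | by apply: cdiffB; [exact: cdiff_id | exact: cdiff_cst]].
    rewrite -normc_gt0; have := normc_ler_dist t (y i1 ord0); have := rad1 y; lra.
  move=> h e e0.
  have h' : tends0 (fun M => A r M y - A (rad y) M y - 0) by apply: tends0_ext h => M; rewrite subr0.
  have := ulimD Uultra (tends0_ulim Uultra Uoo h') (Fspec y) e0.
  by apply: filterS => M /=; rewrite add0r subrK.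
have Fd z : vdiff F z.
  (* The radius in [F y] varies with [y]; near [z] this fixed radius dominates all of them, and by
     [Fr] it gives the same limit. *)
  pose r := rad z + 1.
  have zr : normc (z ord0 ord0) < r by have := rad0 z; rewrite /r; lra.
  have r0 : 0 <= r by have := rad_gt0 z; rewrite /r; lra.
  have [rho [B [rho0 B0 hB]]] := local_bound_circle fd zr.
  have near y : vnorm (y - z) < Num.min rho 1 -> [/\ vnorm (y - z) < rho, rad y <= r & normc (y ord0 ord0) < r].
    rewrite lt_min => /andP[-> y1].
    have : normc ((y - z) ord0 ord0) + normc ((y - z) i1 ord0) <= vnorm (y - z) by exact: coord2_le_vnorm.
    rewrite !mxE => c2.
    have k0 := normc_ler_dist (y ord0 ord0) (z ord0 ord0).
    have k1 := normc_ler_dist (y i1 ord0) (z i1 ord0).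
    have yr : rad y <= r by rewrite /r /rad; lra.
    by split => //; exact: lt_le_trans (rad0 y) yr.
  apply: (@ulim_vdiff R U Uultra _ (fun M => A r M) F z (Num.min rho 1) (B * r)).
  - by rewrite lt_min rho0 ltr01.
  - move=> M y /near[_ yr y0].
    rewrite /A /avg; apply: vdiffM; first exact: vdiff_cst.
    apply: vdiff_sum => k; set t := cnode _ _ _ _.
    have tr : normc t = r by rewrite -[t]subr0; exact: normc_cnode.
    apply: vdiffM; first by apply: vdiff_setcoord; apply: fd; apply: posE; rewrite tr.
    apply: (@vdiff_coord _ _ (fun s => t / (t - s))).
    apply: cdiff_div; [|exact: cdiff_cst|by apply: cdiffB; [exact: cdiff_cst | exact: cdiff_id]].
    by rewrite -normc_gt0; have := normc_ler_dist t (y i1 ord0); have := rad1 y; rewrite tr; lra.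
  - move=> M y /near[yrho yr y0]; apply: avg_bound => // t; rewrite subr0 => tr.
    by rewrite -tr; apply: Kbound; rewrite ?tr //; exact: hB.
  - by move=> y /near[_ yr _]; exact: Fr.
exists F; split => //.
have Feq y : normc (y ord0 ord0) < normc (y (lift ord0 j2) ord0) -> F y = f y.
  move=> y2; have ar : normc (y i1 ord0) < rad y by have := rad1 y; lra.
  have phid t : cdiff (fun s => f (setcoord i1 s y)) t.
    have pos : 0 < hform (setcoord i1 t y).
      apply: (@hform_gt0_coord _ _ _ j2); rewrite !mxE /=.
      by rewrite (inj_eq lift_inj) eq_sym (negbTE j12).
    have := @line_cdiff _ _ f (setcoord i1 0 y) (delta_mx i1 ord0) t.
    rewrite -setcoord_line add0r => /(_ (fd _ pos)).
    by apply: (cdiff_near ltr01) => h _; rewrite -setcoord_line add0r.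
  have := tends0_ulim Uultra Uoo (cauchy_formula ar phid); rewrite setcoord_id.
  exact: (ulim_unique Uultra (Fspec y)).
move=> z zpos.
have [|z2] := ltP (normc (z ord0 ord0)) (normc (z (lift ord0 j2) ord0)); first exact: Feq.
have [v [v0 v2 vpos]] := orthogonal_line zpos z2.
pose g s := F (z + s *: v) - f (z + s *: v).
have gd s : cdiff g s by apply: cdiffB; apply: line_cdiff; [exact: Fd | apply: fd; exact: vpos].
have V0 : 0 < normc (v (lift ord0 j2) ord0) by rewrite normc_gt0.
(* For [normc s >= T] the coordinate [z_2 + s v_2] exceeds [z_0] in modulus, so [Feq] applies; the
   unit disc about [T + 1] consists of such [s]. *)
pose T := (normc (z ord0 ord0) + normc (z (lift ord0 j2) ord0) + 1) / normc (v (lift ord0 j2) ord0).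
have Z0 := normc_ge0 (z ord0 ord0); have Z2 := normc_ge0 (z (lift ord0 j2) ord0).
have T0 : 0 < T by rewrite divr_gt0 //; lra.
have : g 0 = 0.
  apply: (@entire_identity _ g (T + 1)%:C 1) => // s sT; apply/eqP; rewrite subr_eq0; apply/eqP/Feq.
  rewrite !mxE v0 mulr0 addr0.
  have sT' : T <= normc s.
    have := normc_ler_dist (T + 1)%:C s; rewrite normc_distC normcr ger0_norm; lra.
  have : T * normc (v (lift ord0 j2) ord0) <= normc (s * v (lift ord0 j2) ord0).
    by rewrite normc_mul ler_wpM2r // ltW.
  rewrite /T divfK ?gt_eqF // => k.
  have := normc_ler_dist (s * v (lift ord0 j2) ord0) (- z (lift ord0 j2) ord0).
  rewrite opprK normc_opp [s * _ + _]addrC; move: (v _ _) k => ?; lra.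
by rewrite /g scale0r addr0 => /eqP; rewrite subr_eq0 => /eqP.
Qed.

End HartogsExtension.

(** * Comparison with the Fréchet derivative *)

Section MatrixNorm.
Variables (R : realType) (m : nat).
Implicit Types (h z : Cn R m).

Lemma mxnorm_coord h i : `|h i ord0| <= `|h|.
Proof.
rewrite [leRHS]/Num.Def.normr /= mx_normE -[leLHS]nngE num_le.
exact: (le_bigmax _ (fun x : 'I_m.+1 * 'I_1 => `|h x.1 x.2|%:nng) (i, ord0)).
Qed.

Lemma mxnorm_le_vnorm h : `|h| <= (vnorm h)%:C.
Proof.
have v0 : 0 <= (vnorm h)%:C by rewrite ler0c vnorm_ge0.
rewrite [leLHS]/Num.Def.normr /= mx_normE.
have -> : (vnorm h)%:C = (NngNum v0)%:num by [].
rewrite num_le; apply/bigmax_leP; split => [|[i k] _] /=; rewrite -num_le //=.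
by rewrite (ord1 k) normr_normc lecR coord_le_vnorm.
Qed.

Lemma mxnorm_vnorm_lt h (r : R) : `|h| < (r / m.+1%:R)%:C -> vnorm h < r.
Proof.
move=> hr; apply: (@lt_le_trans _ _ (\sum_(j < m.+1) (r / m.+1%:R))).
  apply: ltr_sum => [|j _]; first by apply/hasP; exists ord0; rewrite // mem_index_enum.
  by rewrite -ltcR -normr_normc; exact: le_lt_trans (mxnorm_coord h j) hr.
by rewrite sumr_const card_ord -[_ *+ _]mulr_natr divfK ?pnatr_eq0.
Qed.

End MatrixNorm.

Section FrechetBridge.
Variables (R : realType) (m p : nat).
Implicit Types (h z : Cn R m).

Lemma differentiable_vdiff (f : Cn R m -> Cn R p) z i :
  differentiable f z -> vdiff (fun y => f y i ord0) z.
Proof.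
move=> /diff_locallyP[_ /eqaddoP fo].
exists (fun j => 'd f z (delta_mx j ord0) i ord0) => e e0.
have eC : 0 < e%:C :> R[i] by rewrite ltcR.
have /nbhs_ballP[r /= r0 hr] := fo _ eC.
have rr : r = (Re r)%:C by apply/esym/RRe_real; exact: gtr0_real.
have r0' : 0 < Re r by rewrite -ltcR -rr.
exists (Re r) => // h hlt.
have hb : ball (0 : Cn R m) r h.
  rewrite mx_norm_ball /ball_ /= sub0r normrN; apply: le_lt_trans (mxnorm_le_vnorm h) _.
  by rewrite rr ltcR.
have := hr h hb => /=.
rewrite !fctE /= /shift /= => k.
have dE : 'd f z h i ord0 = linf (fun j => 'd f z (delta_mx j ord0) i ord0) h.
  rewrite {1}(matrix_sum_delta h) linear_sum summxE; apply: eq_bigr => j _.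
  by rewrite big_ord1 linearZ mxE mulrC.
have := le_trans (mxnorm_coord _ i) k; rewrite !mxE -dE => {}k.
rewrite -lecR -normr_normc rmorphM /= opprD addrA in k *.
rewrite [z + h]addrC; apply: (le_trans k); rewrite ler_wpM2l ?(ltW eC) //.
exact: mxnorm_le_vnorm.
Qed.

Lemma vnorm_mulmx (A : 'M[R[i]]_(p.+1, m.+1)) h :
  vnorm (A *m h) <= (\sum_i \sum_j normc (A i j)) * vnorm h.
Proof.
rewrite mulr_suml; apply: ler_sum => i _; rewrite mxE; exact: (linf_bound (A i)).
Qed.

Lemma mulmx_continuous (A : 'M[R[i]]_(p.+1, m.+1)) :
  continuous (mulmx A : Cn R m -> Cn R p).
Proof.
move=> z; apply/(@cvgrPdist_lt _ (Cn R p) (Cn R m) (nbhs z) (nbhs_filter z)) => e e0; apply/nbhs_ballP.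
have er : e = (Re e)%:C by apply/esym/RRe_real; exact: gtr0_real.
have e0' : 0 < Re e by rewrite -ltcR -er.
pose K := 1 + \sum_i \sum_j normc (A i j).
have S0 : 0 <= \sum_i \sum_j normc (A i j).
  by apply: sumr_ge0 => i _; apply: sumr_ge0 => j _; exact: normc_ge0.
have K0 : 0 < K by rewrite /K; lra.
exists (Re e / K / m.+1%:R)%:C; first by rewrite /= ltcR !divr_gt0.
move=> y; rewrite mx_norm_ball /ball_ /= => /mxnorm_vnorm_lt.
rewrite ltr_pdivlMr // => yz.
rewrite -mulmxBr; apply: le_lt_trans (mxnorm_le_vnorm _) _; rewrite er ltcR.
apply: le_lt_trans (vnorm_mulmx _ _) _.
by apply: le_lt_trans yz; rewrite mulrC ler_wpM2l ?vnorm_ge0 // /K; lra.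
Qed.

(** The remainder is exactly zero near [z]. Agreement is only local because the theorem prescribes
    [f] on the domain alone. *)
Lemma differentiable_mulmx_near (A : 'M[R[i]]_(p.+1, m.+1)) (f : Cn R m -> Cn R p) z (r : R) :
  0 < r -> (forall h, vnorm h < r -> f (z + h) = A *m (z + h)) -> differentiable f z.
Proof.
move=> r0 fA.
have fz : f z = A *m z by have := fA 0; rewrite addr0 vnorm0 => ->.
have fo : f \o shift z = cst (f z) + mulmx A +o_ (0 : Cn R m) id.
  apply/eqaddoP => e e0; apply/nbhs_ballP.
  have d0 : 0 < (r / m.+1%:R)%:C by rewrite ltcR divr_gt0.
  exists (r / m.+1%:R)%:C => // h; rewrite mx_norm_ball /ball_ /= sub0r normrN => hr.
  rewrite !fctE /= /shift /=.
  have hv := mxnorm_vnorm_lt hr.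
  rewrite [h + z]addrC fA // fz mulmxDr subrr normr0 mulr_ge0 // ltW //.
have dA := diff_unique (@mulmx_continuous A) fo.
by apply/diff_locallyP; rewrite dA; split => //; exact: mulmx_continuous.
Qed.

End FrechetBridge.

(** * The Hermitian form and GU(n,1) *)

Section SesquilinearForm.
Variables (R : realType) (n : nat).
Local Notation vec := 'cV[R[i]]_n.+1.
Implicit Types (x y z : vec) (s : R[i]) (A : 'M[R[i]]_n.+1).

Definition sform x y : R[i] := (adjmx x *m Jmx R n *m y) ord0 ord0.

Lemma sformE x y : sform x y =
  \sum_(j < n) (x (lift ord0 j) ord0)^* * y (lift ord0 j) ord0 - (x ord0 ord0)^* * y ord0 ord0.
Proof.
rewrite /sform /Jmx mul_mx_diag mxE big_ord_recl addrC.
congr (_ + _); last by rewrite !mxE /=; ring.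
by apply: eq_bigr => j _; rewrite !mxE /=; ring.
Qed.

Lemma sform_diag z : sform z z = (hform z)%:C.
Proof.
rewrite sformE /hform rmorphB rmorph_sum /= conjM_normc; congr (_ - _).
by apply: eq_bigr => j _; rewrite conjM_normc.
Qed.

Lemma sformDr x y z : sform x (y + z) = sform x y + sform x z.
Proof. by rewrite /sform mulmxDr mxE. Qed.

Lemma sformZr x s y : sform x (s *: y) = s * sform x y.
Proof. by rewrite /sform -scalemxAr mxE. Qed.

Lemma sform_conj x y : sform y x = (sform x y)^*.
Proof.
have cM (a b : R[i]) : (a^* * b)^* = b^* * a by rewrite rmorphM /= conjcK mulrC.
rewrite !sformE rmorphB rmorph_sum /= cM; congr (_ - _).
by apply: eq_bigr => j _; rewrite cM.
Qed.

Lemma adjmx_mul m p q (A : 'M[R[i]]_(m, p)) (B : 'M[R[i]]_(p, q)) :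
  adjmx (A *m B) = adjmx B *m adjmx A.
Proof. by rewrite /adjmx map_mxM trmx_mul. Qed.

Lemma sformDl x y z : sform (x + y) z = sform x z + sform y z.
Proof. by rewrite (sform_conj z) sformDr rmorphD /= -!sform_conj. Qed.

Lemma sformZl s x y : sform (s *: x) y = s^* * sform x y.
Proof. by rewrite (sform_conj y) sformZr rmorphM /= -sform_conj. Qed.

Lemma hform_expand x y s :
  hform (x + s *: y) = hform x + 2 * Re (s * sform x y) + normc s ^+ 2 * hform y.
Proof.
apply: complexI; rewrite -sform_diag sformDr sformZr !sformDl !sformZl !sform_diag.
move: (hform x) (hform y) => hx hy.
rewrite (sform_conj x y) !rmorphD !rmorphM /=.
have -> : s^* * (sform x y)^* = (s * sform x y)^* by rewrite rmorphM.
have e2 : 2%:C * (Re (s * sform x y))%:C = s * sform x y + (s * sform x y)^*.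
  by rewrite addcJ rmorph_nat.
have e3 : s * (s^* * hy%:C) = (normc s)%:C * (normc s)%:C * hy%:C.
  by rewrite mulrA [s * _]mulrC conjM_normc expr2 rmorphM.
rewrite e2 -e3; ring.
Qed.

Lemma adjmx_delta (i : 'I_n.+1) : adjmx (delta_mx i ord0 : vec) = delta_mx ord0 i.
Proof.
apply/matrixP => a b; rewrite !mxE andbC.
by case: (_ && _); rewrite /= oppr0.
Qed.

(** This turns the matrix identity defining [GU] into orthogonality and length conditions on the
    columns of [A]. *)
Lemma gram A i j : (adjmx A *m Jmx R n *m A) i j = sform (A *m delta_mx i ord0) (A *m delta_mx j ord0).
Proof.
rewrite /sform adjmx_mul adjmx_delta.
have -> (u : 'rV[R[i]]_n.+1) (v : vec) : u *m adjmx A *m Jmx R n *m (A *m v) =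
  u *m ((adjmx A *m Jmx R n *m A) *m v) by rewrite !mulmxA.
move: (adjmx A *m _ *m A) => X; by rewrite -colE -rowE !mxE.
Qed.

Lemma hform_sum_sqr_le z : \sum_(j < n) normc (z (lift ord0 j) ord0) ^+ 2 <= vnorm z ^+ 2.
Proof.
apply: (@le_trans _ _ ((\sum_(j < n) normc (z (lift ord0 j) ord0)) * vnorm z)).
  rewrite mulr_suml; apply: ler_sum => j _.
  by rewrite expr2 ler_wpM2l ?normc_ge0 // coord_le_vnorm.
rewrite expr2 ler_wpM2r ?vnorm_ge0 // /vnorm big_ord_recl lerDr normc_ge0 //.
Qed.

Lemma Jmx_diag i : Jmx R n i i = if i == ord0 then -1 else 1.
Proof. by rewrite !mxE eqxx mulr1n. Qed.

Lemma Jmx_offdiag i j : i != j -> Jmx R n i j = 0.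
Proof. by move=> /negbTE ij; rewrite !mxE ij. Qed.

Lemma hform_delta0 : hform (delta_mx ord0 ord0 : vec) = -1.
Proof. 
apply: complexI; rewrite -sform_diag -[delta_mx _ _ in LHS]mul1mx -gram. 
have -> : adjmx (1%:M : 'M[R[i]]_n.+1) = 1%:M by rewrite /adjmx map_mx1 trmx1.
by rewrite mul1mx mulmx1 Jmx_diag eqxx rmorphN1.
Qed.

Lemma hform_delta_lift (j : 'I_n) : hform (delta_mx (lift ord0 j) ord0 : vec) = 1.
Proof. 
apply: complexI; rewrite -sform_diag -[delta_mx _ _ in LHS]mul1mx -gram. 
have -> : adjmx (1%:M : 'M[R[i]]_n.+1) = 1%:M by rewrite /adjmx map_mx1 trmx1.
by rewrite mul1mx mulmx1 Jmx_diag rmorph1.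
Qed.

Lemma sform_delta_neq i j : i != j -> sform (delta_mx i ord0) (delta_mx j ord0) = 0.
Proof.
move=> ij; rewrite -[delta_mx i _]mul1mx -[delta_mx j _]mul1mx -gram.
have -> : adjmx (1%:M : 'M[R[i]]_n.+1) = 1%:M by rewrite /adjmx map_mx1 trmx1.
by rewrite mul1mx mulmx1 Jmx_offdiag.
Qed.

Lemma Re_unit_eq0 (w : R[i]) : Re (1 * w) = 0 -> Re ('i * w) = 0 -> w = 0.
Proof.
case: w => a b; rewrite mul1r /= mul0r mul1r sub0r => -> /eqP.
by rewrite oppr_eq0 => /eqP ->.
Qed.

(* On null vectors the two forms vanish together; testing on [e_0 + u e_j] and
   [5 e_0 + 3 e_j + 4 u e_k] for [u] in [1, -1, i, -i] determines the Gram matrix of the columns. *)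
Lemma null_preserving_GU A : A \in unitmx -> (0 < n)%N ->
  (forall z, 0 < hform z -> 0 < hform (A *m z)) ->
  (forall z, hform z <= 0 -> hform (A *m z) <= 0) -> GU R n A.
Proof.
move=> Aunit n0 Apos Aneg.
pose a i : vec := A *m delta_mx i ord0.
(* The missing inequality comes by approximation from the domain: [z - t z_0 e_0] has form
   [|z_0|^2 t (2 - t) > 0], so its image has positive form, and [t] is chosen to make the error
   terms at most [e]. *)
have null z : z ord0 ord0 != 0 -> hform z = 0 -> hform (A *m z) = 0.
  move=> z00 z0; apply/eqP; rewrite eq_le Aneg ?z0 //=.
  rewrite -oppr_le0; apply: ler_eps => e e0; rewrite add0r.
  pose b := 2 * Re (- z ord0 ord0 * sform (A *m z) (a ord0)).
  pose c := normc (z ord0 ord0) ^+ 2 * hform (a ord0).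
  pose t := Num.min 1 (e / (`|b| + `|c| + 1)).
  have B0 := normr_ge0 b; have C0 := normr_ge0 c.
  have t0 : 0 < t by rewrite lt_min ltr01 divr_gt0 //; lra.
  have t1 : t <= 1 by rewrite ge_min lexx.
  have te : t * (`|b| + `|c| + 1) <= e by rewrite -ler_pdivlMr ?ge_min ?lexx ?orbT //; lra.
  have zpos : 0 < normc (z ord0 ord0) by rewrite normc_gt0.
  have := Apos (z + (t%:C * - z ord0 ord0) *: delta_mx ord0 ord0).
  rewrite mulmxDr -scalemxAr -/(a ord0) !hform_expand z0 hform_delta0.
  rewrite sformE big1 ?sub0r => [|j _]; last by rewrite !mxE /= mulr0.
  have ReM (r : R) w : Re (r%:C * w) = r * Re w by case: w => ? ? /=; ring.
  rewrite -!mulrA !ReM !normc_mul normc_opp normcr (gtr0_norm t0) mxE eqxx mulr1 mulrNN [_ * _^*]mulrC conjM_normc /=.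
  have -> : 2 * (t * Re (- z ord0 ord0 * sform (A *m z) (a ord0))) = t * b by rewrite /b; ring.
  have -> : t * normc (z ord0 ord0) * (t * normc (z ord0 ord0) * hform (a ord0)) = t * (t * c) by rewrite /c; ring.
  have -> : 0 + 2 * (t * normc (z ord0 ord0) ^+ 2) + t * normc (z ord0 ord0) * (t * normc (z ord0 ord0) * -1) =
    normc (z ord0 ord0) ^+ 2 * (t * (2 - t)) by ring.
  have tp : 0 < normc (z ord0 ord0) ^+ 2 * (t * (2 - t)).
    by rewrite mulr_gt0 ?exprn_gt0 // mulr_gt0 //; lra.
  move=> /(_ tp).
  have h1 : t * b <= t * `|b| by rewrite ler_wpM2l ?(ltW t0) // ler_norm.
  have h2 : t * (t * c) <= t * (1 * `|c|).
    rewrite ler_wpM2l ?(ltW t0) //; apply: (@le_trans _ _ (t * `|c|)).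
      by rewrite ler_wpM2l ?(ltW t0) // ler_norm.
    by rewrite ler_wpM2r.
  lra.
have eN (j : 'I_n) : ord0 != lift ord0 j :> 'I_n.+1 by [].
have row0 (j : 'I_n) (u : R[i]) : normc u = 1 ->
  hform (a ord0) + 2 * Re (u * sform (a ord0) (a (lift ord0 j))) + hform (a (lift ord0 j)) = 0.
  move=> u1; have := null (delta_mx ord0 ord0 + u *: delta_mx (lift ord0 j) ord0).
  rewrite mulmxDr -scalemxAr -!/(a _) !hform_expand hform_delta0 hform_delta_lift sform_delta_neq //.
  rewrite u1 expr1n mulr0 /= mulr0 addr0 !mul1r => -> //; last by ring.
  by rewrite !mxE eqxx /= mulr0 addr0 oner_neq0.
have n1 : normc (1 : R[i]) = 1 :> R by exact: normc1.
have nN1 : normc (-1 : R[i]) = 1 :> R by rewrite normc_opp.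
have ni : normc ('i : R[i]) = 1 :> R by exact: normc_i.
have nNi : normc (- 'i : R[i]) = 1 :> R by rewrite normc_opp.
(* Subtracting [row0] for [u] and [-u] isolates the real part of [u] times the form; [u = 1] and
   [u = 'i] then give both components. *)
have h0j (j : 'I_n) : sform (a ord0) (a (lift ord0 j)) = 0.
  have k1 := row0 j 1 n1; have k2 := row0 j (-1) nN1; have k3 := row0 j 'i ni; have k4 := row0 j (- 'i) nNi.
  apply: Re_unit_eq0.
    by rewrite mulN1r raddfN mul1r /= in k1 k2 *; lra.
  by rewrite mulNr raddfN /= in k4; lra.
have hjj (j : 'I_n) : hform (a (lift ord0 j)) = - hform (a ord0).
  by have := row0 j 1 n1; rewrite h0j mulr0 /=; lra.
have hjk (j k : 'I_n) : j != k -> sform (a (lift ord0 j)) (a (lift ord0 k)) = 0.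
  move=> jk.
  have key (u : R[i]) : normc u = 1 -> Re (u * sform (a (lift ord0 j)) (a (lift ord0 k))) = 0.
    (* The triple [3^2 + 4^2 = 5^2] gives a null vector with integer weights. By [h0j] and [hjj]
       everything in its image cancels except the cross term, with factor [2 * 3 * 4 = 24]. *)
    move=> u1; pose w : vec := 3%:R *: delta_mx (lift ord0 j) ord0 + (4%:R * u) *: delta_mx (lift ord0 k) ord0.
    have := null (w + 5%:R *: delta_mx ord0 ord0).
    have lk : lift ord0 j != lift ord0 k :> 'I_n.+1 by rewrite (inj_eq lift_inj).
    have lN i : lift ord0 i != ord0 :> 'I_n.+1 by [].
    have hsN (m : nat) x y : sform (m%:R *: x) y = m%:R * sform x y.
      by rewrite sformZl; congr (_ * _); exact: conjc_nat.
    have nat_Re (m : nat) (x : R[i]) : Re (m%:R * x) = m%:R * Re x.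
      by rewrite -(rmorph_nat (real_complex R)); case: x => ? ? /=; ring.
    rewrite mulmxDr -scalemxAr -!/(a _) !hform_expand hform_delta0 normc_nat.
    have -> : sform w (delta_mx ord0 ord0) = 0 by rewrite /w sformDl !sformZl !sform_delta_neq // !mulr0 addr0.
    have -> : A *m w = 3%:R *: a (lift ord0 j) + (4%:R * u) *: a (lift ord0 k).
      by rewrite /w mulmxDr -!scalemxAr.
    have -> : sform (3%:R *: a (lift ord0 j) + (4%:R * u) *: a (lift ord0 k)) (a ord0) = 0.
      by rewrite sformDl !sformZl !(sform_conj (a ord0)) !h0j !conjc0 !mulr0 addr0.
    rewrite /w !hform_expand !hformZ !hform_delta_lift !hsN sform_delta_neq // !hjj !mulr0 normc_mul !normc_nat u1.
    have -> : 4%:R * u * (3%:R * sform (a (lift ord0 j)) (a (lift ord0 k))) = 12%:R * (u * sform (a (lift ord0 j)) (a (lift ord0 k))) by ring.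
    rewrite nat_Re /= => k1; apply: (mulfI (_ : (24 : R) != 0)); first by rewrite pnatr_eq0.
    rewrite mulr0; rewrite -k1; first by ring.
    - by rewrite !mxE /= !mulr0 !add0r mulr1 pnatr_eq0.
    - by ring.
  by apply: Re_unit_eq0; exact: key.
pose nu := hform (a (lift ord0 (Ordinal n0))).
have nu0 : 0 < nu by apply: Apos; rewrite hform_delta_lift.
have nuE : hform (a ord0) = - nu by rewrite /nu hjj opprK.
split => //; exists nu%:C; split; first by rewrite ltcR.
apply/matrixP => i j; rewrite gram -!/(a _) [RHS]mxE.
have [<-|ij] := eqVneq i j.
  rewrite sform_diag Jmx_diag; case: (unliftP ord0 i) => [k ->|->]; last by rewrite eqxx nuE mulrN1 rmorphN.
  by rewrite hjj nuE opprK /= mulr1.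
rewrite Jmx_offdiag // mulr0.
case: (unliftP ord0 i) ij => [k ->|->]; case: (unliftP ord0 j) => [l ->|->]; rewrite ?eqxx // => ij.
- by apply: hjk; apply: contra_neq ij => ->.
- by rewrite (sform_conj (a ord0)) h0j conjc0.
Qed.

Lemma GU_hform A : GU R n A -> exists2 nu : R, 0 < nu & forall z, hform (A *m z) = nu * hform z.
Proof.
move=> [_ [nu [nu0 AJA]]]; have nuE : nu = (Re nu)%:C by apply/esym/RRe_real; exact: gtr0_real.
exists (Re nu); first by rewrite -ltcR -nuE.
move=> z; apply: complexI; rewrite rmorphM /= -nuE -!sform_diag /sform adjmx_mul.
have -> : adjmx z *m adjmx A *m Jmx R n *m (A *m z) = adjmx z *m (adjmx A *m Jmx R n *m A) *m z.
  by rewrite !mulmxA.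
by rewrite AJA -scalemxAr -scalemxAl mxE.
Qed.

End SesquilinearForm.

(** * Automorphisms of the complementary cone *)

Section ConeAutomorphisms.
Variables (R : realType) (n : nat).
Local Notation vec := 'cV[R[i]]_n.+1.
Implicit Types (x y z v : vec) (F G : vec -> vec).

Definition ventire F := forall z i, vdiff (fun y => F y i ord0) z.

Definition cone_preserving F := forall z, hform z <= 0 -> hform (F z) <= 0.

Lemma ventire_line F z v i s : ventire F -> cdiff (fun t => F (z + t *: v) i ord0) s.
Proof. by move=> Fd; apply: (@line_cdiff _ _ (fun y => F y i ord0)); exact: Fd. Qed.

Lemma ventire_ray F z i s : ventire F -> cdiff (fun t => F (t *: z) i ord0) s.
Proof.
by move=> /(ventire_line 0 z i s); apply: (cdiff_near ltr01) => h _; rewrite add0r.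
Qed.

Lemma cone_coord z i : hform z <= 0 -> normc (z i ord0) <= normc (z ord0 ord0).
Proof.
move=> z0; case: (unliftP ord0 i) => [j ->|->] //.
by rewrite leNgt; apply/negP => /hform_gt0_coord; rewrite ltNge z0.
Qed.

Lemma cone_eq0 z : hform z <= 0 -> z ord0 ord0 = 0 -> z = 0.
Proof.
move=> z0 z00; apply/matrixP => i j; rewrite (ord1 j) mxE; apply: normc_le0.
by have := cone_coord i z0; rewrite z00 normc0.
Qed.

Lemma coneZ s z : hform z <= 0 -> hform (s *: z) <= 0.
Proof. by rewrite hformZ; apply: mulr_ge0_le0; exact: sqr_ge0. Qed.

(* [F (t z)] stays in the cone, so its coordinates are bounded by the leading one, which vanishes
   for at most one [t]; Liouville makes the ratios constant. *)
Lemma cone_ray_collinear F z : ventire F -> injective F -> cone_preserving F ->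
  hform z <= 0 -> z != 0 -> exists2 c : vec, c ord0 ord0 = 1 & forall t, F (t *: z) = F (t *: z) ord0 ord0 *: c.
Proof.
move=> Fd Finj FK zK z0; pose g t := F (t *: z) ord0 ord0.
have gi i t : normc (F (t *: z) i ord0) <= normc (g t) by apply: cone_coord; apply: FK; exact: coneZ.
have g0 t : g t = 0 -> F (t *: z) = 0 by move=> gt0; apply: cone_eq0 => //; apply: FK; exact: coneZ.
have [a ga] : exists a, forall t, t != a -> g t != 0.
  have [[a ga]|none] := pselect (exists a, g a = 0); last first.
    by exists 0 => t _; apply/eqP => gt0; apply: none; exists t.
  exists a => t; apply: contra_neq => gt0; apply/eqP; rewrite -subr_eq0.
  have : (t - a) *: z == 0.
    by rewrite scalerBl subr_eq0; apply/eqP; apply: Finj; rewrite !g0.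
  by rewrite scaler_eq0 (negbTE z0) orbF.
have ratio i : exists c, forall t, F (t *: z) i ord0 = c * g t.
  have [t ta|t ta|c hc] := @liouville_punctured R (fun t => F (t *: z) i ord0 / g t) a 1.
  - by apply: cdiff_div; [exact: ga | exact: ventire_ray | exact: ventire_ray].
  - by rewrite normc_div ler_pdivrMr ?mul1r ?normc_gt0 ?ga.
  have off t : t != a -> F (t *: z) i ord0 - c * g t = 0.
    by move=> ta; rewrite -(hc t ta) divfK ?ga // subrr.
  exists c => t; apply/eqP; rewrite -subr_eq0; apply/eqP.
  (* The unit disc about [a + 1] misses [a], so the identity known off [a] extends to [a]. *)
  apply: (@entire_identity R (fun t => F (t *: z) i ord0 - c * g t) (a + 1) 1) => // s.
    apply: cdiffB; first exact: ventire_ray.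
    by apply: cdiffM; [exact: cdiff_cst | exact: ventire_ray].
  move=> sa; apply: off; apply: contraTneq sa => ->.
  by rewrite opprD addrA subrr add0r normc_opp normc1 ltxx.
have /choice[c hc] := ratio.
exists (\col_i (if i == ord0 then 1 else c i)) => [|t]; first by rewrite mxE.
apply/matrixP => i j; rewrite (ord1 j) !mxE; case: eqP => [->|_]; first by rewrite mulr1.
exact: etrans (hc i t) (mulrC _ _).
Qed.

(** The line through [G y] contains 0, so its image contains both [y] and [F 0]. If [F 0] were
    nonzero, all of the cone would be multiples of it, yet [e_0] and [e_0 + e_j] are independent
    elements of the cone. *)
Lemma cone_automorphism_fix0 F G : (0 < n)%N -> ventire F -> cancel F G -> cancel G F ->
  cone_preserving F -> cone_preserving G -> F 0 = 0.
Proof.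
move=> n0 Fd FG GF FK GK; apply/eqP; apply: contraT => F0N0.
have K0 : hform (0 : vec) <= 0 by have := coneZ 0 (z := 0); rewrite scale0r /hform big1 => [|j _]; rewrite !mxE normc0 expr0n ?subrr //.
have F00 : F 0 ord0 ord0 != 0.
  by apply: contraNneq F0N0 => h; apply/eqP; apply: cone_eq0 => //; exact: FK.
have multF0 y : hform y <= 0 -> exists s, y = s *: F 0.
  move=> yK; have [Gy0|Gy0] := eqVneq (G y) 0; first by exists 1; rewrite scale1r -Gy0 GF.
  have [c _ hc] := cone_ray_collinear Fd (can_inj FG) FK (GK y yK) Gy0.
  have := hc 0; rewrite scale0r => h0.
  exists (y ord0 ord0 / F 0 ord0 ord0).
  by rewrite {2}h0 scalerA divfK //; have := hc 1; rewrite scale1r GF.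
pose j : 'I_n := Ordinal n0.
have [s hs0] : exists s, delta_mx ord0 ord0 = s *: F 0 by apply: multF0; rewrite hform_delta0 lerN10.
have [s' hs1] : exists s', delta_mx ord0 ord0 + 1 *: delta_mx (lift ord0 j) ord0 = s' *: F 0.
  apply: multF0; rewrite hform_expand hform_delta0 hform_delta_lift sform_delta_neq //.
  by rewrite mulr0 normc1 /= expr1n mulr0 addr0 mulr1 addNr.
have := congr1 (fun x : vec => x ord0 ord0) hs0; rewrite !mxE /= => e1.
have := congr1 (fun x : vec => x (lift ord0 j) ord0) hs0; rewrite !mxE /= => e2.
have := congr1 (fun x : vec => x (lift ord0 j) ord0) hs1; rewrite !mxE eqxx /= => e3.
have sN0 : s != 0 by apply: contra_eq_neq e1 => ->; rewrite mul0r oner_eq0.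
move/esym/eqP: e2; rewrite mulf_eq0 (negbTE sN0) /= => /eqP e2.
by move/eqP: e3; rewrite e2 !mulr0 mul1r add0r oner_eq0.
Qed.

(** On the line of [z], [F] acts by an entire function [alpha] of the parameter and [G] by its
    inverse [beta]. Such an [alpha] is linear, and [alpha 1 = 1] fixes the factor. *)
Lemma cone_automorphism_homogeneous F G z t : (0 < n)%N -> ventire F -> ventire G ->
  cancel F G -> cancel G F -> cone_preserving F -> cone_preserving G ->
  hform z <= 0 -> F (t *: z) = t *: F z.
Proof.
move=> n0 Fd Gd FG GF FK GK zK.
have F0 : F 0 = 0 by exact: (cone_automorphism_fix0 n0 Fd FG GF FK GK).
have G0 : G 0 = 0 by rewrite -[in LHS]F0 FG.
have [->|z0] := eqVneq z 0; first by rewrite scaler0 F0 scaler0.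
have ray F' G' y : ventire F' -> cancel F' G' -> cone_preserving F' -> F' 0 = 0 -> G' 0 = 0 ->
    hform y <= 0 -> y != 0 ->
    exists2 alpha : R[i] -> R[i], (forall s, cdiff alpha s) & forall s, F' (s *: y) = alpha s *: F' y.
  move=> F'd F'G F'K F'0 G'0 yK y0.
  have F'y0 : F' y ord0 ord0 != 0.
    apply: contraNneq y0 => h; rewrite -(F'G y) (cone_eq0 _ h) ?G'0 //; exact: F'K.
  have [c _ hc] := cone_ray_collinear F'd (can_inj F'G) F'K yK y0.
  exists (fun s => F' (s *: y) ord0 ord0 / F' y ord0 ord0) => s.
    by apply: cdiffM; [exact: ventire_ray | exact: cdiff_cst].
  have := hc 1; rewrite scale1r => {2}->; rewrite scalerA divfK //; exact: hc.
have Fz0 : F z != 0 by apply: contraNneq z0 => h; rewrite -(FG z) h G0.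
have [alpha alphad alphaE] := ray F G z Fd FG FK F0 G0 zK z0.
have [beta betad betaE] := ray G F (F z) Gd GF GK G0 F0 (FK z zK) Fz0.
rewrite FG in betaE.
have scaleI x : x != 0 -> injective (fun s : R[i] => s *: x).
  move=> x0 s s' /eqP; rewrite -subr_eq0 -scalerBl scaler_eq0 (negbTE x0) orbF subr_eq0 => /eqP //.
have alphaK s : alpha (beta s) = s by apply: (scaleI _ Fz0) => /=; rewrite -alphaE -betaE GF.
have betaK s : beta (alpha s) = s by apply: (scaleI _ z0) => /=; rewrite -betaE -alphaE FG.
have alpha0 : alpha 0 = 0 by apply: (scaleI _ Fz0) => /=; rewrite -alphaE !scale0r.
have alpha1 : alpha 1 = 1 by apply: (scaleI _ Fz0) => /=; rewrite -alphaE !scale1r.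
have [c hc] := entire_bijection_linear alphad betad alpha0 alphaK betaK.
have c1 : c = 1 by rewrite -alpha1 hc mulr1.
by rewrite alphaE hc c1 mul1r.
Qed.

(** [e_0] is interior to the cone, so each line through [e_0] meets the cone in a disc to which the
    identity theorem applies. *)
Lemma cone_near_axis v s : normc s * vnorm v < 1 / 2 -> hform (delta_mx ord0 ord0 + s *: v) <= 0.
Proof.
rewrite -vnormZ; set w := s *: v => ws; rewrite /hform subr_le0.
have h1 : \sum_(j < n) normc ((delta_mx ord0 ord0 + w) (lift ord0 j) ord0) ^+ 2 <= vnorm w ^+ 2.
  apply: le_trans (hform_sum_sqr_le w); apply: ler_sum => j _.
  by rewrite !mxE /= add0r.
apply: (le_trans h1); rewrite ler_sqr ?nnegrE ?vnorm_ge0 ?normc_ge0 // !mxE /=.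
have h2 := coord_le_vnorm w ord0.
by have := normc_ler_dist 1 (- w ord0 ord0); rewrite normc1 normc_opp opprK mxE; move: h2; rewrite mxE; lra.
Qed.

Lemma cone_automorphism_linear F G : (0 < n)%N -> ventire F -> ventire G ->
  cancel F G -> cancel G F -> cone_preserving F -> cone_preserving G ->
  exists A : 'M[R[i]]_n.+1, forall z, F z = A *m z.
Proof.
move=> n0 Fd Gd FG GF FK GK.
have hom z t : hform z <= 0 -> F (t *: z) = t *: F z.
  by move=> zK; exact: (cone_automorphism_homogeneous t n0 Fd Gd FG GF FK GK zK).
have F0 : F 0 = 0 by exact: (cone_automorphism_fix0 n0 Fd FG GF FK GK).
have /choice[L hL] : forall i, exists L, vderiv (fun y => F y i ord0) 0 L by move=> i; exact: Fd.
(* By homogeneity the relative error of the linear approximation at 0 is the same at [t z] as at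
   [z], so it is zero. *)
have onK z i : hform z <= 0 -> F z i ord0 = linf (L i) z.
  move=> zK; apply/eqP; rewrite -subr_eq0; apply/eqP/normc_le0/ler_eps => e e0; rewrite add0r.
  have V0 := vnorm_ge0 z.
  have D0 : 0 < 1 + vnorm z by lra.
  have e1 : 0 < e / (1 + vnorm z) by rewrite divr_gt0.
  have [r r0 hr] := hL i _ e1.
  pose t : R := r / (1 + vnorm z) / 2.
  have t0 : 0 < t by rewrite !divr_gt0.
  have nt : normc t%:C = t by rewrite normcr gtr0_norm.
  have tr : vnorm (t%:C *: z) < r.
    rewrite vnormZ nt; apply: (@le_lt_trans _ _ (t * (1 + vnorm z))).
      by rewrite ler_wpM2l ?(ltW t0) //; lra.
    have -> : t * (1 + vnorm z) = r / 2 by rewrite /t; field; rewrite gt_eqF.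
    lra.
  have := hr _ tr; rewrite add0r F0 hom // !mxE subr0 linfZ -mulrBr normc_mul vnormZ nt.
  rewrite mulrCA ler_pM2l // => k; apply: (le_trans k).
  rewrite -mulrA ler_piMr ?(ltW e0) // mulrC ler_pdivrMr //; lra.
exists (\matrix_(i, j) L i j) => z; apply/matrixP => i k; rewrite (ord1 k).
have -> : ((\matrix_(i, j) L i j) *m z) i ord0 = linf (L i) z.
  by rewrite mxE; apply: eq_bigr => j _; rewrite mxE.
apply/eqP; rewrite -subr_eq0; apply/eqP.
pose v := z - delta_mx ord0 ord0.
pose g s := F (delta_mx ord0 ord0 + s *: v) i ord0 - linf (L i) (delta_mx ord0 ord0 + s *: v).
have -> : F z i ord0 - linf (L i) z = g 1 by rewrite /g scale1r /v addrCA subrr addr0.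
have linE x y t : linf (L i) (x + t *: y) = linf (L i) x + t * linf (L i) y.
  by rewrite linfD linfZ.
have D0 : 0 < 1 + vnorm v by have := vnorm_ge0 v; lra.
apply: (@entire_identity R g 0 (1 / 2 / (1 + vnorm v))) => [|s|s].
- by rewrite !divr_gt0.
- apply: cdiffB; first exact: ventire_line.
  apply: (@cdiff_near _ (fun s => linf (L i) (delta_mx ord0 ord0) + s * linf (L i) v) _ s 1 ltr01).
    by move=> h _; rewrite linE.
  by apply: cdiffD; [exact: cdiff_cst | apply: cdiffM; [exact: cdiff_id | exact: cdiff_cst]].
rewrite subr0 ltr_pdivlMr // => sv; rewrite /g onK ?subrr //; apply: cone_near_axis.
by have := normc_ge0 s; have := vnorm_ge0 v; lra.
Qed.

(** Here [n > 1] enters: the extension uses one positive coordinate for the circle and a second one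
    to make whole lines in the first lie in the domain. *)
Lemma hartogs_extension_map (f : vec -> vec) : (1 < n)%N ->
  (forall z, 0 < hform z -> forall i, vdiff (fun y => f y i ord0) z) ->
  exists2 F, ventire F & forall z, 0 < hform z -> F z = f z.
Proof.
move=> n1 fd.
have j12 : Ordinal (ltnW n1) != Ordinal n1 by [].
have /choice[F hF] : forall i, exists Fi : vec -> R[i], (forall z, vdiff Fi z) /\
    (forall z, 0 < hform z -> Fi z = f z i ord0).
  by move=> i; apply: (hartogs_extension j12) => z zpos; exact: fd.
exists (fun z => \col_i F i z) => [z i|z zpos].
  by apply: (vdiff_near ltr01 _ ((hF i).1 z)) => h _; rewrite mxE.
by apply/matrixP => i k; rewrite (ord1 k) mxE; exact: (hF i).2.
Qed.

(** Every line in a positive coordinate direction is in the domain for large parameters, so the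
    identity theorem on that line carries the equation to all of space. *)
Lemma entire_cancel F G : (0 < n)%N -> ventire F -> ventire G ->
  (forall z, 0 < hform z -> F (G z) = z) -> cancel G F.
Proof.
move=> n0 Fd Gd FG z; apply/matrixP => i k; rewrite (ord1 k).
pose j : 'I_n := Ordinal n0; pose v : vec := delta_mx (lift ord0 j) ord0.
pose g s := F (G (z + s *: v)) i ord0 - (z + s *: v) i ord0.
apply/eqP; rewrite -subr_eq0; apply/eqP.
have -> : F (G z) i ord0 - z i ord0 = g 0 by rewrite /g scale0r addr0.
pose T := normc (z ord0 ord0) + normc (z (lift ord0 j) ord0).
have T0 : 0 <= T by rewrite addr_ge0 ?normc_ge0.
apply: (@entire_identity R g (T + 2)%:C 1) => // s.
  apply: cdiffB.
    apply: (@curve_cdiff _ _ (fun y => F y i ord0) (fun t => G (z + t *: v))) => // l.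
    exact: ventire_line.
  apply: (@cdiff_near _ (fun t => z i ord0 + t * v i ord0) _ s 1 ltr01) => [t _|]; first by rewrite !mxE.
  by apply: cdiffD; [exact: cdiff_cst | apply: cdiffM; [exact: cdiff_id | exact: cdiff_cst]].
move=> sT; rewrite /g FG ?subrr //; apply: (@hform_gt0_coord _ _ _ j).
rewrite !mxE !eqxx /= mulr0 addr0 mulr1.
have h1 := normc_ler_dist (T + 2)%:C s; rewrite normc_distC normcr ger0_norm in h1; last by lra.
have h2 := normc_ler_dist s (- z (lift ord0 j) ord0); rewrite normc_opp opprK addrC in h2.
rewrite [z _ _ + s]addrC; rewrite /T in h1 sT; lra.
Qed.

Lemma hform_gt0_open z : 0 < hform z ->
  exists2 r : R, 0 < r & forall h, vnorm h < r -> 0 < hform (z + h).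
Proof.
move=> zpos; pose K := \sum_j normc ((adjmx z *m Jmx R n) ord0 j).
have K0 : 0 <= K by apply: sumr_ge0 => j _; exact: normc_ge0.
exists (Num.min 1 (hform z / (2 * K + 1))) => [|h].
  by rewrite lt_min ltr01 divr_gt0 //; lra.
rewrite lt_min ltr_pdivlMr; last by lra.
move=> /andP[h1 h2]; have H0 := vnorm_ge0 h.
have hsK : `|Re (sform z h)| <= K * vnorm h.
  apply: (le_trans (Re_le_normc _)); rewrite /sform mxE; exact: (linf_bound ((adjmx z *m Jmx R n) ord0)).
(* Only [- normc h_0 ^+ 2] is negative, and [vnorm h < 1] makes it at least [- vnorm h]; the
   quadratic term is thus controlled linearly. *)
have hh : - vnorm h <= hform h.
  have c2 : normc (h ord0 ord0) ^+ 2 <= vnorm h.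
    have c0 := coord_le_vnorm h ord0.
    by rewrite expr2 (le_trans _ c0) // ler_piMl ?normc_ge0 // (le_trans c0) // ltW.
  have := sumr_ge0 (index_enum 'I_n) (P := xpredT) (F := fun j => normc (h (lift ord0 j) ord0) ^+ 2) (fun j _ => sqr_ge0 _).
  rewrite /hform; lra.
have := hform_expand z h 1; rewrite scale1r mul1r normc1 expr1n mul1r => ->.
move: hsK; rewrite ler_norml => /andP[? _]; lra.
Qed.

End ConeAutomorphisms.

(* Aut(D^{n,1}) = GU(n,1) acting by z |-> A z: a map is a biholomorphic
   self-map of D^{n,1} iff it agrees on D^{n,1} with z |-> A z for some
   A in GU(n,1). *)
Theorem theorem3p1 (R : realType) (n : nat) (hn : (1 < n)%N)
    (f : Cn R n -> Cn R n) :
  biholomorphic_self (Dn1 R n) f <->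
  exists A : 'M[R[i]]_n.+1, GU R n A /\ (forall z, Dn1 R n z -> f z = A *m z).
Proof.
have n0 : (0 < n)%N by exact: ltnW.
split=> [[fd fD [g [gd gD gf fg]]]|[A [AGU fA]]].
  have vd (u : Cn R n -> Cn R n) : holomorphic_on (Dn1 R n) u ->
      forall z, 0 < hform z -> forall i, vdiff (fun y => u y i ord0) z.
    by move=> ud z /Dn1E zD i; apply: differentiable_vdiff; exact: ud.
  have [F Fd FE] := hartogs_extension_map hn (vd f fd).
  have [G Gd GE] := hartogs_extension_map hn (vd g gd).
  have Fpos z : 0 < hform z -> 0 < hform (F z) by move=> zp; rewrite FE //; apply/Dn1E/fD/Dn1E.
  have Gpos z : 0 < hform z -> 0 < hform (G z) by move=> zp; rewrite GE //; apply/Dn1E/gD/Dn1E.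
  have GF : cancel G F.
    apply: entire_cancel => // z zp; rewrite FE; last exact: Gpos.
    by rewrite GE // fg //; apply/Dn1E.
  have FG : cancel F G.
    apply: entire_cancel => // z zp; rewrite GE; last exact: Fpos.
    by rewrite FE // gf //; apply/Dn1E.
  (* If [F z] were in the domain, so would be [G (F z) = z]. *)
  have coneF z : hform z <= 0 -> hform (F z) <= 0.
    by rewrite !leNgt; apply: contra => /Gpos; rewrite FG.
  have coneG z : hform z <= 0 -> hform (G z) <= 0.
    by rewrite !leNgt; apply: contra => /Fpos; rewrite GF.
  have [A FA] := cone_automorphism_linear n0 Fd Gd FG GF coneF coneG.
  have [B GB] := cone_automorphism_linear n0 Gd Fd GF FG coneG coneF.
  exists A; split; last by move=> z /Dn1E zp; rewrite -FE // FA.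
  apply: null_preserving_GU => //; last 2 first.
  - by move=> z; rewrite -FA; exact: Fpos.
  - by move=> z; rewrite -FA; exact: coneF.
  (* Invertibility of [A] is obtained from the matrix [B] of the inverse map. *)
  suff /mulmx1_unit[] : A *m B = 1%:M by [].
  apply/matrixP => i j; have := congr1 (fun x : 'cV[R[i]]_n.+1 => x i ord0) (GF (delta_mx j ord0)).
  rewrite FA GB mulmxA -colE mxE => ->.
  by rewrite !mxE andbT.
have [nu nu0 nuE] := GU_hform AGU.
have Aunit := AGU.1.
have Dnear (z : Cn R n) : Dn1 R n z -> exists2 r : R, 0 < r & forall h, vnorm h < r -> Dn1 R n (z + h).
  by move=> /Dn1E/hform_gt0_open[r r0 hr]; exists r => // h /hr /Dn1E.
split.
- move=> z zD; have [r r0 hr] := Dnear z zD.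
  by apply: (@differentiable_mulmx_near R n n A f z r r0) => h /hr; exact: fA.
- by move=> z zD; rewrite fA //; apply/Dn1E; rewrite nuE pmulr_rgt0 //; apply/Dn1E.
exists (fun z => invmx A *m z).
have invD z : Dn1 R n z -> Dn1 R n (invmx A *m z).
  move=> /Dn1E zp; apply/Dn1E; rewrite -(pmulr_rgt0 _ nu0) -nuE mulmxA mulmxV // mul1mx //.
split => //.
- by move=> z _; apply: (@differentiable_mulmx_near R n n (invmx A) _ z 1).
- by move=> z zD; rewrite fA // mulmxA mulVmx // mul1mx.
- by move=> z zD; rewrite fA ?mulmxA ?mulmxV ?mul1mx //; exact: invD.
Qed.
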